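(* Let $\Gamma$ be a distance-regular graph with valency $k\geq 3$, diameter $D\geq 2$, intersection number $a_1=1$ and distinct eigenvalues $\theta_0>\theta_1>\cdots>\theta_D$. If $c_2\geq 5$ and $\theta_D=-k/2$, then $c_2=5$ and $\Gamma$ is the Hermitian dual polar graph $^2A_{2D-1}(2)$.
   Context: A connected graph $\Gamma$ of diameter $D$ is distance-regular if there are integers $b_i,c_i$ ($0\le i\le D$) such that for any vertices $x,y$ at distance $i$, $y$ has exactly $c_i$ neighbours at distance $i-1$ from $x$ and $b_i$ neighbours at distance $i+1$ from $x$; $k=b_0$ is the valency and $a_i=k-b_i-c_i$. The eigenvalues are those of the adjacency matrix. The Hermitian dual polar graph $^2A_{2D-1}(r)$ has as vertices the maximal (dimension $D$) totally isotropic subspaces of $\mathbb{F}_{r^2}^{2D}$ with respect to a nondegenerate Hermitian form, two being adjacent when their intersection has dimension $D-1$. *)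

(* Defs.v *)
From HB Require Import structures.
From mathcomp Require Import all_boot all_order all_algebra all_field.
Set Implicit Arguments. Unset Strict Implicit. Unset Printing Implicit Defensive.
Import Order.TTheory GRing.Theory Num.Theory.

Section Graphs.
Variables (T : finType) (e : rel T).

Definition simple_graph : Prop := symmetric e /\ irreflexive e.

Fixpoint ball (n : nat) (x : T) : {set T} :=
  match n with
  | 0 => [set x]
  | n'.+1 => let B := ball n' x in B :|: [set z | [exists y in B, e y z]]
  end.

(* graph distance: least n with y in ball n x (equals #|T| if unreachable) *)
Definition gdist (x y : T) : nat := find (fun n => y \in ball n x) (iota 0 #|T|).

Definition connected_graph : Prop := forall x y, y \in ball #|T| x.

Definition diameter : nat := \max_(x : T) \max_(y : T) gdist x y.

Definition distance_regular (b c : nat -> nat) : Prop :=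
  [/\ simple_graph, connected_graph &
   forall x y, let i := gdist x y in
     #|[set z | e y z & gdist x z == i.-1]| = c i /\
     #|[set z | e y z & gdist x z == i.+1]| = b i].

Definition adjmx : 'M[algC]_#|T| :=
  \matrix_(i, j) ((e (enum_val i) (enum_val j))%:R)%R.

End Graphs.

Local Open Scope ring_scope.

Definition least_eigenvalue (n : nat) (A : 'M[algC]_n) (t : algC) : Prop :=
  eigenvalue A t /\ forall a, eigenvalue A a -> t <= a.

(* Hermitian dual polar graph: over F with #|F| = r^2, conjugation x |-> x^r,
   Hermitian form h(u,v) = u M (v^sigma)^T on F^(2D), M nondegenerate with
   M^T = M^sigma. Subspaces of F^(2D) are represented by their canonical
   generating square matrices (<<A>>%MS = A). *)
Definition hconj (F : fieldType) (r : nat) (x : F) : F := x ^+ r.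

Definition hdp_vertex (F : fieldType) (r D : nat) (M : 'M[F]_(D.*2))
    (A : 'M[F]_(D.*2)) : bool :=
  [&& (<<A>>%MS == A), \rank A == D &
      A *m M *m (map_mx (hconj r) A)^T == 0].

Definition hdp_adj (F : fieldType) (D : nat) (A B : 'M[F]_(D.*2)) : bool :=
  \rank (A :&: B)%MS == D.-1.

Definition is_hermitian_dual_polar (T : finType) (e : rel T) (D r : nat) : Prop :=
  exists F : finFieldType, #|F| = (r ^ 2)%N /\
  exists M : 'M[F]_(D.*2),
    [/\ M \in unitmx, M^T = map_mx (hconj r) M &
    exists f : T -> 'M[F]_(D.*2),
      [/\ injective f,
          forall x, hdp_vertex r M (f x),
          forall A, hdp_vertex r M A -> exists x, f x = A &
          forall x y, e x y = hdp_adj (f x) (f y)]].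

(* Main.v *)
(** In the representation of the graph on the eigenspace of [-k/2], the points of a line sum to
    zero, and comparing two points at distance 2 with their [c 2] common neighbours gives a
    vector whose squared norm is proportional to [5 - c 2]. Hence [c 2 = 5], the vector vanishes,
    and the cosine sequence is [(-1/2)^i]. Read at every vertex, the vanishing relations say how
    distances vary along lines and quadrangles. It follows that the neighbours of [x] on geodesics
    from [x] to an opposite vertex [y] form a projective space with lines of size 5, and this
    space is coordinatized over the field of order 4, one dimension at a time. For a vertex [v],
    the points not farther from [v] than [x] form a subspace [U], and there is a Hermitian form on
    [U] vanishing exactly at the points nearer to [v] than [x]; the graph of this form is a
    maximal totally isotropic subspace. This gives an injective adjacency-preserving map, and
    counting neighbours shows that it is an isomorphism. *)

(* The spectral part hands on only [c 2 = 5] and two relations, valid for every vertex p: the weight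
   (-1/2)^d(p,.) sums to zero over a line, and over a quadrangle x, z and common neighbours with
   coefficients 2, 2, 1. On a quadrangle they leave one ungeometric pattern: three common neighbours
   no farther from p than x, two of them nearer. Excluding it makes the points not farther than x a
   subspace. The obstacle to coordinates is that for D = 3 the space is only a plane, so that
   Desargues' theorem cannot be had from a third dimension. With five points on a line, a direction
   can instead be found by excluding four others, helped by a Fano property of parallelograms. A
   Hermitian form suits the geometry because over the field of order 4 its values h(b,b) lie in the
   prime field: they can record whether a point is nearer than x or at the same distance. Passing
   between adjacent vertices opposite to x flips this record exactly off a hyperplane, which is the
   effect of adding a form of rank one. *)
Require Import Defs.
From mathcomp Require Import all_boot all_order all_algebra all_field.
From mathcomp Require Import mxabelem.
From mathcomp Require Import zify ring lra.
Import Order.TTheory GRing.Theory Num.Theory.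
Set Implicit Arguments. Unset Strict Implicit. Unset Printing Implicit Defensive.

(* [lia] on the arithmetical hypotheses only: its preprocessing is slow in large contexts. *)
Ltac nlia := intros; repeat match goal with
  | H : ?P |- _ => lazymatch P with
    | @eq nat _ _ => fail | @eq (Equality.sort _) _ _ => fail
    | is_true (leq _ _) => fail | is_true (andb (leq _ _) _) => fail
    | is_true (negb (leq _ _)) => fail
    | is_true (negb (@eq_op Datatypes_nat__canonical__eqtype_Equality _ _)) => fail
    | is_true (@eq_op Datatypes_nat__canonical__eqtype_Equality _ _) => fail
    | _ /\ _ => fail | _ \/ _ => fail | is_true (leq _ _) -> _ => fail | _ -> False => fail
    | _ => lazymatch type of P with Prop => clear H end
    end
  end; repeat match goal with
  | H := _ |- _ => clearbody H end; lia.

(** * Distances and the eigenspace representation *)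

Section Distance.
Variables (T : finType) (e : rel T).
Hypotheses (e_sym : symmetric e) (e_irr : irreflexive e) (e_con : connected_graph e).
Local Notation d := (gdist e).

Lemma ball_mono m n x y : m <= n -> y \in ball e m x -> y \in ball e n x.
Proof.
move=> /subnK <-; elim: (n - m) => // k IH /IH yk.
by rewrite addSn /= inE yk.
Qed.

Lemma gdist_leq n x y : (d x y <= n) = (y \in ball e n x).
Proof.
rewrite /gdist; set p := fun n => _; set s := iota 0 #|T|.
have [hasp|nhas] := boolP (has p s).
- have ltf : find p s < #|T| by rewrite -[X in _ < X](size_iota 0) -has_find.
  have := nth_find 0 hasp; rewrite nth_iota // add0n => pf.
  apply/idP/idP => [le_fn|yn]; first exact: ball_mono le_fn pf.
  rewrite leqNgt; apply/negP => lt_nf.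
  have := before_find 0 lt_nf; rewrite nth_iota ?(ltn_trans lt_nf) // add0n.
  by rewrite /p yn.
- rewrite hasNfind // size_iota; apply/idP/idP => [le_n|yn].
    exact: ball_mono le_n (e_con _ _).
  rewrite leqNgt; apply/negP => lt_n; case/negP: nhas.
  by apply/hasP; exists n => //; rewrite mem_iota.
Qed.

Lemma gdist0 x y : (d x y == 0) = (x == y).
Proof. by rewrite -leqn0 gdist_leq inE eq_sym. Qed.

Lemma gdistxx x : d x x = 0.
Proof. by apply/eqP; rewrite gdist0. Qed.

Lemma gdistS n x y :
  (d x y <= n.+1) = (d x y <= n) || [exists z, (d x z <= n) && e z y].
Proof.
rewrite !gdist_leq /= !inE; congr (_ || _).
by apply: eq_existsb => z; rewrite gdist_leq.
Qed.

Lemma gdist_edge x y z : e y z -> d x z <= (d x y).+1.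
Proof.
by move=> eyz; rewrite gdistS; apply/orP; right; apply/existsP; exists y; rewrite leqnn.
Qed.

Lemma gdist_pred n x y : d x y = n.+1 -> exists2 z, e z y & d x z = n.
Proof.
move=> dxy; have := gdistS n x y; rewrite dxy leqnn ltnn /= => /esym/existsP[z].
case/andP=> dxz ezy; exists z => //; apply/eqP; rewrite eqn_leq dxz /=.
by have := gdist_edge x ezy; rewrite dxy.
Qed.

Lemma gdist_tri y x z : d x z <= d x y + d y z.
Proof.
move: {2}(d y z) (erefl (d y z)) => n; elim: n z => [|n IH] z dyz.
  by move/eqP: dyz; rewrite gdist0 => /eqP->; rewrite gdistxx addn0.
have [t etz dyt] := gdist_pred dyz.
have := gdist_edge x etz; have := IH t dyt; rewrite dyz dyt; lia.
Qed.

Lemma gdist_le_sym n x y : d x y = n -> d y x <= n.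
Proof.
elim: n x y => [|n IH] x y.
  by move/eqP; rewrite gdist0 => /eqP->; rewrite gdistxx.
move=> /gdist_pred[z ezy dxz]; have dzx := IH _ _ dxz.
apply: leq_trans (gdist_tri z _ _) _; rewrite -add1n leq_add //.
by have := @gdist_edge y y z; rewrite gdistxx e_sym => ->.
Qed.

Lemma gdistC x y : d x y = d y x.
Proof. by apply/eqP; rewrite eqn_leq !(gdist_le_sym (erefl _)). Qed.

Lemma gdist1 x y : (d x y == 1) = e x y.
Proof.
apply/eqP/idP => [/gdist_pred[z ezy /eqP]|exy]; first by rewrite gdist0 => /eqP->.
apply/eqP; rewrite eqn_leq lt0n gdist0.
have := gdist_edge x exy; rewrite gdistxx => ->.
by apply: contraL exy => /eqP->; rewrite e_irr.
Qed.

Lemma gdist_diam x y : d x y <= diameter e.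
Proof.
apply: leq_trans (leq_bigmax x); exact: (leq_bigmax y).
Qed.

Lemma diam_pair : 0 < diameter e -> exists x y, d x y = diameter e.
Proof.
move=> D0; have T0 : 0 < #|T|.
  rewrite lt0n; apply: contraTneq D0 => /card0_eq T0.
  by rewrite /diameter big_pred0.
have [x Ex] := @bigop.eq_bigmax T (fun x => \max_(y : T) d x y) T0.
have [y Ey] := @bigop.eq_bigmax T (fun y => d x y) T0.
by exists x, y; rewrite -Ey -Ex.
Qed.

Lemma gdist_mid i x y : i <= d x y -> exists2 z, d x z = i & d z y = d x y - i.
Proof.
move: {2}(d x y) (erefl (d x y)) => n; elim: n y => [|n IH] y dxy le_i.
  by exists x; rewrite ?gdistxx; lia.
have [t ety dxt] := gdist_pred dxy.
have [->|ne_i] := eqVneq i (d x y); first by exists y; rewrite ?subnn ?gdistxx.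
have [|z dxz dzt] := IH t dxt; first by rewrite dxt; lia.
exists z => //; have := gdist_edge z ety; have := gdist_tri z x y.
rewrite dzt dxt; lia.
Qed.

End Distance.

(** * Spheres, eigenfunctions and the cosine sequence of the eigenvalue -k/2 *)

Section Spectral.
Variables (T : finType) (e : rel T) (b c : nat -> nat).
Hypothesis drg : distance_regular e b c.
Local Notation d := (gdist e).
Local Notation D := (diameter e).
Local Notation k := (b 0).

Local Open Scope ring_scope.

Let e_sym : symmetric e. Proof. by case: drg => -[]. Qed.
Let e_irr : irreflexive e. Proof. by case: drg => -[]. Qed.
Let e_con : connected_graph e. Proof. by case: drg. Qed.

Lemma sum_nat_cond (P Q : pred T) :
  \sum_(z | P z) (Q z)%:R = #|[set z | P z & Q z]|%:R :> rat.
Proof.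
rewrite -natr_sum; congr _%:R; rewrite -sum1_card big_mkcond [RHS]big_mkcond /=.
by apply: eq_bigr => z _; rewrite inE; case: (P z); case: (Q z).
Qed.

Lemma card_c x y : #|[set z | e y z & d x z == (d x y).-1]| = c (d x y).
Proof. by case: drg => _ _ /(_ x y)[]. Qed.

Lemma card_b x y : #|[set z | e y z & d x z == (d x y).+1]| = b (d x y).
Proof. by case: drg => _ _ /(_ x y)[]. Qed.

Lemma card_nbr x : #|[set z | e x z]| = k.
Proof.
have := card_b x x; rewrite gdistxx // => <-; apply: eq_card => z.
by rewrite !inE gdist1 // andbb.
Qed.

Lemma gdist_nbr x y z : e y z -> (d x z <= (d x y).+1)%N && (d x y <= (d x z).+1)%N.
Proof. by move=> eyz; rewrite !gdist_edge // e_sym. Qed.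

(** The tridiagonal intersection matrix: the adjacency operator on functions of the distance to a
    fixed vertex. At [j = 0] the term [h j.-1] is harmless, as [c 0] is zero. *)
Definition nbr_op (h : nat -> rat) (j : nat) : rat :=
  (c j)%:R * h j.-1 + (k%:R - (b j)%:R - (c j)%:R) * h j + (b j)%:R * h j.+1.

Lemma sum_nbr h x y : \sum_(z | e y z) h (d x z) = nbr_op h (d x y).
Proof.
set i := d x y.
rewrite (eq_bigr (fun z => (d x z == i.-1)%:R * (h i.-1 - h i)
  + (d x z == i.+1)%:R * (h i.+1 - h i) + h i)) => [|z eyz]; last first.
  have := gdist_nbr x eyz; rewrite -/i; case: eqVneq => [->|ne1].
    case: eqVneq => [|ne2 _]; first by lia.
    by rewrite mul1r mul0r; ring.
  case: eqVneq => [->|ne2] => [_|/andP[le1 le2]]; first by rewrite mul1r mul0r; ring.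
  have -> : d x z = i by lia.
  by rewrite !mul0r !add0r.
rewrite !big_split /= -!mulr_suml !sum_nat_cond card_c card_b.
rewrite sumr_const -cardsE card_nbr -/i -mulr_natl /nbr_op; ring.
Qed.

Definition theta : rat := - k%:R / 2.
Definition eigenfun (g : T -> rat) := forall y, \sum_(z | e y z) g z = theta * g y.
Definition lam (g : T -> rat) x (h : nat -> rat) : rat := \sum_y g y * h (d x y).

(** The adjacency operator is self-adjoint, so it may be moved from [h] to the eigenfunction. *)
Lemma lam_nbr g x h : eigenfun g -> lam g x (nbr_op h) = theta * lam g x h.
Proof.
move=> eg; rewrite /lam mulr_sumr.
under eq_bigr do rewrite -sum_nbr mulr_sumr.
rewrite (exchange_big_dep xpredT) //=; apply: eq_bigr => z _.
rewrite mulrA -eg mulr_suml; apply: eq_bigl => y; exact: e_sym.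
Qed.

Lemma eq_lam g x h h' : (forall j, (j <= D)%N -> h j = h' j) -> lam g x h = lam g x h'.
Proof. by move=> hh'; apply: eq_bigr => y _; rewrite hh' // gdist_diam. Qed.

Lemma lamD g x h h' : lam g x (fun j => h j + h' j) = lam g x h + lam g x h'.
Proof. by rewrite /lam -big_split; apply: eq_bigr => y _; rewrite mulrDr. Qed.

Lemma lamZ g x a h : lam g x (fun j => a * h j) = a * lam g x h.
Proof. by rewrite /lam mulr_sumr; apply: eq_bigr => y _; rewrite mulrCA. Qed.

Definition sph i (j : nat) : rat := (j == i)%:R.

Lemma lam_sph0 g x : lam g x (sph 0) = g x.
Proof.
rewrite /lam (bigD1 x) //= /sph gdistxx // eqxx mulr1 big1 ?addr0 // => y /negPf yx.
by rewrite gdist0 // eq_sym yx mulr0.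
Qed.

Lemma c0 : (0 < D)%N -> c 0 = 0%N.
Proof.
move=> /diam_pair[x _]; have := card_c x x; rewrite gdistxx // => <-.
by apply: eq_card0 => z; rewrite !inE gdist0 //; apply/negP => /andP[+ /eqP xz];
  rewrite xz e_irr.
Qed.

Lemma nbr_sph i j : (0 < D)%N -> nbr_op (sph i) j = (c i.+1)%:R * sph i.+1 j
  + (k%:R - (b i)%:R - (c i)%:R) * sph i j
  + (if i is i'.+1 then (b i')%:R * sph i' j else 0).
Proof.
move=> /c0 c00; have E (f : nat -> rat) m n : f m * (m == n)%:R = f n * (m == n)%:R.
  by case: eqVneq => [->|]; rewrite ?mulr0.
rewrite /nbr_op /sph (E (fun j => k%:R - (b j)%:R - (c j)%:R)).
case: j => [|j]; case: i => [|i] //=; rewrite ?c00 ?mulr0 ?add0r ?addr0 ?mul0r ?eqSS //.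
  by rewrite (E (fun j => (b j)%:R) 0%N).
- by rewrite (E (fun j => (c j.+1)%:R)).
- by rewrite (E (fun j => (c j.+1)%:R)) (E (fun j => (b j)%:R) j.+1).
Qed.

Lemma b_gt0 i : (i < D)%N -> (0 < b i)%N.
Proof.
move=> iD; have [|x [y dxy]] := @diam_pair _ e; first by lia.
have [|z dxz dzy] := gdist_mid e_con (i := i.+1) (x := x) (y := y); first by rewrite dxy.
have [t etz dxt] := gdist_pred e_con dxz.
rewrite -dxt -card_b; apply/card_gt0P; exists z.
by rewrite inE etz dxz dxt eqxx.
Qed.

Lemma c_gt0 i : (i < D)%N -> (0 < c i.+1)%N.
Proof.
move=> iD; have [|x [y dxy]] := @diam_pair _ e; first by lia.
have [|z dxz dzy] := gdist_mid e_con (i := i.+1) (x := x) (y := y); first by rewrite dxy.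
have [t etz dxt] := gdist_pred e_con dxz.
rewrite -dxz -card_c; apply/card_gt0P; exists t.
by rewrite inE e_sym etz dxz dxt eqxx.
Qed.

Lemma gdist_up x y : (d x y < D)%N -> exists2 z, e y z & d x z = (d x y).+1.
Proof.
move/b_gt0; rewrite -card_b => /card_gt0P[z]; rewrite inE => /andP[eyz /eqP]; by exists z.
Qed.

(* The coefficient attached to [h] depends neither on the vertex nor on the eigenfunction. *)
Definition averaging (h : nat -> rat) :=
  exists a, forall g x, eigenfun g -> lam g x h = a * g x.

(** The matrix of distance [i] is a polynomial in the adjacency matrix. Only its value at [theta] is
    followed, by solving the three-term recurrence for the next sphere, where [c i.+1] is
    nonzero. *)
Lemma averaging_sph i : (0 < D)%N -> (i <= D)%N -> averaging (sph i).
Proof.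
move=> D0; elim/ltn_ind: i => -[|i] IH iD.
  by exists 1 => g x _; rewrite lam_sph0 mul1r.
have [a1 Ha1] := IH i (ltnSn _) (ltnW iD).
have [a0 Ha0] : exists a0, forall g x, eigenfun g ->
    lam g x (fun j => if i is i'.+1 then (b i')%:R * sph i' j else 0) = a0 * g x.
  case: i {a1 Ha1} IH iD => [|i] IH iD.
    by exists 0 => g x _; rewrite /lam big1 ?mul0r // => y _; rewrite mulr0.
  have [a0 Ha0] := IH i (ltnW (ltnSn _)) (ltnW (ltnW iD)).
  by exists ((b i)%:R * a0) => g x eg; rewrite lamZ Ha0 // mulrA.
exists ((theta * a1 - (k%:R - (b i)%:R - (c i)%:R) * a1 - a0) / (c i.+1)%:R) => g x eg.
have cn0 : (c i.+1)%:R != 0 :> rat by rewrite pnatr_eq0 -lt0n c_gt0.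
have := lam_nbr x (sph i) eg; rewrite (eq_lam _ _ (fun j _ => nbr_sph i j D0)).
rewrite !lamD !lamZ Ha1 // Ha0 // => E; apply: (mulfI cn0).
transitivity (theta * (a1 * g x) - (k%:R - (b i)%:R - (c i)%:R) * (a1 * g x) - a0 * g x).
  by rewrite -E; ring.
by field.
Qed.

Lemma averaging_all h : (0 < D)%N -> averaging h.
Proof.
move=> D0; suff H n : (n <= D.+1)%N -> averaging (fun j => \sum_(i < n) h i * sph i j).
  have [a Ha] := H D.+1 (leqnn _); exists a => g x eg; rewrite -Ha //.
  apply: eq_lam => j jD; rewrite (bigD1 (Ordinal (jD : (j < D.+1)%N))) //= /sph eqxx mulr1.
  rewrite big1 ?addr0 // => i ij; case: eqVneq => [ji|]; rewrite ?mulr0 //.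
  by case/eqP: ij; apply: val_inj.
elim: n => [|n IH] nD.
  exists 0 => g x eg; rewrite mul0r /lam big1 // => y _; by rewrite big_ord0 mulr0.
have [a Ha] := averaging_sph D0 nD.
have [a' Ha'] := IH (ltnW nD).
exists (a' + h n * a) => g x eg.
have -> : lam g x (fun j => \sum_(i < n.+1) h i * sph i j) =
    lam g x (fun j => \sum_(i < n) h i * sph i j + h n * sph n j).
  by apply: eq_bigr => y _; rewrite big_ord_recr.
by rewrite lamD lamZ Ha // Ha' // mulrDl mulrA.
Qed.

(** Two consecutive terms of the standard sequence of [theta]. Terms of index above the diameter are
    meaningless: they come from a division by [b D], which is zero. *)
Fixpoint cosine2 (n : nat) : rat * rat :=
  match n with
  | 0 => (1, (theta - (k%:R - (b 0)%:R - (c 0)%:R)) / (b 0)%:R)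
  | n'.+1 => let p := cosine2 n' in
     (p.2, ((theta - (k%:R - (b n)%:R - (c n)%:R)) * p.2 - (c n)%:R * p.1) / (b n)%:R)
  end.
Definition cosine n := (cosine2 n).1.

Lemma cosine_rec j : (j < D)%N -> nbr_op cosine j = theta * cosine j.
Proof.
move=> jD; have bn0 : (b j)%:R != 0 :> rat by rewrite pnatr_eq0 -lt0n b_gt0.
rewrite /nbr_op /cosine; case: j jD bn0 => [|j] jD bn0 /=.
  rewrite c0; last by lia. by field.
by field.
Qed.

Hypothesis D0 : (0 < D)%N.
Hypothesis theta_eig : exists2 g, eigenfun g & exists x, g x != 0.

(** Below the diameter the recurrence holds by construction; at the diameter it expresses that
    [theta] is an eigenvalue. If it failed there by [eps], pairing an eigenfunction with the defect
    would show that its sum over every sphere of radius [D] is zero; the recurrence carries this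
    down to radius 0, where the eigenfunction itself vanishes. *)
Lemma cosine_eig x : eigenfun (fun y => cosine (d x y)).
Proof.
move=> y; rewrite sum_nbr; have [jD|] := boolP (d x y < D)%N; first exact: cosine_rec.
rewrite -leqNgt => jD; have -> : d x y = D by apply/eqP; rewrite eqn_leq jD gdist_diam.
apply/eqP; rewrite -subr_eq0; set eps := _ - _; apply/eqP.
have [g eg [x0 gx0]] := theta_eig; apply: contraNeq gx0 => eps0; apply/eqP.
have lD z : lam g z (sph D) = 0.
  apply: (mulfI eps0); rewrite mulr0 -lamZ.
  rewrite (eq_lam _ _ (h' := fun j => nbr_op cosine j + (- theta) * cosine j)).
    by rewrite lamD lamZ lam_nbr // mulNr addrN.
  move=> j jD'; rewrite /sph; case: eqVneq => [->|ne]; first by rewrite mulr1 mulNr.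
  by rewrite mulr0 cosine_rec ?mulNr ?addrN // ltn_neqAle ne.
suff H n : (n <= D)%N -> forall z, lam g z (sph (D - n)%N) = 0 /\ lam g z (sph (D - n)%N.+1) = 0.
  by have [] := H D (leqnn _) x0; rewrite subnn lam_sph0.
elim: n => [|n IH] nD z.
  rewrite subn0 lD; split=> //; rewrite /lam big1 // => t _.
  by rewrite /sph; have := gdist_diam e z t; case: eqVneq => [->|]; rewrite ?mulr0 ?ltnn.
have [H0 H1] := IH (ltnW nD) z.
have E : (D - n = (D - n.+1).+1)%N by lia.
rewrite E in H0 H1; split=> //.
have := lam_nbr z (sph (D - n.+1)%N.+1) eg.
rewrite (eq_lam _ _ (fun j _ => nbr_sph _ j D0)) !lamD !lamZ H0 H1 !mulr0 !add0r => /eqP.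
rewrite mulf_eq0 => /orP[|/eqP //]; rewrite pnatr_eq0 => /eqP b0.
by have := @b_gt0 (D - n.+1)%N; rewrite b0; lia.
Qed.

(** The kernel [cosine (d x y)] is a positive multiple of the projection onto the eigenspace.
    Vectors of the representation can thus be handled as functions of [p], with sums over [p] as
    inner products. *)
Lemma cosine_gram : exists2 kap, 0 < kap &
  forall x y, \sum_p cosine (d p x) * cosine (d p y) = kap * cosine (d x y).
Proof.
have [kap Hk] := averaging_all cosine D0; exists kap.
  have [x _] := @diam_pair _ e D0.
  have := Hk _ x (cosine_eig x); rewrite gdistxx // mulr1 => <-.
  rewrite /lam (bigD1 x) //= gdistxx // mulr1 ltr_pwDl //.
  by apply: sumr_ge0 => y _; exact: sqr_ge0.
move=> x y; rewrite gdistC // -(Hk _ _ (cosine_eig y)) /lam.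
by apply: eq_bigr => p _; rewrite mulrC ![d p _]gdistC.
Qed.

End Spectral.

(** * Lines, quadrangles and the equality [c 2 = 5] *)

Section Lines.
Variables (T : finType) (e : rel T) (b c : nat -> nat).
Hypothesis drg : distance_regular e b c.
Hypothesis a1 : b 0 - b 1 - c 1 = 1.
Hypothesis D2 : 2 <= diameter e.
Hypothesis theta_eig : exists2 g, eigenfun e b g & exists x, (g x != 0)%R.
Local Notation d := (gdist e).
Local Notation D := (diameter e).
Local Notation k := (b 0).

Local Open Scope ring_scope.

Let e_sym : symmetric e. Proof. by case: drg => -[]. Qed.
Let e_irr : irreflexive e. Proof. by case: drg => -[]. Qed.
Let e_con : connected_graph e. Proof. by case: drg. Qed.
Let D0 : (0 < D)%N. Proof. exact: ltnW. Qed.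

Definition third (x y : T) : T := odflt x [pick z | e x z && e y z].

(** The common neighbours of adjacent vertices number [a_1], read off from the sphere of radius 1 by
    [sum_nbr]. *)
Lemma thirdP x y z : e x y -> e x z && e y z = (z == third x y).
Proof.
move=> exy; have dxy : d x y = 1%N by apply/eqP; rewrite gdist1.
have /eqP/cards1P[t Et] : #|[set z | e y z & d x z == 1%N]| = 1%N.
  apply/eqP; rewrite -(eqr_nat rat) -sum_nat_cond.
  have := sum_nbr drg (sph 1) x y; rewrite /nbr_op /sph dxy /= => ->.
  have -> : b 0 = (b 1 + c 1 + 1)%N by lia.
  by apply/eqP; rewrite !natrD; ring.
have Ht z' : e x z' && e y z' = (z' == t).
  by have := in_set1 z' t; rewrite -Et inE gdist1 // andbC.
rewrite /third; case: pickP => [z' /=|/(_ t)]; last by rewrite Ht eqxx.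
by rewrite !Ht => /eqP->.
Qed.

Lemma third_edge x y : e x y -> e x (third x y) && e y (third x y).
Proof. by move=> exy; rewrite thirdP. Qed.

Lemma thirdC x y : e x y -> third y x = third x y.
Proof. by move=> exy; apply/eqP; rewrite -thirdP // andbC third_edge // e_sym. Qed.

Lemma thirdK x y : e x y -> third x (third x y) = y.
Proof.
move=> exy; have /andP[ext eyt] := third_edge exy.
by apply/esym/eqP; rewrite -thirdP // exy e_sym.
Qed.

Lemma sum_third g x : \sum_(z | e x z) g (third x z) = \sum_(z | e x z) g z :> rat.
Proof.
rewrite [RHS](reindex_onto (third x) (third x)) => [|z]; last exact: thirdK.
apply: eq_bigl => z; apply/idP/andP => [exz|[ext /eqP E]].
  by have /andP[-> _] := third_edge exz; rewrite thirdK.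
by rewrite -E; have /andP[] := third_edge ext.
Qed.

(* [A + (k/2) I] is the Gram matrix of the point-line incidence. *)
Lemma line_sum g x y : eigenfun e b g -> e x y -> g x + g y + g (third x y) = 0.
Proof.
move=> eg; pose s x y := g x + g y + g (third x y).
(* The sum is [k * g x' + 2 * theta * g x'], the third points running over the neighbours again.
   Here the value -k/2 of the eigenvalue enters. *)
have s_nbr x' : \sum_(z | e x' z) s x' z = 0.
  rewrite /s !big_split /= sum_third eg sumr_const -cardsE (card_nbr drg).
  by rewrite /theta -mulr_natl; field.
have sC x' z : e x' z -> s z x' = s x' z.
  by move=> exz; rewrite /s thirdC // (addrC (g z)).
have sumsx : \sum_x' \sum_(z | e x' z) s x' z * g x' = 0.
  by rewrite big1 // => x' _; rewrite -mulr_suml s_nbr mul0r.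
have sumsz : \sum_x' \sum_(z | e x' z) s x' z * g z = 0.
  rewrite (exchange_big_dep xpredT) //= -[RHS]sumsx; apply: eq_bigr => z _.
  rewrite (eq_bigl (e z)) => [|x']; last exact: e_sym.
  by apply: eq_bigr => x' ezx; rewrite sC.
have sumst : \sum_x' \sum_(z | e x' z) s x' z * g (third x' z) = 0.
  rewrite -[RHS]sumsz; apply: eq_bigr => x' _; rewrite -[RHS]sum_third.
  apply: eq_bigr => z exz; rewrite /s thirdK //; ring.
have /psumr_eq0P H : \sum_x' \sum_(z | e x' z) s x' z * s x' z = 0.
  transitivity (\sum_x' \sum_(z | e x' z) (s x' z * g x' + s x' z * g z + s x' z * g (third x' z))).
    by apply: eq_bigr => x' _; apply: eq_bigr => z _; rewrite -!mulrDr.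
  under eq_bigr do rewrite !big_split /=.
  by rewrite !big_split /= sumsx sumsz sumst !addr0.
move=> exy; have /psumr_eq0P H2 : \sum_(z | e x z) s x z * s x z = 0.
  by apply: H => // x' _; apply: sumr_ge0 => z _; exact: sqr_ge0.
have /eqP : s x y * s x y = 0 by apply: H2 => // z _; exact: sqr_ge0.
by rewrite mulf_eq0 orbb => /eqP.
Qed.

Local Notation u := (cosine b c).

Lemma cos_line p x y : e x y -> u (d p x) + u (d p y) + u (d p (third x y)) = 0.
Proof. by move=> exy; exact: (line_sum (cosine_eig drg D0 theta_eig p) exy). Qed.

Lemma cos0 : u 0 = 1. Proof. by []. Qed.

Lemma cos1 : u 1 = - 1 / 2.
Proof.
have [x [y dxy]] := diam_pair D0.
have [z dxz _] : exists2 z, d x z = 1%N & d z y = (d x y - 1)%N.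
  by apply: gdist_mid => //; rewrite dxy.
have exz : e x z by rewrite -gdist1 // dxz.
have /andP[ext _] := third_edge exz.
have dxt : d x (third x z) = 1%N by apply/eqP; rewrite gdist1.
have := cos_line x exz; rewrite gdistxx // dxz dxt cos0; lra.
Qed.

(** A line through a neighbour of [x] and a vertex at distance 2 has its third vertex at distance 2
    as well, so [u 1 + 2 * u 2 = 0]. *)
Lemma cos2 : u 2 = 1 / 4.
Proof.
have [x [y' dxy']] := diam_pair D0.
have [y dxy _] : exists2 y, d x y = 2%N & d y y' = (d x y' - 2)%N.
  by apply: gdist_mid => //; rewrite dxy'.
have [z ezy dxz] := gdist_pred e_con dxy.
have /andP[ezt eyt] := third_edge ezy.
have exz : e x z by rewrite -gdist1 // dxz.
have dxt : d x (third z y) = 2%N.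
  have := gdist_nbr drg x ezt; rewrite dxz => /andP[le2 _].
  have := gdist_nbr drg x eyt; rewrite dxy => /andP[_ ge1].
  have [//|ne2] := eqVneq (d x (third z y)) 2%N.
  have dx1 : d x (third z y) = 1%N by lia.
  have ext : e x (third z y) by rewrite -gdist1 // dx1.
  have : x == third z (third z y) by rewrite -thirdP // (e_sym z x) exz (e_sym _ x).
  by rewrite thirdK // => /eqP xy; rewrite xy gdistxx in dxy.
have := cos_line x ezy; rewrite dxz dxy dxt cos1; lra.
Qed.

Definition cnbr (x y : T) : {set T} := [set z | e x z & e z y].

Lemma card_cnbr x y : d x y = 2%N -> #|cnbr x y| = c 2.
Proof.
move=> dxy; have := card_c drg x y; rewrite dxy => <-.
by apply: eq_card => z; rewrite !inE /= gdist1 // andbC e_sym.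
Qed.

Lemma cnbr_dist x y z z' : d x y = 2%N -> z \in cnbr x y -> z' \in cnbr x y -> z != z' ->
  d z z' = 2%N.
Proof.
rewrite !inE => dxy /andP[exz ezy] /andP[exz' ezy'] ne.
have := gdist_edge e_con z exz'; rewrite (gdistC e_sym e_con z x).
have -> : d x z = 1%N by apply/eqP; rewrite gdist1.
have : d z z' != 0%N by rewrite gdist0.
have : d z z' != 1%N; last by lia.
rewrite gdist1 //; apply/negP => ezz.
have : x == third z z' by rewrite -thirdP // e_sym exz e_sym exz'.
have : y == third z z' by rewrite -thirdP // ezy ezy'.
by move=> /eqP<- /eqP E; rewrite E gdistxx in dxy.
Qed.

Hypothesis c2 : (5 <= c 2)%N.

(* With [m = c 2], the vector [(m + 3)(x + y) + 4 * sum of the common neighbours] has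
   squared norm proportional to [5 - m] in the eigenspace representation. *)
Lemma cos_rel x y : d x y = 2%N ->
  c 2 = 5%N /\ forall p, 2 * u (d p x) + 2 * u (d p y) + \sum_(z in cnbr x y) u (d p z) = 0.
Proof.
move=> dxy; have [kap kap0 gram] := cosine_gram drg D0 theta_eig.
(* The weight [m + 3] makes [w] orthogonal to every common neighbour: that inner product is
   proportional to [- t + 4 * (1 + (m - 1) / 4)]. *)
have m5le := c2; set m := c 2 in m5le *; pose t : rat := m%:R + 3.
pose w p := t * u (d p x) + t * u (d p y) + 4 * \sum_(z in cnbr x y) u (d p z).
have ip q : \sum_p w p * u (d p q) =
    kap * (t * u (d x q) + t * u (d y q) + 4 * \sum_(z in cnbr x y) u (d z q)).
  transitivity (t * \sum_p u (d p x) * u (d p q) + t * (\sum_p u (d p y) * u (d p q))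
     + 4 * \sum_(z in cnbr x y) \sum_p u (d p z) * u (d p q)).
    rewrite exchange_big !mulr_sumr -!big_split /=; apply: eq_bigr => p _.
    rewrite /w -mulr_suml; ring.
  rewrite !gram; under eq_bigr do rewrite gram.
  rewrite -mulr_sumr; ring.
have dyx : d y x = 2%N by rewrite gdistC.
have dn z : z \in cnbr x y -> (d x z = 1%N) * (d y z = 1%N) * (d z x = 1%N) * (d z y = 1%N).
  rewrite !inE => /andP[exz ezy]; do !split; apply/eqP; rewrite gdist1 //; by rewrite e_sym.
have S1 (f : T -> rat) a : (forall z, z \in cnbr x y -> f z = a) -> \sum_(z in cnbr x y) f z = m%:R * a.
  move=> fa; rewrite (eq_bigr (fun=> a)) // sumr_const (card_cnbr dxy) -/m.
  by rewrite mulr_natl.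
have ipx : \sum_p w p * u (d p x) = kap * (15 - 3 * m%:R) / 4.
  rewrite ip gdistxx // dyx cos0 cos2 (S1 _ (u 1)) => [|z /dn ->] //.
  by rewrite cos1 /t; field.
have ipy : \sum_p w p * u (d p y) = kap * (15 - 3 * m%:R) / 4.
  rewrite ip gdistxx // dxy cos0 cos2 (S1 _ (u 1)) => [|z /dn ->] //.
  by rewrite cos1 /t; field.
have ipz z : z \in cnbr x y -> \sum_p w p * u (d p z) = 0.
  move=> zc; rewrite ip !(dn z zc) (bigD1 z) //= gdistxx // cos0 cos1.
  rewrite (eq_bigr (fun=> u 2)) => [|z' /andP[zc' ne]]; last first.
    by rewrite (cnbr_dist dxy).
  rewrite sumr_const cos2.
  have -> : #|(fun i => (i \in cnbr x y) && (i != z))| = m.-1.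
    have := cardD1 z (cnbr x y); rewrite (card_cnbr dxy) zc add1n -/m => -> /=.
    by apply: eq_card => i; rewrite unfold_in /= [RHS]inE andbC.
  have Em : m%:R = m.-1%:R + 1 :> rat by rewrite natr1; congr _%:R; lia.
  by rewrite /t Em -mulr_natl; field.
have nw : \sum_p w p * w p = kap * (3 / 2) * t * (5 - m%:R).
  transitivity (t * (\sum_p w p * u (d p x)) + t * (\sum_p w p * u (d p y))
     + 4 * \sum_(z in cnbr x y) \sum_p w p * u (d p z)).
    rewrite exchange_big !mulr_sumr -!big_split /=; apply: eq_bigr => p _.
    by rewrite -mulr_sumr {2}/w; ring.
  by rewrite ipx ipy big1 // /t; field.
have nw0 : 0 <= \sum_p w p * w p by apply: sumr_ge0 => p _; exact: sqr_ge0.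
have t0 : 0 < t by rewrite /t ltr_wpDl // ler0n.
have m5 : m = 5%N.
  apply/eqP; rewrite eqn_leq m5le andbT -(ler_nat rat).
  move: nw0; rewrite nw pmulr_rge0; last by rewrite !mulr_gt0.
  by rewrite subr_ge0.
split=> // p; have /psumr_eq0P H : \sum_p w p * w p = 0 by rewrite nw m5 subrr mulr0.
have : w p * w p = 0 by apply: H => // q _; exact: sqr_ge0.
move/eqP; rewrite mulf_eq0 orbb => /eqP; rewrite /w /t m5; lra.
Qed.

Definition wt (n : nat) : rat := (- 1 / 2) ^+ n.

(** Seen from a vertex [p] such that [y] lies between [x] and [p], [cos_rel] becomes the recurrence
    2 u_(n+2) + 5 u_(n+1) + 2 u_n = 0. Its characteristic roots are -1/2 and -2, and the first two
    terms select -1/2. *)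
Lemma cosE n : (n <= D)%N -> u n = wt n.
Proof.
elim/ltn_ind: n => -[|[|n]] IH nD; first by rewrite /wt expr0.
  by rewrite cos1 /wt expr1.
have [x [y' dxy']] := diam_pair D0.
have [p dxp _] : exists2 p, d x p = n.+2 & d p y' = (d x y' - n.+2)%N.
  by apply: gdist_mid => //; rewrite dxy'.
have [y dxy dyp] : exists2 y, d x y = 2%N & d y p = (d x p - 2)%N.
  by apply: gdist_mid => //; rewrite dxp.
have [_ /(_ p)] := cos_rel dxy.
have -> : d p x = n.+2 by rewrite gdistC.
have -> : d p y = n by rewrite gdistC // dyp dxp; lia.
rewrite (eq_bigr (fun=> u n.+1)) => [|z].
  rewrite sumr_const (card_cnbr dxy); have [-> _] := cos_rel dxy.
  rewrite (IH n) ?(IH n.+1) //; try lia.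
  rewrite /wt !exprS; lra.
rewrite inE => /andP[exz ezy]; congr u.
have eyz : e y z by rewrite e_sym.
have ezx : e z x by rewrite e_sym.
have := gdist_edge e_con p eyz; have := gdist_edge e_con p ezx.
rewrite (gdistC _ _ p x) // dxp (gdistC _ _ p y) // dyp dxp; lia.
Qed.

Lemma wt_line p x y : e x y -> wt (d p x) + wt (d p y) + wt (d p (third x y)) = 0.
Proof. by move=> exy; have := cos_line p exy; rewrite !cosE ?gdist_diam. Qed.

Lemma wt_rel p x y : d x y = 2%N ->
  2 * wt (d p x) + 2 * wt (d p y) + \sum_(z in cnbr x y) wt (d p z) = 0.
Proof.
move=> dxy; have [_ /(_ p) H] := cos_rel dxy; rewrite !cosE ?gdist_diam // in H; rewrite -[RHS]H.
by congr (_ + _); apply: eq_bigr => z _; rewrite cosE ?gdist_diam.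
Qed.

Lemma c2_eq5 : c 2 = 5%N.
Proof.
have [x [y' dxy']] := diam_pair D0.
have [y dxy _] : exists2 y, d x y = 2%N & d y y' = (d x y' - 2)%N.
  by apply: gdist_mid => //; rewrite dxy'.
by have [] := cos_rel dxy.
Qed.

End Lines.

Section Eigenvector.
Local Open Scope ring_scope.

(** A rational eigenvalue of a rational matrix has a rational eigenvector, so the positivity
    arguments can take place in the ordered field [rat]. *)
Lemma rational_eigenfun (T : finType) (e : rel T) (b : nat -> nat) :
  symmetric e -> eigenvalue (adjmx e) (- (b 0%N)%:R / 2) ->
  exists2 g, eigenfun e b g & exists x, g x != 0.
Proof.
move=> e_sym; pose A : 'M[rat]_#|T| := \matrix_(i, j) (e (enum_val i) (enum_val j))%:R.
have -> : adjmx e = map_mx ratr A.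
  by apply/matrixP => i j; rewrite !mxE rmorph_nat.
have -> : - (b 0%N)%:R / 2 = ratr (theta b) :> algC.
  by rewrite /theta rmorphM rmorphN fmorphV !rmorph_nat.
rewrite eigenvalue_map => /eigenvalueP[v vA v0].
exists (fun x => v 0 (enum_rank x)).
  move=> y; have /rowP/(_ (enum_rank y)) := vA; rewrite !mxE => <-.
  rewrite [RHS](reindex (@enum_rank T)) /=; last by apply: onW_bij; exact: enum_rank_bij.
  rewrite [LHS]big_mkcond; apply: eq_bigr => z _; rewrite mxE !enum_rankK e_sym.
  by case: ifP; rewrite ?mulr1 ?mulr0.
have /rV0Pn[i vi] := v0; by exists (enum_val i); rewrite enum_valK.
Qed.

End Eigenvector.

(** * Coordinates of projective spaces with lines of size 5 *)

Section Order4.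
Variable F : finFieldType.
Hypothesis cardF : #|F| = 4.
Local Open Scope ring_scope.

Lemma F4_exp (x : F) : x ^+ 4 = x.
Proof. by rewrite -{2}(expf_card x) cardF. Qed.

Lemma F4_add (x : F) : x + x = 0.
Proof.
have E : (1 + 1 : F) = 0.
  have E1 : 1 = -1 :> F by rewrite -[RHS]F4_exp -signr_odd expr0.
  by rewrite {1}E1 addNr.
by rewrite -(mulr1 x) -mulrDr E mulr0.
Qed.

Lemma F4_opp (x : F) : - x = x.
Proof. by apply/eqP; rewrite eq_sym -addr_eq0 F4_add. Qed.

Lemma F4_exp3 (x : F) : x != 0 -> x ^+ 3 = 1.
Proof. by move=> x0; apply: (mulfI x0); rewrite -exprS F4_exp mulr1. Qed.

Lemma F4_addv n (v : 'rV[F]_n) : v + v = 0.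
Proof. by apply/rowP => i; rewrite !mxE F4_add. Qed.

Lemma F4_oppv n (v : 'rV[F]_n) : - v = v.
Proof. by apply/rowP => i; rewrite !mxE F4_opp. Qed.

End Order4.

(** The exclusion principle for lines of size 5; it identifies a point at infinity from four that it
    is not. *)
Lemma five_points (T : finType) (l : {set T}) (A B C E y y' : T) :
  #|l| = 5 -> uniq [:: A; B; C; E] -> all (mem l) [:: A; B; C; E] ->
  y \in l -> y' \in l -> y \notin [:: A; B; C; E] -> y' \notin [:: A; B; C; E] -> y = y'.
Proof.
move=> l5 U /allP sub yl yl' ny ny'; apply/eqP/negPn/negP => ne.
have U6 : uniq [:: y, y' & [:: A; B; C; E]].
  by rewrite /= in U *; rewrite inE negb_or ne ny ny'.
have := card_uniqP U6; rewrite /= => E6.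
suff : #|[:: y, y' & [:: A; B; C; E]]| <= #|l| by rewrite E6 l5.
apply/subset_leq_card/subsetP => z; rewrite 2!in_cons.
by case/orP => [/eqP->|/orP[/eqP->|/sub]].
Qed.

Section Coordinates.
Variables (T : finType) (F : finFieldType) (ln : T -> T -> {set T}) (P : {set T}).
Hypothesis cardF : #|F| = 4.
Hypothesis ln_l : forall p q, p \in P -> q \in P -> p != q -> p \in ln p q.
Hypothesis ln_r : forall p q, p \in P -> q \in P -> p != q -> q \in ln p q.
Hypothesis ln_card : forall p q, p \in P -> q \in P -> p != q -> #|ln p q| = 5.
Hypothesis ln_eq : forall p q r s, p \in P -> q \in P -> p != q -> r \in ln p q -> s \in ln p q ->
  r != s -> ln r s = ln p q.

Definition line_closed (S : {set T}) :=
  S \subset P /\ forall p q, p \in S -> q \in S -> p != q -> ln p q \subset S.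
Definition plane (Pi : {set T}) := line_closed Pi /\
  forall p q r s, p \in Pi -> q \in Pi -> p != q -> r \in Pi -> s \in Pi -> r != s ->
    exists2 t, t \in ln p q & t \in ln r s.

Lemma ln_sym p q : p \in P -> q \in P -> p != q -> ln q p = ln p q.
Proof. by move=> pP qP pq; apply: ln_eq; rewrite ?ln_l ?ln_r // eq_sym. Qed.

Lemma ln_unique p q r s a b : p \in P -> q \in P -> p != q -> r \in P -> s \in P -> r != s ->
  a \in ln p q -> b \in ln p q -> a \in ln r s -> b \in ln r s -> a != b -> ln p q = ln r s.
Proof.
move=> pP qP pq rP sP rs a1 b1 a2 b2 ab.
by rewrite -(ln_eq pP qP pq a1 b1 ab) (ln_eq rP sP rs a2 b2 ab).
Qed.

(** * Parallelism in a plane of order 4 with line at infinity [l] *)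

Section AffinePlane.
Variables (Pi : {set T}) (e f : T).
Hypotheses (PiH : plane Pi) (ePi : e \in Pi) (fPi : f \in Pi) (ef : e != f).
Local Notation l := (ln e f).
Local Notation A := (Pi :\: l).

Let PiP p : p \in Pi -> p \in P. Proof. by case: PiH => -[/subsetP sub _] _; exact: sub. Qed.
Let PiA p : p \in A -> p \in Pi. Proof. by rewrite inE => /andP[]. Qed.
Let AP p : p \in A -> p \in P. Proof. by move/PiA/PiP. Qed.
Let lnPi p q r : p \in Pi -> q \in Pi -> p != q -> r \in ln p q -> r \in Pi.
Proof. by case: PiH => -[_ cl] _ pPi qPi pq; apply/subsetP/cl. Qed.
Let lPi r : r \in l -> r \in Pi. Proof. exact: lnPi. Qed.
Let notA p U : p \in A -> U \in l -> p != U.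
Proof. by rewrite inE => /andP[pn _] Ul; apply: contraNneq pn => ->. Qed.

(* The point at infinity of the line through two affine points. *)
Definition dir p q : T := odflt p [pick U in ln p q :&: l].

Lemma dirP p q : p \in A -> q \in A -> p != q -> dir p q \in l /\ dir p q \in ln p q.
Proof.
move=> pA qA pq; rewrite /dir; case: pickP => [U|none].
  by rewrite inE => /andP[].
case: PiH => _ meet; have [U U1 U2] := meet p q e f (PiA pA) (PiA qA) pq ePi fPi ef.
by have := none U; rewrite inE U1 U2.
Qed.

Lemma dir_eq p q U : p \in A -> q \in A -> p != q -> U \in l -> U \in ln p q -> dir p q = U.
Proof.
move=> pA qA pq Ul Uln; have [D1 D2] := dirP pA qA pq; apply/eqP/negPn/negP => ne.
move: (pA); rewrite inE => /andP[/negP []].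
rewrite -(ln_unique (AP pA) (AP qA) pq (PiP ePi) (PiP fPi) ef D2 Uln D1 Ul ne).
by rewrite ln_l ?AP.
Qed.

Lemma dirC p q : p \in A -> q \in A -> p != q -> dir q p = dir p q.
Proof.
move=> pA qA pq; have [D1 D2] := dirP pA qA pq; apply: dir_eq; rewrite 1?eq_sym //.
by rewrite ln_sym ?AP.
Qed.

Lemma dir_ln p q r : p \in A -> q \in A -> p != q -> r \in A -> r != p ->
  (dir p r == dir p q) = (r \in ln p q).
Proof.
move=> pA qA pq rA rp; have [D1 D2] := dirP pA qA pq.
have pr : p != r by rewrite eq_sym.
apply/eqP/idP => [E|rl].
  have [_ D4] := dirP pA rA pr; rewrite E in D4.
  rewrite (@ln_unique p q p r p (dir p q)) ?AP ?ln_l ?ln_r ?AP //; exact: notA.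
apply: dir_eq => //; rewrite (@ln_eq p q p r) ?AP ?ln_l ?AP //.
Qed.

Lemma dir_trans p q r : p \in A -> q \in A -> r \in A -> p != q -> p != r -> q != r ->
  dir p q = dir p r -> dir q r = dir p q.
Proof.
move=> pA qA rA pq pr qr E; have rp : r != p by rewrite eq_sym.
have rl : r \in ln p q by rewrite -dir_ln // E.
apply/eqP; rewrite -(dirC pA qA pq) dir_ln //; rewrite 1?eq_sym //.
by rewrite ln_sym ?AP.
Qed.

(** Two lines of the plane meet, and here not at infinity, since their points there differ. *)
Lemma dir_meet p U a s : p \in A -> a \in A -> s \in A -> a != s -> U \in l -> U != dir a s ->
  p \notin ln a s -> exists n, [/\ n \in ln a s, n \in A, n != p & dir p n = U].
Proof.
move=> pA aA sA as_ Ul Un pn; have pU := notA pA Ul.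
case: PiH => _ meet.
have [n n1 n2] := meet a s p U (PiA aA) (PiA sA) as_ (PiA pA) (lPi Ul) pU.
have np : n != p by apply: contraNneq pn => <-.
have nA : n \in A.
  rewrite inE (lnPi (PiA aA) (PiA sA) as_ n1) andbT; apply/negP => nl.
  have En : dir a s = n by apply: dir_eq.
  have UP := PiP (lPi Ul); rewrite -En in n2 nl np *.
  move: (pA); rewrite inE => /andP[/negP[]].
  have Un' : dir a s != U by rewrite eq_sym.
  rewrite -(ln_unique (AP pA) UP pU (PiP ePi) (PiP fPi) ef n2 (ln_r (AP pA) UP pU) nl Ul Un').
  exact: (ln_l (AP pA) UP pU).
exists n; split=> //; apply: dir_eq => //; first by rewrite eq_sym.
have UP := PiP (lPi Ul); have pn' : p != n by rewrite eq_sym.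
by rewrite (ln_eq (AP pA) UP pU (ln_l (AP pA) UP pU) n2 pn') (ln_r (AP pA) UP pU).
Qed.

Lemma dir_neq p q r : p \in A -> q \in A -> r \in A -> p != q -> p != r -> q != r ->
  dir p q != dir p r -> dir q r != dir p q.
Proof.
move=> pA qA rA pq pr qr; apply: contraNneq => E; have qp : q != p by rewrite eq_sym.
have E2 := dirC pA qA pq.
by rewrite (dir_trans qA pA rA) ?E2 ?E.
Qed.

(* If the diagonals were not parallel, the fifth point [G] at infinity would lie on no side,
   and the lines joining [G] to the vertices would be all the affine lines through [G]; but
   the intersection point of the diagonals lies on none of them. *)
Lemma fano a s t r : a \in A -> s \in A -> t \in A -> r \in A -> uniq [:: a; s; t; r] ->
  dir a s = dir t r -> dir a t = dir s r -> dir a s != dir a t -> dir a r = dir s t.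
Proof.
move=> aA sA tA rA; rewrite /= !inE !negb_or !andbT.
move=> /andP[/and3P[as_ at_ ar] /andP[/andP[st sr] tr]] EV EW VW; apply/eqP/negPn/negP => XZ.
have [sa ta ra] : [/\ s != a, t != a & r != a] by rewrite ![_ == a]eq_sym.
have [ts rs rt] : [/\ t != s, r != s & r != t] by rewrite [_ == t]eq_sym ![_ == s]eq_sym.
have VX : dir a s != dir a r.
  by apply: contraNneq VW => E; rewrite EW (dir_trans aA sA rA) // E.
have VZ : dir a s != dir s t.
  apply: contraNneq VW => E; rewrite (dir_trans sA aA tA) ?(dirC aA sA) // E.
have WX : dir a t != dir a r.
  by apply: contraNneq VW => E; rewrite EV (dir_trans aA tA rA) // E.
have WZ : dir a t != dir s t.
  apply: contraNneq VW => E.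
  by rewrite (dir_trans tA aA sA) ?(dirC aA tA) ?(dirC sA tA) // E.
have [Vl Vas] := dirP aA sA as_; have [Wl _] := dirP aA tA at_.
have [Xl Xar] := dirP aA rA ar; have [Zl Zst] := dirP sA tA st.
have [G Gl nG] : exists2 G, G \in l & G \notin [:: dir a s; dir a t; dir a r; dir s t].
  apply/subsetPn; apply/negP => /subset_leq_card.
  rewrite ln_card ?PiP // (card_uniqP _) //= !inE !negb_or VW VX VZ WX WZ XZ //.
move: nG; rewrite !inE !negb_or => /and4P[GV GW GX GZ].
case: (PiH) => _ meet; have [m mar mst] := meet a r s t (PiA aA) (PiA rA) ar (PiA sA) (PiA tA) st.
have mA : m \in A.
  rewrite inE (lnPi (PiA aA) (PiA rA) ar mar) andbT; apply/negP => ml.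
  by case/negP: XZ; rewrite (dir_eq aA rA ar ml mar) (dir_eq sA tA st ml mst).
have ma : m != a.
  apply: contraTneq mst => ->; rewrite -dir_ln // dirC //.
have mr : m != r.
  apply: contraTneq mst => ->; rewrite -dir_ln // -EW //.
have ms : m != s.
  apply: contraTneq mar => ->; rewrite -dir_ln //.
have mt : m != t.
  apply: contraTneq mar => ->; rewrite -dir_ln //.
have am : dir a m = dir a r by apply/eqP; rewrite dir_ln.
have sm : dir s m = dir s t by apply/eqP; rewrite dir_ln.
have rm : dir r m = dir a r.
  by rewrite -(dirC aA rA ar); apply/eqP; rewrite dir_ln // ln_sym ?AP.
have tm : dir t m = dir s t.
  by rewrite -(dirC sA tA st); apply/eqP; rewrite dir_ln // ln_sym ?AP.
have tn : t \notin ln a s by rewrite -dir_ln // eq_sym.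
have rn : r \notin ln a s by rewrite -dir_ln // eq_sym.
have mn : m \notin ln a s by rewrite -dir_ln // am eq_sym.
(* [n], [n'], [n''] are the projections of [t], [r], [m] from [G] on the line of [a] and [s].
   Together with [a], [s] and its point at infinity they would be six points of that line. *)
have [n [n1 nA nt En]] := dir_meet tA aA sA as_ Gl GV tn.
have [n' [n1' nA' nr En']] := dir_meet rA aA sA as_ Gl GV rn.
have [n'' [n1'' nA'' nm En'']] := dir_meet mA aA sA as_ Gl GV mn.
have neq p q z z' : p \in A -> q \in A -> p != q -> z \in A -> z' \in A -> z != p -> z' != q ->
    dir p z = G -> dir q z' = G -> dir p q != G -> z != z'.
  move=> pA qA pq zA zA' zp zq E1 E2; apply: contraNneq => Ez.
  rewrite -Ez in E2 zq *; have pz : p != z by rewrite eq_sym.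
  have qz : q != z by rewrite eq_sym.
  have h1 : dir z p = G by rewrite (dirC pA zA).
  have h2 : dir z q = G by rewrite (dirC qA zA).
  by rewrite (dir_trans zA pA qA) ?h1.
have nG p q z : p \in A -> q \in A -> p != q -> z \in A -> dir p z = G -> dir p q != G -> q != z.
  by move=> pA qA pq zA E; apply: contraNneq => ->; rewrite E.
have [gV gW gX gZ] : [/\ dir a s != G, dir a t != G, dir a r != G & dir s t != G].
  by rewrite ![_ == G]eq_sym.
have [am' sm' rm' tm'] : [/\ a != m, s != m, r != m & t != m] by rewrite ![_ == m]eq_sym.
have an : a != n by apply: (nG t); rewrite ?(dirC aA tA).
have an' : a != n' by apply: (nG r); rewrite ?(dirC aA rA).
have an'' : a != n'' by apply: (nG m); rewrite ?(dirC aA mA) ?am.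
have sn : s != n by apply: (nG t); rewrite ?(dirC sA tA).
have sn' : s != n' by apply: (nG r); rewrite ?(dirC sA rA) -?EW.
have sn'' : s != n'' by apply: (nG m); rewrite ?(dirC sA mA) ?sm.
have nn' : n != n' by apply: (neq t r); rewrite -?EV.
have nn'' : n != n'' by apply: (neq t m); rewrite ?tm.
have n'n'' : n' != n'' by apply: (neq r m); rewrite ?rm.
have U6 : uniq [:: dir a s; a; s; n; n'; n''].
  rewrite /= !inE !negb_or as_ an an' an'' sn sn' sn'' nn' nn'' n'n'' ![dir a s == _]eq_sym.
  by rewrite !(notA _ Vl).
have := card_uniqP U6; rewrite /= => E6.
suff : #|[:: dir a s; a; s; n; n'; n'']| <= #|ln a s| by rewrite E6 ln_card ?AP.
apply/subset_leq_card/subsetP; apply/allP.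
by rewrite /= Vas n1 n1' n1'' ln_l ?ln_r ?AP.
Qed.

End AffinePlane.

Hypothesis plane_ex : forall a b c, a \in P -> b \in P -> c \in P -> a != b -> c \notin ln a b ->
  exists Pi, plane Pi /\ [/\ a \in Pi, b \in Pi & c \in Pi].

Local Open Scope ring_scope.

(** Collinearity is asked only of [v + w]: rescaling the two vectors covers the other combinations,
    and a count of the five points shows that a line contains nothing else. *)
Definition coordinates (H : {set T}) n (pt : 'rV[F]_n -> T) :=
  [/\ forall v, v != 0 -> pt v \in H,
      forall h, h \in H -> exists2 v, v != 0 & pt v = h,
      forall v w, v != 0 -> w != 0 -> (pt v = pt w <-> exists l, w = l *: v) &
      forall v w, v != 0 -> w != 0 -> pt v != pt w -> pt (v + w) \in ln (pt v) (pt w)].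

Local Ltac vring := apply/rowP => ?; rewrite !mxE; ring.

(** * Vectors and points: independence and spans *)

Section Frame.
Variables (H : {set T}) (n : nat) (pt : 'rV[F]_n -> T).
Hypotheses (HP : line_closed H) (ptH : coordinates H pt).

Definition indep v w := [&& v != 0, w != 0 & pt v != pt w].

Let pt_in v : v != 0 -> pt v \in H. Proof. by case: ptH => h _ _ _; exact: h. Qed.
Let pt_eq v w : v != 0 -> w != 0 -> (pt v = pt w <-> exists l, w = l *: v).
Proof. by case: ptH => _ _ h _; exact: h. Qed.
Let ptP v : v != 0 -> pt v \in P.
Proof. by move=> v0; case: HP => /subsetP sub _; apply/sub/pt_in. Qed.

Lemma indep_sym v w : indep v w -> indep w v.
Proof. by case/and3P => v0 w0 vw; rewrite /indep w0 v0 eq_sym. Qed.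

Lemma pt_scale l v : l != 0 -> v != 0 -> pt (l *: v) = pt v.
Proof.
move=> l0 v0; apply/esym; rewrite pt_eq // ?scaler_eq0 ?negb_or ?l0 //.
by exists l.
Qed.

Lemma indepP v w a b : indep v w -> a *: v + b *: w = 0 -> a = 0 /\ b = 0.
Proof.
case/and3P => v0 w0 vw E; have [b0|b0] := eqVneq b 0.
  move: E; rewrite b0 scale0r addr0 => /eqP; rewrite scaler_eq0 (negbTE v0) orbF.
  by move/eqP.
case/eqP: vw; apply/pt_eq => //; exists (- (b^-1 * a)).
rewrite scaleNr -scalerA -[LHS](scalerK b0); have -> : b *: w = - (a *: v).
  by apply/eqP; rewrite -addr_eq0 addrC E.
by rewrite scalerN.
Qed.

Lemma indep_comb v w a b : indep v w -> (a != 0) || (b != 0) -> a *: v + b *: w != 0.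
Proof.
move=> vw ab; apply: contraTneq ab => /(indepP vw)[-> ->]; by rewrite eqxx.
Qed.

Lemma indep_pt v w a b c d : indep v w -> a * d - b * c != 0 ->
  indep (a *: v + b *: w) (c *: v + d *: w).
Proof.
move=> vw D; have ab : (a != 0) || (b != 0).
  by apply: contraNT D; rewrite negb_or !negbK => /andP[/eqP-> /eqP->]; rewrite !mul0r subrr.
have cd : (c != 0) || (d != 0).
  by apply: contraNT D; rewrite negb_or !negbK => /andP[/eqP-> /eqP->]; rewrite !mulr0 subrr.
rewrite /indep !indep_comb //=; apply: contraNneq D => E.
have /pt_eq [||l El] := E; rewrite ?indep_comb //.
have [] : c - l * a = 0 /\ d - l * b = 0.
  by apply: (indepP vw); rewrite -(subrr (c *: v + d *: w)) {2}El; vring.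
move=> /eqP + /eqP; rewrite !subr_eq0 => /eqP-> /eqP->; apply/eqP; ring.
Qed.

Lemma pt_add v w : indep v w -> pt (v + w) \in ln (pt v) (pt w).
Proof. by case/and3P; case: ptH => _ _ _; exact. Qed.

Lemma pt_comb v w a b : indep v w -> (a != 0) || (b != 0) ->
  pt (a *: v + b *: w) \in ln (pt v) (pt w).
Proof.
move=> vw; have /and3P[v0 w0 ne] := vw.
have [->|a0] /= := eqVneq a 0; have [->|b0] //= := eqVneq b 0 => _.
- by rewrite scale0r add0r pt_scale // ln_r ?ptP.
- by rewrite scale0r addr0 pt_scale // ln_l ?ptP.
rewrite -(pt_scale a0 v0) -(pt_scale b0 w0); case: ptH => _ _ _; apply.
- by rewrite scaler_eq0 negb_or a0.
- by rewrite scaler_eq0 negb_or b0.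
- by rewrite !pt_scale.
Qed.

(** [pt v] and the four points [pt (l *: v + w)] are distinct and lie on the line, which has only
    five points. *)
Lemma pt_span v w u : indep v w -> u != 0 -> pt u \in ln (pt v) (pt w) ->
  exists a b, u = a *: v + b *: w.
Proof.
move=> vw u0 ul; have /and3P[v0 w0 ne] := vw.
pose g (l : option F) := if l is Some l then pt (l *: v + 1 *: w) else pt v.
have wl0 l : l *: v + 1 *: w != 0 by rewrite indep_comb // oner_eq0 orbT.
have gI : injective g.
  have N l : pt v != pt (l *: v + 1 *: w).
    have : indep (1 *: v + 0 *: w) (l *: v + 1 *: w).
      by apply: indep_pt => //; rewrite mulr1 mul0r subr0 oner_eq0.
    by rewrite scale1r scale0r addr0 => /and3P[].
  case=> [l|] [l'|] //= E; [|by case/eqP: (N l) | by case/eqP: (N l')].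
  have [<- //|ll'] := eqVneq l l'.
  have /and3P[_ _ /eqP[]] : indep (l *: v + 1 *: w) (l' *: v + 1 *: w).
    by apply: indep_pt; rewrite // mulr1 mul1r subr_eq0.
  by [].
have Eg : codom g =i ln (pt v) (pt w).
  apply/subset_cardP.
    by rewrite card_codom // card_option cardF ln_card ?ptP.
  apply/subsetP => z /codomP[l ->]; case: l => [l|] /=; last by rewrite ln_l ?ptP.
  by rewrite pt_comb // oner_eq0 orbT.
have /codomP[l El] : pt u \in codom g by rewrite Eg.
case: l El => [l|] /= El.
  have /pt_eq [||m Em] := esym El; rewrite ?wl0 //.
  by exists (m * l), m; rewrite Em; vring.
have /pt_eq [||m Em] := esym El; rewrite ?v0 //.
by exists m, 0; rewrite scale0r addr0.
Qed.

(** * Extending coordinates from a hyperplane [H] to the space [S], with an affine origin [a] *)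

Section Hyperplane.
Variables (S : {set T}) (a : T).
Hypotheses (SP : line_closed S) (HS : H \subset S) (aS : a \in S) (aH : a \notin H).
Hypothesis SH : forall p q, p \in S -> q \in S -> p != q -> exists2 t, t \in ln p q & t \in H.

Local Notation A := (S :\: H).

Let S_P p : p \in S -> p \in P. Proof. by case: SP => /subsetP sub _; exact: sub. Qed.
Let H_S p : p \in H -> p \in S. Proof. by apply/subsetP. Qed.
Let A_S p : p \in A -> p \in S. Proof. by rewrite inE => /andP[]. Qed.
Let A_H p h : p \in A -> h \in H -> p != h.
Proof. by rewrite inE => /andP[pH _] hH; apply: contraNneq pH => ->. Qed.
Let lnS p q r : p \in S -> q \in S -> p != q -> r \in ln p q -> r \in S.
Proof. by case: SP => _ cl pS qS pq; apply/subsetP/cl. Qed.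
Let lnH p q r : p \in H -> q \in H -> p != q -> r \in ln p q -> r \in H.
Proof. by case: HP => _ cl pS qS pq; apply/subsetP/cl. Qed.
Let ptS v : v != 0 -> pt v \in S. Proof. by move/pt_in/H_S. Qed.
Let aA : a \in A. Proof. by rewrite inE aH. Qed.
Let apt v : v != 0 -> a != pt v. Proof. by move=> v0; apply: A_H; rewrite // pt_in. Qed.

Lemma infinity_uniq p q s t t' : p \in S -> q \in S -> p != q -> s \in ln p q -> s \notin H ->
  t \in ln p q -> t \in H -> t' \in ln p q -> t' \in H -> t = t'.
Proof.
move=> pS qS pq sl sH tl tH tl' tH'; apply/eqP/negPn/negP => tt.
by case/negP: sH; apply: (lnH tH tH' tt); rewrite (ln_eq (S_P pS) (S_P qS) pq tl tl' tt).
Qed.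

Lemma cone_uniq v w b : indep v w -> b \in ln a (pt v) -> b \in ln a (pt w) -> b = a.
Proof.
case/and3P => v0 w0 vw bv bw; apply/eqP/negPn/negP => ba.
case/eqP: vw; apply: (@infinity_uniq a (pt v) a); rewrite ?ptS ?pt_in ?apt ?ln_l ?ln_r ?S_P ?ptS ?apt //.
rewrite (@ln_unique a (pt v) a (pt w) a b) ?S_P ?ptS ?apt ?ln_l ?ln_r ?S_P ?ptS ?apt //.
by rewrite eq_sym.
Qed.

(* [s] and [t] correspond to [v] and [w] under an additive bijection sending [0] to [a]. *)
Definition paired v s w t :=
  [/\ indep v w, s \in ln a (pt v) :\: H, s != a, t \in ln a (pt w) :\: H & t != a] /\
  pt (v + w) \in ln s t.

Lemma cone_A v s : v != 0 -> s \in ln a (pt v) :\: H -> s \in A.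
Proof.
by move=> v0; rewrite !inE => /andP[-> sl]; rewrite (lnS aS (ptS v0)) // apt.
Qed.

Lemma cone_ln v s : v != 0 -> s \in ln a (pt v) -> s != a -> ln a s = ln a (pt v).
Proof.
move=> v0 sl sa; apply: ln_eq; rewrite ?ln_l ?S_P ?ptS ?apt //; by rewrite eq_sym.
Qed.

Lemma indep_add v w : indep v w -> indep v (v + w).
Proof.
move=> vw; have := @indep_pt v w 1 0 1 1 vw.
by rewrite mul1r mul0r subr0 oner_eq0 !scale1r scale0r addr0 => /(_ isT).
Qed.

Lemma paired_sym v s w t : paired v s w t -> paired w t v s.
Proof.
case=> -[vw sv sa tw ta] vst; split; first by split=> //; exact: indep_sym.
have /and3P[v0 w0 _] := vw; have sP := S_P (A_S (cone_A v0 sv)).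
have tP := S_P (A_S (cone_A w0 tw)).
have st : s != t.
  apply: contraNneq sa => E; apply/eqP/(cone_uniq vw).
    by move: sv; rewrite inE => /andP[].
  by move: tw; rewrite E inE => /andP[].
by rewrite addrC ln_sym.
Qed.

Lemma paired_ne v s w t : paired v s w t -> s != t.
Proof.
case=> -[vw sv sa tw ta] _; apply: contraNneq sa => E; apply/eqP/(cone_uniq vw).
  by move: sv; rewrite inE => /andP[].
by move: tw; rewrite E inE => /andP[].
Qed.

Lemma cone_plane v w : indep v w -> exists Pi, [/\ plane Pi, a \in Pi, pt v \in Pi & pt w \in Pi].
Proof.
move=> vw; have /and3P[v0 w0 ne] := vw.
have [|||||Pi [PiH [aPi vPi wPi]]] := @plane_ex a (pt v) (pt w); rewrite ?S_P ?ptS ?apt //.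
  apply: contraNN ne => wl; apply/eqP.
  apply: (@infinity_uniq a (pt v) a); rewrite ?ptS ?pt_in ?apt ?ln_l ?ln_r ?S_P ?ptS ?apt //.
by exists Pi.
Qed.

(** The point [t] is where the line from [s] to [pt (v + w)] meets the line from [a] to [pt w]; they
    meet because both lie in the plane of [a], [pt v] and [pt w]. *)
Lemma paired_ex v s w : indep v w -> s \in ln a (pt v) :\: H -> s != a -> exists t, paired v s w t.
Proof.
move=> vw sv sa; have /and3P[v0 w0 ne] := vw; have sA := cone_A v0 sv.
have [Pi [PiH aPi vPi wPi]] := cone_plane vw; have [[PiP cl] meet] := PiH.
have /and3P[_ vw0 nvw] := indep_add vw.
have vwl := pt_add vw.
have vwPi : pt (v + w) \in Pi by apply: (subsetP (cl _ _ vPi wPi ne)).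
have sl : s \in ln a (pt v) by move: sv; rewrite inE => /andP[].
have sPi : s \in Pi by apply: (subsetP (cl _ _ aPi vPi (apt v0))).
have svw : s != pt (v + w) by apply: A_H; rewrite // pt_in.
have [t t1 t2] := meet s (pt (v + w)) a (pt w) sPi vwPi svw aPi wPi (apt w0).
have sS := A_S sA; have sP := S_P sS; have pP := S_P (ptS vw0).
have nsH : s \notin H by move: sA; rewrite inE => /andP[].
have ta : t != a.
  apply/eqP => E; rewrite E in t1; case/eqP: nvw.
  have as_ : a != s by rewrite eq_sym.
  have El : ln a s = ln s (pt (v + w)).
    by apply: (ln_unique (S_P aS) sP as_ sP pP svw (a := a) (b := s)); rewrite ?ln_l ?ln_r ?S_P ?ptS.
  apply: (@infinity_uniq a (pt v) a); rewrite ?ptS ?pt_in ?apt ?ln_l ?ln_r ?S_P ?ptS ?apt //.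
  by rewrite -(cone_ln v0 sl sa) El ln_r.
have tH : t \notin H.
  apply/negP => tH; have E : t = pt w.
    by apply: (@infinity_uniq a (pt w) a); rewrite ?ptS ?pt_in ?apt ?ln_l ?ln_r ?S_P ?ptS ?apt.
  have /and3P[_ _ /eqP[]] := indep_add (indep_sym vw); rewrite -E addrC.
  by apply: (@infinity_uniq s (pt (v + w)) s); rewrite ?ptS ?pt_in ?ln_l ?ln_r.
exists t; split; first by split=> //; rewrite inE tH.
have st : s != t.
  apply: contraNneq sa => E; apply/eqP/(cone_uniq vw sl); by rewrite E.
by rewrite (ln_eq sP pP svw (ln_l sP pP svw) t1 st) ln_r.
Qed.

Lemma pt_det v w b c b' c' : indep v w -> (b != 0) || (c != 0) -> (b' != 0) || (c' != 0) ->
  (pt (b *: v + c *: w) == pt (b' *: v + c' *: w)) = (b * c' == c * b').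
Proof.
move=> vw n1 n2; apply/idP/idP; last first.
  move=> E; apply/eqP/pt_eq; rewrite ?indep_comb //; have [b0|b0] := eqVneq b 0.
    move: E n1; rewrite b0 eqxx mul0r eq_sym mulf_eq0 /= => /orP[/eqP->|/eqP b'0 c0]; rewrite ?eqxx //.
    exists (c' / c); rewrite b'0 !scale0r !add0r scalerA divfK //.
  exists (b' / b); rewrite scalerDr !scalerA divfK //; congr (_ + _ *: _).
  by apply: (mulfI b0); rewrite (eqP E); field.
by apply: contraTT; rewrite -subr_eq0 => /(indep_pt vw) /and3P[].
Qed.

(* Desargues' theorem, from the intersection of two planes. *)
Lemma paired_desargues v s w t x r : indep w x -> paired v s w t -> paired v s x r ->
  (forall b c, x != b *: v + c *: w) -> pt (w + x) \in ln t r.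
Proof.
move=> wx R1 R2 ncomb; have st := paired_ne R1; have sr := paired_ne R2.
case: R1 => -[vw sv sa tw ta] Z; case: R2 => -[vx _ _ rx ra] Y.
have /and3P[v0 w0 _] := vw; have /and3P[_ x0 _] := vx; have /and3P[_ _ nwx] := wx.
have sA := cone_A v0 sv; have tA := cone_A w0 tw; have rA := cone_A x0 rx.
have [sP tP rP] : [/\ s \in P, t \in P & r \in P] by split; apply/S_P/A_S.
have tl : t \in ln a (pt w) by move: tw; rewrite inE => /andP[].
have rl : r \in ln a (pt x) by move: rx; rewrite inE => /andP[].
have tr : t != r by apply: contraNneq ta => E; apply/eqP/(cone_uniq wx tl); rewrite E.
have sH : s \notin H by move: sA; rewrite inE => /andP[].
have tH : t \notin H by move: tA; rewrite inE => /andP[].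
have /and3P[_ vw0 _] := indep_add vw; have /and3P[_ vx0 _] := indep_add vx.
have ind : pt (v + w) != pt (v + x).
  apply: contraNneq (ncomb (-1) 0) => E; have /pt_eq [||l El] := E; rewrite ?vw0 ?vx0 //.
  case/eqP: (ncomb (l - 1) l); rewrite -[x](addKr v) El; vring.
have at_ : a != t by rewrite eq_sym.
have ar : a != r by rewrite eq_sym.
have [||Pi1 [[[PiP1 cl1] meet1] [aPi tPi rPi]]] := @plane_ex a t r _ tP rP at_.
- exact: S_P.
- rewrite (cone_ln w0 tl ta); apply: contraNN ra => rw; exact/eqP/(cone_uniq wx rw rl).
have wPi : pt w \in Pi1.
  by apply: (subsetP (cl1 _ _ aPi tPi at_)); rewrite (cone_ln w0 tl ta) ln_r ?S_P ?ptS ?apt.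
have xPi : pt x \in Pi1.
  by apply: (subsetP (cl1 _ _ aPi rPi ar)); rewrite (cone_ln x0 rl ra) ln_r ?S_P ?ptS ?apt.
have [y1 y1l y1h] := meet1 t r (pt w) (pt x) tPi rPi tr wPi xPi nwx.
have [|Pi2 [[[PiP2 cl2] meet2] [sPi2 tPi2 rPi2]]] := @plane_ex s t r sP tP rP st.
  apply: contraNN ind => rst; apply/eqP.
  apply: (@infinity_uniq s t s); rewrite ?A_S ?ln_l ?pt_in //.
  by rewrite -(ln_eq sP tP st (ln_l sP tP st) rst sr).
have [y2 y2l y2h] := meet2 t r (pt (v + w)) (pt (v + x)) tPi2 rPi2 tr
  (subsetP (cl2 _ _ sPi2 tPi2 st) _ Z) (subsetP (cl2 _ _ sPi2 rPi2 sr) _ Y) ind.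
have y1H : y1 \in H by apply: lnH y1h; rewrite ?pt_in.
have y2H : y2 \in H by apply: lnH y2h; rewrite ?pt_in.
have Ey : y1 = y2 by apply: (@infinity_uniq t r t); rewrite ?A_S ?ln_l.
have c1 := pt_add wx.
have i2 : indep (v + w) (v + x) by rewrite /indep vw0 vx0.
have c2 : pt (w + x) \in ln (pt (v + w)) (pt (v + x)).
  have -> : w + x = (v + w) + (v + x) by rewrite addrACA F4_addv // add0r.
  exact: pt_add.
suff -> : pt (w + x) = y1 by [].
(* With a second common point the lines [pt w], [pt x] and [pt (v + w)], [pt (v + x)] would
   coincide, and [x] would be a combination of [v] and [w]. *)
apply/eqP/negPn/negP => ne.
have El : ln (pt w) (pt x) = ln (pt (v + w)) (pt (v + x)).
  apply: (ln_unique _ _ nwx _ _ ind c1 y1h c2); rewrite ?Ey ?y2h -?Ey ?S_P ?ptS //.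
have [|b [c E]] := pt_span wx vw0; first by rewrite El ln_l ?S_P ?ptS.
have [c0|c0] := eqVneq c 0.
  have [] := @indepP v w 1 (1 - b) vw; last by move/eqP; rewrite oner_eq0.
  transitivity (v + w - b *: w); first by vring.
  by rewrite E c0 scale0r addr0 subrr.
case/eqP: (ncomb c^-1 (c^-1 * (1 - b))).
apply: (scalerI c0); rewrite scalerDr !scalerA mulrA mulfV // scale1r mul1r.
by apply: (addrI (b *: w)); rewrite -E; vring.
Qed.

(** No second plane is available here. The point at infinity of [t r] differs from those of [a t],
    [a r], [s t] and [s r], and so does [pt (w + x)]; if those four are distinct, one point of [l]
    remains. They coincide in part when [s], [t], [r] are collinear ([1 + b = c]), which is
    immediate, or when [b = 1] or [b = c]. *)
Lemma paired_planar v s w t x r : indep w x -> paired v s w t -> paired v s x r ->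
  (exists b c, x = b *: v + c *: w) -> pt (w + x) \in ln t r.
Proof.
move=> wx R1 R2 [b [c Ex]]; have st := paired_ne R1; have sr := paired_ne R2.
case: R1 => -[vw sv sa tw ta] Z; case: R2 => -[vx _ _ rx ra] Y.
have /and3P[v0 w0 nvw] := vw; have /and3P[_ x0 nvx] := vx; have /and3P[_ _ nwx] := wx.
have [sA tA rA] : [/\ s \in A, t \in A & r \in A] by split; apply: cone_A; last first; eassumption.
have tl : t \in ln a (pt w) by move: tw; rewrite inE => /andP[].
have rl : r \in ln a (pt x) by move: rx; rewrite inE => /andP[].
have sl : s \in ln a (pt v) by move: sv; rewrite inE => /andP[].
have tr : t != r by apply: contraNneq ta => E; apply/eqP/(cone_uniq wx tl); rewrite E.
have [as_ at_ ar] : [/\ a != s, a != t & a != r] by rewrite ![a == _]eq_sym.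
have b0 : b != 0.
  apply: contraNneq nwx => E; rewrite Ex E scale0r add0r.
  by rewrite pt_scale //; apply: contraNneq x0 => E'; rewrite Ex E E' !scale0r addr0.
have c0 : c != 0.
  apply: contraNneq nvx => E; rewrite Ex E scale0r addr0.
  by rewrite pt_scale.
have [Pi [PiH aPi vPi wPi]] := cone_plane vw; have [[PiP cl] meet] := PiH.
set l := ln (pt v) (pt w).
have lH h : h \in l -> h \in H by apply: lnH; rewrite ?pt_in.
pose B := Pi :\: l.
have inB p : p \in A -> p \in Pi -> p \in B.
  by rewrite !inE => /andP[pH _] ->; rewrite andbT; apply: contra pH; exact: lH.
have aB : a \in B by apply: inB.
have vl : pt v \in l by rewrite ln_l ?S_P ?ptS.
have wl : pt w \in l by rewrite ln_r ?S_P ?ptS.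
have xl : pt x \in l by rewrite Ex pt_comb // b0.
have sB : s \in B by apply: inB => //; apply: (subsetP (cl _ _ aPi vPi (apt v0))).
have tB : t \in B by apply: inB => //; apply: (subsetP (cl _ _ aPi wPi (apt w0))).
have xPi : pt x \in Pi by apply: (subsetP (cl _ _ vPi wPi nvw)).
have rB : r \in B by apply: inB => //; apply: (subsetP (cl _ _ aPi xPi (apt x0))).
have vx' : v + x = (1 + b) *: v + c *: w by rewrite Ex; vring.
have vw' : v + w = 1 *: v + 1 *: w by rewrite !scale1r.
have wx' : w + x = b *: v + (1 + c) *: w by rewrite Ex; vring.
have v' : v = 1 *: v + 0 *: w by rewrite scale1r scale0r addr0.
have w' : w = 0 *: v + 1 *: w by rewrite scale1r scale0r add0r.
have Zl : pt (v + w) \in l by rewrite vw' pt_comb ?oner_eq0.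
have Yl : pt (v + x) \in l by rewrite vx' pt_comb ?c0 ?orbT.
have Cl : pt (w + x) \in l by rewrite wx' pt_comb ?b0.
have dirE p q U : p \in B -> q \in B -> p != q -> U \in l -> U \in ln p q -> dir (pt v) (pt w) p q = U.
  by move=> pB qB pq Ul; apply: (@dir_eq Pi).
have conE u p : u != 0 -> p \in ln a (pt u) -> p != a -> pt u \in ln a p.
  by move=> u0 pl pa; rewrite (cone_ln u0 pl pa) ln_r ?S_P ?ptS ?apt.
have Das := dirE _ _ _ aB sB as_ vl (conE _ _ v0 sl sa).
have Dat := dirE _ _ _ aB tB at_ wl (conE _ _ w0 tl ta).
have Dar := dirE _ _ _ aB rB ar xl (conE _ _ x0 rl ra).
have Dst := dirE _ _ _ sB tB st Zl Z.
have Dsr := dirE _ _ _ sB rB sr Yl Y.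
pose dr := dir (pt v) (pt w).
have [Dl Dln] : dr t r \in l /\ dr t r \in ln t r by apply: (@dirP Pi).
suff -> : pt (w + x) = dr t r by [].
have det1 := @pt_det v w _ _ _ _ vw.
have nz : (b != 0) && (c != 0) by rewrite b0.
have YZ : (pt (v + x) == pt (v + w)) = (1 + b == c).
  by rewrite vx' vw' det1 ?c0 ?oner_eq0 ?orbT // !mulr1.
have [/eqP E|nE] := boolP (1 + b == c).
  have E1 : pt (w + x) = pt (v + w).
    by apply/eqP; rewrite wx' vw' det1 ?b0 ?oner_eq0 // !mulr1 -E addrA F4_add // add0r.
  rewrite E1 -Dst; apply/esym; apply: (@dir_trans Pi) => //.
  by rewrite Dst Dsr; apply/esym/eqP; rewrite YZ E.
have [tr' ts rs] : [/\ r != t, t != s & r != s] by rewrite [r == t]eq_sym ![_ == s]eq_sym.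
have ne1 : dr t r != pt w.
  by rewrite -Dat; apply: (@dir_neq Pi) => //; rewrite Dat Dar.
have ne2 : dr t r != pt x.
  by rewrite -Dar /dr -(@dirC Pi (pt v) (pt w) PiH) //; apply: (@dir_neq Pi); rewrite // Dat Dar eq_sym.
have ne3 : dr t r != pt (v + w).
  by rewrite -Dst; apply: (@dir_neq Pi) => //; rewrite Dst Dsr eq_sym YZ.
have ne4 : dr t r != pt (v + x).
  by rewrite -Dsr /dr -(@dirC Pi (pt v) (pt w) PiH) //; apply: (@dir_neq Pi); rewrite // Dst Dsr YZ.
have C1 : pt (w + x) != pt w.
  by rewrite wx' {2}w' det1 ?b0 ?oner_eq0 ?orbT // mulr1 mulr0.
have C2 : pt (w + x) != pt x.
  rewrite wx' Ex det1 ?b0 // -subr_eq0 (_ : _ - _ = - b) ?oppr_eq0 //; by ring.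
have C3 : pt (w + x) != pt (v + w).
  rewrite wx' vw' det1 ?b0 ?oner_eq0 // !mulr1; apply: contra nE => /eqP->.
  by rewrite addrA F4_add // add0r.
have C4 : pt (w + x) != pt (v + x).
  rewrite wx' vx' det1 ?b0 ?c0 ?orbT //; apply: contra nE => /eqP E.
  rewrite -subr_eq0 -[1 + b - c](F4_opp cardF) opprB.
  rewrite (_ : c - (1 + b) = (b * c - (1 + c) * (1 + b)) + (c + c)); last by ring.
  by rewrite E subrr F4_add // addr0.
have WY : (pt w == pt (v + x)) = (b == 1).
  by rewrite vx' {1}w' det1 ?c0 ?oner_eq0 ?orbT // mul0r mul1r eq_sym addrC addr_eq0 F4_opp.
have XZ : (pt x == pt (v + w)) = (b == c).
  by rewrite vw' {1}Ex det1 ?b0 ?oner_eq0 // !mulr1.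
have CV : (pt (w + x) == pt v) = (c == 1).
  by rewrite wx' {2}v' det1 ?b0 ?oner_eq0 // mulr0 mulr1 eq_sym addrC addr_eq0 F4_opp.
have VZ : pt v != pt (v + w) by have /and3P[] := indep_add vw.
have VY : pt v != pt (v + x) by have /and3P[] := indep_add vx.
have WZ : pt w != pt (v + w) by have /and3P[_ _] := indep_add (indep_sym vw); rewrite addrC.
have XY : pt x != pt (v + x) by have /and3P[_ _] := indep_add (indep_sym vx); rewrite addrC.
have ZY : pt (v + w) != pt (v + x) by rewrite eq_sym YZ.
have l5 : #|l| = 5 by rewrite ln_card ?S_P ?ptS.
rewrite -/dr in Das Dat Dar Dst Dsr.
have sym p q : p \in B -> q \in B -> p != q -> dr q p = dr p q by move=> *; apply: (@dirC Pi).
have [b1|nb1] := eqVneq b 1; have [bc|nbc] := eqVneq b c.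
(* For [b = 1] the points [pt w] and [pt (v + x)] coincide, for [b = c] the points [pt x] and
   [pt (v + w)]. If both happen, [fano] gives the direction [pt v] at once; if only one does, [fano]
   excludes [pt v], which then serves as the missing fourth excluded point. *)
- have E : dr a s = dr r t.
    apply: (@fano Pi) => //; rewrite -/dr.
    + by rewrite /= !inE !negb_or ar at_ as_ tr' rs ts.
    + by rewrite Dar sym // Dst; apply/eqP; rewrite XZ bc.
    + by rewrite Dat sym // Dsr; apply/eqP; rewrite WY b1.
    + by rewrite Dat Dar eq_sym.
  by rewrite sym // -E Das; apply/eqP; rewrite CV -bc b1.
- have ne5 : dr t r != pt v.
    apply: contra nbc => /eqP E; rewrite -XZ -Dar -Dst; apply/eqP.
    apply: (@fano Pi) => //; rewrite -/dr.
    + by rewrite /= !inE !negb_or at_ ar as_ tr sr st.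
    + by rewrite Das E.
    + by rewrite Dat Dsr; apply/eqP; rewrite WY b1.
    + by rewrite Das Dat.
  apply: (@five_points _ l (pt w) (pt x) (pt (v + w)) (pt v)) => //.
  + by rewrite /= !inE !negb_or nwx WZ XZ nbc ![_ == pt v]eq_sym nvw nvx VZ.
  + by rewrite /= wl xl Zl vl.
  + by rewrite !inE !negb_or C1 C2 C3 CV -b1 eq_sym.
  + by rewrite !inE !negb_or ne1 ne2 ne3.
- have ne5 : dr t r != pt v.
    apply: contra nb1 => /eqP E; rewrite -WY -Dat -Dsr; apply/eqP.
    apply: (@fano Pi) => //; rewrite -/dr.
    + by rewrite /= !inE !negb_or as_ ar at_ sr st tr'.
    + by rewrite Das sym // E.
    + by rewrite Dar Dst; apply/eqP; rewrite XZ bc.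
    + by rewrite Das Dar.
  apply: (@five_points _ l (pt w) (pt x) (pt (v + x)) (pt v)) => //.
  + by rewrite /= !inE !negb_or nwx WY nb1 XY ![_ == pt v]eq_sym nvw nvx VY.
  + by rewrite /= wl xl Yl vl.
  + by rewrite !inE !negb_or C1 C2 C4 CV -bc.
  + by rewrite !inE !negb_or ne1 ne2 ne4.
apply: (@five_points _ l (pt w) (pt x) (pt (v + w)) (pt (v + x))) => //.
- by rewrite /= !inE !negb_or nwx WZ WY nb1 XZ nbc XY ZY.
- by rewrite /= wl xl Zl Yl.
- by rewrite !inE !negb_or C1 C2 C3 C4.
- by rewrite !inE !negb_or ne1 ne2 ne3 ne4.
Qed.

Lemma paired_trans v s w t x r : indep w x -> paired v s w t -> paired v s x r -> paired w t x r.
Proof.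
move=> wx R1 R2; split.
  by case: R1 => -[_ _ _ tw ta] _; case: R2 => -[_ _ _ rx ra] _.
have [/existsP[b /existsP[c /eqP E]]|none] := boolP [exists b, exists c, x == b *: v + c *: w].
  by apply: (paired_planar wx R1 R2); exists b, c.
apply: (paired_desargues wx R1 R2) => b c; apply: contraNneq none => E.
by apply/existsP; exists b; apply/existsP; exists c; rewrite E.
Qed.

(** In characteristic 2 the sum [v + w] is the difference, so the last clause says that the line
    joining two images has the expected point at infinity. *)
Definition affine_chart (psi : 'rV[F]_n -> T) :=
  [/\ forall v, psi v \in A, forall s, s \in A -> exists v, psi v = s,
      forall v w, v != w -> psi v != psi w &
      forall v w, v != w -> pt (v + w) \in ln (psi v) (psi w)].

(** [H] is a single point and [S] a single line, so any bijection from the vectors onto the four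
    remaining points will do. *)
Lemma chart_of_line : (forall v w, v != 0 -> w != 0 -> pt v = pt w) -> n = 1%N ->
  exists psi, affine_chart psi.
Proof.
move=> ptc n1; have /card_gt0P[v0 v0n] : (0 < #|[pred v : 'rV[F]_n | v != 0%R]|)%N.
  apply/card_gt0P; exists (const_mx 1); rewrite inE; apply/eqP => /rowP/(_ (cast_ord (esym n1) ord0)).
  by rewrite !mxE => /eqP; rewrite oner_eq0.
rewrite inE in v0n; pose h := pt v0.
have Hh : H = [set h].
  apply/setP => x; rewrite inE; apply/idP/eqP => [xH|->]; last exact: pt_in.
  by case: ptH => _ /(_ x xH) [w w0 <-] _ _; exact: ptc.
have ah : a != h := apt v0n.
have hP : h \in P := S_P (ptS v0n).
have hS : h \in S := ptS v0n.
have ES : S = ln a h.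
  apply/setP => s; apply/idP/idP => [sS|]; last exact: lnS.
  have [->|sa] := eqVneq s a; first by rewrite ln_l // S_P.
  have as_ : a != s by rewrite eq_sym.
  have [t tl] := SH aS sS as_; rewrite Hh inE => /eqP Et; rewrite Et in tl.
  by rewrite (ln_eq (S_P aS) (S_P sS) as_ _ tl ah) ?ln_r ?ln_l ?S_P.
have cA : #|[set: 'rV[F]_n]| = #|A|.
  rewrite cardsT card_mx n1 muln1 expn1 cardF; have := cardsD1 h S.
  by rewrite hS -Hh ES ln_card ?S_P // => -[].
have cA' : #|'rV[F]_n| = #|A| by rewrite -cA cardsT.
have EA s t : s \in A -> t \in A -> s != t -> ln s t = S.
  move=> sA tA st; rewrite ES; apply: ln_eq; rewrite ?S_P // -ES; exact: A_S.
exists (fun v => enum_val (cast_ord cA' (enum_rank v))); split=> [v|s sA|v w vw|v w vw].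
- exact: enum_valP.
- exists (enum_val (cast_ord (esym cA') (enum_rank_in sA s))).
  by rewrite enum_valK cast_ordKV enum_rankK_in.
- by apply: contraNneq vw => /enum_val_inj /cast_ord_inj /enum_rank_inj ->.
- rewrite EA ?enum_valP //; last first.
    by apply: contraNneq vw => /enum_val_inj /cast_ord_inj /enum_rank_inj ->.
  apply: ptS; apply: contraNneq vw => E; rewrite -[v]addr0 -E addrA F4_addv //.
  by rewrite add0r.
Qed.

Definition transport v s w : T :=
  odflt a [pick t | [&& t \in ln a (pt w) :\: H, t != a & pt (v + w) \in ln s t]].

Lemma transportP v s w : indep v w -> s \in ln a (pt v) :\: H -> s != a -> paired v s w (transport v s w).
Proof.
move=> vw sv sa; rewrite /transport; case: pickP => [t /and3P[h1 h2 h3] // | none].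
have [t [[_ _ _ h1 h2] h3]] := paired_ex vw sv sa.
by have := none t; rewrite h1 h2 h3.
Qed.

(** A point [b], meant as the image of [e], determines the chart by [transport]. Multiples of [e]
    cannot be reached from [e] and are transported from [f]; to compare a multiple of [e] with a
    multiple of [f], one passes through [e + f]. *)
Lemma chart_of_indep e f : indep e f -> exists psi, affine_chart psi.
Proof.
move=> ef; have /and3P[e0 f0 nef] := ef.
have [b bl ba] : exists2 b, b \in ln a (pt e) :\: H & b != a.
  have : ~~ (ln a (pt e) \subset [set a; pt e]).
    apply/negP => /subset_leq_card; rewrite ln_card ?S_P ?ptS ?apt // cards2.
    by case: (_ != _).
  case/subsetPn => b bl; rewrite !inE negb_or => /andP[ba bp]; exists b => //.
  rewrite inE bl andbT; apply: contra bp => bH; apply/eqP.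
  apply: (@infinity_uniq a (pt e) a); rewrite ?ptS ?pt_in ?apt ?ln_l ?ln_r ?S_P ?ptS ?apt //.
pose psi1 v := transport e b v.
pose psi v := if v == 0 then a else if indep e v then psi1 v else transport f (psi1 f) v.
have psiE v : indep e v -> paired e b v (psi v).
  move=> ev; have /and3P[_ v0 _] := ev.
  by rewrite /psi (negbTE v0) ev; apply: transportP.
have nindep v : v != 0 -> ~~ indep e v -> pt v = pt e.
  by move=> v0; rewrite /indep e0 v0 /= negbK => /eqP.
have psiN v : v != 0 -> ~~ indep e v -> paired f (psi f) v (psi v).
  move=> v0 nv; have [[_ _ _ fl fa] _] := psiE f ef.
  rewrite {2}/psi (negbTE v0) (negbTE nv) {1}/psi (negbTE f0) ef.
  rewrite /psi (negbTE f0) ef in fl fa; apply: transportP => //.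
  by rewrite /indep f0 v0 (nindep _ v0 nv) eq_sym.
have case1 v w : indep e v -> indep e w -> indep v w -> paired v (psi v) w (psi w).
  by move=> ev ew vw; apply: (paired_trans vw (psiE v ev) (psiE w ew)).
have case2 v w : v != 0 -> ~~ indep e v -> indep v w -> indep f w -> paired v (psi v) w (psi w).
  move=> v0 nv vw fw; have ew : indep e w.
    by case/and3P: vw => _ w0; rewrite (nindep _ v0 nv) /indep e0 w0.
  exact: (paired_trans vw (psiN v v0 nv) (case1 _ _ ef ew fw)).
have case3 v w : v != 0 -> ~~ indep e v -> indep v w -> paired v (psi v) w (psi w).
  move=> v0 nv vw; have [fw|nfw] := boolP (indep f w); first exact: case2.
  have /and3P[_ w0 nvw] := vw.
  have Ew : pt w = pt f by move: nfw; rewrite /indep f0 w0 /= negbK => /eqP.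
  have eg := indep_add ef; have fg : indep f (e + f) by rewrite addrC; apply/indep_add/indep_sym.
  have /and3P[_ g0 neg] := eg; have /and3P[_ _ nfg] := fg.
  have ew : indep e w by rewrite /indep e0 w0 Ew.
  have vg : indep v (e + f) by rewrite /indep v0 g0 (nindep _ v0 nv).
  have gw : indep (e + f) w by rewrite /indep g0 w0 Ew eq_sym.
  exact: (paired_trans vw (paired_sym (case2 _ _ v0 nv vg fg)) (case1 _ _ eg ew gw)).
have psi_rel v w : indep v w -> paired v (psi v) w (psi w).
  move=> vw; have /and3P[v0 w0 _] := vw.
  have [ev|nv] := boolP (indep e v); last exact: case3.
  have [ew|nw] := boolP (indep e w); first exact: case1.
  exact/paired_sym/case3/indep_sym.
have other v : v != 0 -> exists w, indep v w.
  move=> v0; have [ev|nv] := boolP (indep e v); first by exists e; apply: indep_sym.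
  by exists f; rewrite /indep v0 f0 (nindep _ v0 nv).
have psi0 : psi 0 = a by rewrite /psi eqxx.
have psi_cone v : v != 0 -> psi v \in ln a (pt v) :\: H /\ psi v != a.
  by move=> v0; have [w vw] := other v v0; have [[_ h1 h2 _ _] _] := psi_rel v w vw.
have psiA v : psi v \in A.
  have [->|v0] := eqVneq v 0; first by rewrite psi0.
  by have [h _] := psi_cone v v0; apply: cone_A h.
have psiL v : v != 0 -> psi v \in ln a (pt v).
  by move=> v0; have [] := psi_cone v v0; rewrite inE => /andP[].
have psiI v w : v != w -> psi v != psi w.
  have [->|v0] := eqVneq v 0.
    by rewrite psi0 eq_sym => w0; rewrite eq_sym; have [] := psi_cone w w0.
  have [->|w0] := eqVneq w 0; first by rewrite psi0; have [] := psi_cone v v0.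
  have [vw|] := boolP (indep v w); first by move=> _; apply: paired_ne (psi_rel v w vw).
  rewrite /indep v0 w0 /= negbK => /eqP E; apply: contraNneq => Es.
  have /pt_eq [||l El] := E; rewrite ?v0 ?w0 //.
  have [x vx] := other v v0; have /and3P[_ x0 nvx] := vx.
  have wx : indep w x by rewrite /indep w0 x0 -E.
  have [[_ _ _ _ _] m1] := psi_rel v x vx; have [_ m2] := psi_rel w x wx; rewrite -Es in m2.
  have sx := paired_ne (psi_rel v x vx).
  have /and3P[_ vx0 _] := indep_add vx; have /and3P[_ wx0 _] := indep_add wx.
  have : pt (v + x) = pt (w + x).
    apply: (@infinity_uniq (psi v) (psi x) (psi v)); rewrite ?A_S ?ln_l ?S_P ?A_S ?pt_in //.
    by have := psiA v; rewrite inE => /andP[].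
  have -> : v + x = 1 *: v + 1 *: x by rewrite !scale1r.
  have -> : w + x = l *: v + 1 *: x by rewrite El scale1r.
  move/eqP; rewrite pt_det ?oner_eq0 ?orbT // !mul1r => /eqP l1.
  by rewrite El -l1 scale1r.
exists psi; split=> // [s sA|v w vw].
  have [->|sa] := eqVneq s a; first by exists 0.
  have as_ : a != s by rewrite eq_sym.
  have [h hl hH] := SH aS (A_S sA) as_.
  have [v v0 Ev] : exists2 v, v != 0 & pt v = h by case: ptH => _ /(_ h hH).
  have ah : a != h by apply: A_H.
  have El : ln a (pt v) = ln a s.
    by rewrite Ev; apply: (ln_eq (S_P aS) (S_P (A_S sA)) as_) => //; rewrite ln_l ?S_P ?A_S.
  (* The line from [a] to [pt v] has five points, so it consists of [pt v] and the images of the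
     four multiples of [v]; [s] lies on it and outside [H]. *)
  pose g (l : option F) := if l is Some l then psi (l *: v) else pt v.
  have gI : injective g.
    case=> [l|] [m|] //=.
    - move/eqP => E; congr Some; apply/eqP; apply: contraLR E => lm; apply: psiI.
      by apply: contra lm; rewrite -subr_eq0 -scalerBl scaler_eq0 (negbTE v0) orbF subr_eq0.
    - by move=> E; have := psiA (l *: v); rewrite E inE pt_in.
    - by move=> E; have := psiA (m *: v); rewrite -E inE pt_in.
  have Eg : codom g =i ln a (pt v).
    apply/subset_cardP.
      by rewrite card_codom // card_option cardF ln_card ?S_P ?ptS ?apt.
    apply/subsetP => z /codomP[[l|] ->] /=; last by rewrite ln_r ?S_P ?ptS ?apt.
    have [->|l0] := eqVneq l 0; first by rewrite scale0r psi0 ln_l ?S_P ?ptS ?apt.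
    by rewrite -(pt_scale l0 v0) psiL // scaler_eq0 negb_or l0.
  have : s \in codom g by rewrite Eg El ln_r ?S_P ?A_S.
  case/codomP => -[l|] /= Es; first by exists (l *: v).
  by move: sA; rewrite Es inE pt_in.
have pP u : psi u \in P by apply/S_P/A_S.
have [E|v0] := eqVneq v 0.
  rewrite E psi0 add0r; have w0 : w != 0 by rewrite -E eq_sym.
  by have [_ wa] := psi_cone w w0; rewrite (cone_ln w0 (psiL w w0) wa) ln_r ?S_P ?ptS ?apt.
have [E|w0] := eqVneq w 0.
  rewrite E psi0 addr0; have [_ va] := psi_cone v v0.
  have av : a != psi v by rewrite eq_sym.
  rewrite (ln_sym (S_P aS) (pP v) av).
  by rewrite (cone_ln v0 (psiL v v0) va) ln_r ?S_P ?ptS ?apt.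
have [iv|] := boolP (indep v w); first by have [] := psi_rel v w iv.
rewrite /indep v0 w0 /= negbK => /eqP E; have /pt_eq [||l El] := E; rewrite ?v0 ?w0 //.
have -> : pt (v + w) = pt v.
  have -> : v + w = (1 + l) *: v by rewrite El scalerDl scale1r.
  rewrite pt_scale //; apply: contraNneq vw => l1.
  by rewrite El -(addKr 1 l) l1 addr0 scaleN1r F4_oppv.
rewrite (ln_eq (S_P aS) (S_P (ptS v0)) (apt v0)) ?psiL ?psiI //; last by rewrite E psiL.
by rewrite ln_r ?S_P ?ptS ?apt.
Qed.

(** Homogeneous coordinates: the first one vanishes on the hyperplane at infinity [H], and elsewhere
    one divides by it. *)
Definition extend_pt (psi : 'rV[F]_n -> T) (u : 'rV[F]_(1 + n)) : T :=
  let t := lsubmx u 0 0 in if t == 0 then pt (rsubmx u) else psi (t^-1 *: rsubmx u).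

Lemma extend_coordinates psi : affine_chart psi -> coordinates S (extend_pt psi).
Proof.
case=> psiA psiS psiI psiL.
pose tt (u : 'rV[F]_(1 + n)) := lsubmx u 0 0; pose vv (u : 'rV[F]_(1 + n)) := rsubmx u.
have ttD u w : tt (u + w) = tt u + tt w by rewrite /tt !mxE.
have ttZ l u : tt (l *: u) = l * tt u by rewrite /tt !mxE.
have vvD u w : vv (u + w) = vv u + vv w by rewrite /vv linearD.
have vvZ l u : vv (l *: u) = l *: vv u by rewrite /vv linearZ.
have ext u w : tt u = tt w -> vv u = vv w -> u = w.
  move=> Et Ev; rewrite -[u]hsubmxK -[w]hsubmxK -/(vv u) -/(vv w) Ev; congr row_mx.
  by apply/matrixP => i j; rewrite !ord1.
have nz u : u != 0 -> tt u = 0 -> vv u != 0.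
  move=> u0 t0; apply: contra u0 => /eqP v0; apply/eqP/ext; rewrite ?t0 ?v0.
    by rewrite /tt !mxE.
  by rewrite /vv linear0.
have Ept u : extend_pt psi u = if tt u == 0 then pt (vv u) else psi ((tt u)^-1 *: vv u) by [].
have ptHs v : v != 0 -> pt v \in S by exact: ptS.
have nH s h : s \in A -> h \in H -> s <> h by move=> sA hH E; have /eqP := A_H sA hH.
split=> [u u0|h hS|u w u0 w0|u w u0 w0 ne].
- rewrite Ept; case: eqP => [t0|_]; [exact/ptS/nz | exact/A_S/psiA].
- have [hH|nhH] := boolP (h \in H).
    have [v v0 Ev] : exists2 v, v != 0 & pt v = h by case: ptH => _ /(_ h hH).
    have t0 : tt (row_mx 0 v) = 0 by rewrite /tt row_mxKl mxE.
    have vE : vv (row_mx 0 v) = v by rewrite /vv row_mxKr.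
    exists (row_mx 0 v); last by rewrite Ept t0 eqxx vE.
    by apply: contraNneq v0 => E; rewrite -vE E /vv linear0.
  have [v Ev] : exists v, psi v = h by apply: psiS; rewrite inE nhH.
  have t1 : tt (row_mx 1%:M v) = 1 by rewrite /tt row_mxKl mxE.
  have vE : vv (row_mx 1%:M v) = v by rewrite /vv row_mxKr.
  exists (row_mx 1%:M v); last by rewrite Ept t1 oner_eq0 vE invr1 scale1r.
  by apply: contraTneq (oner_neq0 F) => E; rewrite -t1 E /tt !mxE eqxx.
- rewrite !Ept; case: eqP => [t0|/eqP t0]; case: eqP => [s0|/eqP s0].
  + rewrite pt_eq ?nz //; split=> -[l El]; exists l.
      by apply: ext; rewrite ?vvZ // ttZ t0 s0 mulr0.
    by rewrite El vvZ.
  + split=> [E|[l El]]; first by case: (nH _ _ (psiA ((tt w)^-1 *: vv w)) (pt_in (nz _ u0 t0))).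
    by move: s0; rewrite El ttZ t0 mulr0 eqxx.
  + split=> [E|[l El]]; first by case: (nH _ _ (psiA ((tt u)^-1 *: vv u)) (pt_in (nz _ w0 s0))).
    move: s0; rewrite El ttZ => /eqP; rewrite mulf_eq0 (negbTE t0) orbF => /eqP l0.
    by move: w0; rewrite El l0 scale0r eqxx.
  + split=> [E|[l El]].
      have {}E : (tt u)^-1 *: vv u = (tt w)^-1 *: vv w.
        by apply/eqP; apply: contra_eqT E; exact: psiI.
      exists (tt w / tt u); apply: ext; first by rewrite ttZ divfK.
      by rewrite vvZ -scalerA E scalerA divff // scale1r.
    have l0 : l != 0 by apply: contraNneq w0 => l0; rewrite El l0 scale0r.
    congr psi; rewrite El ttZ vvZ scalerA; congr (_ *: _).
    by field; rewrite t0.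
move: ne; rewrite !Ept ttD vvD.
have [t0|t0] := eqVneq (tt u) 0; have [s0|s0] := eqVneq (tt w) 0 => ne.
- rewrite t0 s0 addr0 eqxx; apply: pt_add; rewrite /indep !nz //.
- rewrite t0 add0r (negbTE s0) scalerDr; set p := _ *: vv w; set q := _ *: vv u.
  have v0 := nz u u0 t0.
  have Eq : pt q = pt (vv u) by rewrite /q pt_scale ?invr_eq0.
  have q0 : q != 0 by rewrite /q scaler_eq0 negb_or invr_eq0 s0.
  have pq : p != q + p by rewrite -subr_eq0 opprD addrCA subrr addr0 oppr_eq0.
  have := psiL _ _ pq; rewrite addrCA F4_addv // addr0 Eq => h1.
  have pA := psiA p; have qA := psiA (q + p); have hH := pt_in v0.
  have ph : psi p != pt (vv u) by apply: A_H.
  have pP : psi p \in P by apply/S_P/A_S.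
  have qP : psi (q + p) \in P by apply/S_P/A_S.
  rewrite ln_sym ?(S_P (ptS v0)) //.
  by rewrite (ln_eq pP qP (psiI _ _ pq) (ln_l pP qP (psiI _ _ pq)) h1 ph) ln_r ?psiI.
- rewrite s0 addr0 (negbTE t0) scalerDr; set p := _ *: vv u; set q := _ *: vv w.
  have v0 := nz w w0 s0.
  have Eq : pt q = pt (vv w) by rewrite /q pt_scale ?invr_eq0.
  have q0 : q != 0 by rewrite /q scaler_eq0 negb_or invr_eq0 t0.
  have pq : p != p + q by rewrite -subr_eq0 opprD addrA subrr add0r oppr_eq0.
  have := psiL _ _ pq; rewrite addrA F4_addv // add0r Eq => h1.
  have pA := psiA p; have qA := psiA (p + q); have hH := pt_in v0.
  have ph : psi p != pt (vv w) by apply: A_H.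
  have pP : psi p \in P by apply/S_P/A_S.
  have qP : psi (p + q) \in P by apply/S_P/A_S.
  by rewrite (ln_eq pP qP (psiI _ _ pq) (ln_l pP qP (psiI _ _ pq)) h1 ph) ln_r ?psiI.
set p := _ *: vv u in ne *; set q := _ *: vv w in ne *.
have pq : p != q by apply: contraNneq ne => ->.
have Eu : vv u = tt u *: p by rewrite /p scalerA divff ?scale1r.
have Ew : vv w = tt w *: q by rewrite /q scalerA divff ?scale1r.
have pP : psi p \in P by apply/S_P/A_S.
have qP : psi q \in P by apply/S_P/A_S.
have := psiL _ _ pq; have pq0 : p + q != 0.
  by apply: contra pq => /eqP E; rewrite -[q]F4_oppv // -addr_eq0 E.
case: eqP => [r0|/eqP r0] h1.
  have Et : tt w = tt u by rewrite -[tt u](F4_opp cardF); apply/eqP; rewrite -addr_eq0 addrC r0.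
  by rewrite Eu Ew Et -scalerDr pt_scale.
set r := tt u + tt w in r0 *; set m := _ *: (vv u + vv w).
(* [m] is the affine combination of [p] and [q] with weights [tt u / r] and [tt w / r], so [m - p]
   is a multiple of [q - p]; signs do not matter. The doubled term below, which is zero, makes the
   identity valid in every characteristic, as [field] requires. *)
have mp : m + p = (tt w / r) *: (p + q).
  transitivity ((tt w / r) *: (p + q) + ((tt u / r) *: p + (tt u / r) *: p)).
    have G (t' s' : F) (p' q' : 'rV[F]_n) : t' + s' != 0 ->
        (t' + s')^-1 *: (t' *: p' + s' *: q') + p' =
        (s' / (t' + s')) *: (p' + q') + ((t' / (t' + s')) *: p' + (t' / (t' + s')) *: p').
      by move=> ?; apply/rowP => i; rewrite !mxE; field.
    by rewrite /m Eu Ew G.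
  by rewrite F4_addv // addr0.
have sr0 : tt w / r != 0 by rewrite mulf_eq0 negb_or s0 invr_eq0.
have pm : p != m.
  apply: contra_neq sr0 => E; apply/eqP; move/eqP: mp; rewrite -E F4_addv // eq_sym.
  by rewrite scaler_eq0 (negbTE pq0) orbF => ->.
have mP : psi m \in P by apply/S_P/A_S.
have := psiL _ _ pm; rewrite addrC mp pt_scale // => h2.
have hH := pt_in pq0; have ph : psi p != pt (p + q) by apply: A_H.
rewrite -(ln_eq pP qP (psiI _ _ pq) (ln_l pP qP (psiI _ _ pq)) h1 ph).
by rewrite (ln_eq pP mP (psiI _ _ pm) (ln_l pP mP (psiI _ _ pm)) h2 ph) ln_r ?psiI.
Qed.

End Hyperplane.
End Frame.
End Coordinates.

(** * Hermitian forms and the dual polar graph *)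

Section Hermitian.
Variable F : finFieldType.
Hypothesis cardF : #|F| = 4.
Local Open Scope ring_scope.
Local Notation conj := (@hconj F 2).

Lemma F4_char : 2%N \in [pchar F].
Proof. by rewrite inE /= mulr2n F4_add. Qed.

Definition ctr m n (A : 'M[F]_(m, n)) : 'M[F]_(n, m) := (map_mx conj A)^T.

(** Squaring is an automorphism in characteristic 2; this gives access to the morphism lemmas of
    [map_mx]. *)
Lemma map_conjE m n (A : 'M[F]_(m, n)) : map_mx conj A = map_mx (pFrobenius_aut F4_char) A.
Proof. by apply/matrixP => i j; rewrite !mxE. Qed.

Lemma ctrM m n p (A : 'M[F]_(m, n)) (B : 'M_(n, p)) : ctr (A *m B) = ctr B *m ctr A.
Proof. by rewrite /ctr !map_conjE map_mxM trmx_mul. Qed.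

Lemma ctrD m n (A B : 'M[F]_(m, n)) : ctr (A + B) = ctr A + ctr B.
Proof. by rewrite /ctr !map_conjE map_mxD linearD. Qed.

Lemma ctrB m n (A B : 'M[F]_(m, n)) : ctr (A - B) = ctr A - ctr B.
Proof. by rewrite /ctr !map_conjE map_mxB linearB. Qed.

Lemma ctrZ m n l (A : 'M[F]_(m, n)) : ctr (l *: A) = conj l *: ctr A.
Proof. by rewrite /ctr !map_conjE map_mxZ linearZ. Qed.

Lemma ctr0 m n : ctr (0 : 'M[F]_(m, n)) = 0.
Proof. by rewrite /ctr map_conjE map_mx0 trmx0. Qed.

Lemma ctr1 n : ctr (1%:M : 'M[F]_n) = 1%:M.
Proof. by rewrite /ctr map_conjE map_mx1 trmx1. Qed.

Lemma ctr_block m1 m2 n1 n2 (A : 'M[F]_(m1, n1)) (B : 'M_(m1, n2)) (C : 'M_(m2, n1)) (E : 'M_(m2, n2)) :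
  ctr (block_mx A B C E) = block_mx (ctr A) (ctr C) (ctr B) (ctr E).
Proof. by rewrite /ctr !map_conjE map_block_mx tr_block_mx. Qed.

Lemma ctrK m n (A : 'M[F]_(m, n)) : ctr (ctr A) = A.
Proof.
by apply/matrixP => i j; rewrite !mxE /hconj -exprM F4_exp.
Qed.

Lemma rank_ctr m n (A : 'M[F]_(m, n)) : \rank (ctr A) = \rank A.
Proof. by rewrite /ctr map_conjE mxrank_tr mxrank_map. Qed.

Lemma oppm_id m n (A : 'M[F]_(m, n)) : - A = A.
Proof. by apply/matrixP => i j; rewrite !mxE F4_opp. Qed.

Lemma omega_ex : exists w : F, w ^+ 2 + w + 1 = 0.
Proof.
have [w] : exists w : F, w \notin [:: 0; 1].
  apply/existsP; rewrite -negb_forall; apply/negP => /forallP H'.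
  have H z : z \in [:: 0; 1 : F] by have := H' z; rewrite ?negbK.
  pose s : seq F := [:: 0; 1].
  have : (#|F| <= #|s|)%N by apply/subset_leq_card/subsetP => z _; exact: H.
  by rewrite cardF => /leq_trans /(_ (card_size s)).
rewrite !inE negb_or => /andP[w0 w1]; exists w.
have : (w - 1) * (w ^+ 2 + w + 1) = 0.
  transitivity (w ^+ 3 - 1); first by ring.
  by rewrite F4_exp3 // subrr.
by move/eqP; rewrite mulf_eq0 subr_eq0 (negbTE w1) => /eqP.
Qed.

Definition hform n (G : 'M[F]_n) (u v : 'rV[F]_n) : F := (u *m G *m ctr v) 0 0.

Lemma hform_sym n (G : 'M[F]_n) u v : ctr G = G -> hform G v u = conj (hform G u v).
Proof.
move=> GH; have -> : conj (hform G u v) = ctr (u *m G *m ctr v) 0 0 by rewrite /hform /ctr !mxE.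
by rewrite !ctrM ctrK GH mulmxA.
Qed.

Lemma hformDZ n (G : 'M[F]_n) u v l : hform G (v + l *: u) (v + l *: u) =
  hform G v v + l * hform G u v + conj l * hform G v u + l * conj l * hform G u u.
Proof.
rewrite /hform ctrD ctrZ !mulmxDl !mulmxDr -!scalemxAl -!scalemxAr !mxE; ring.
Qed.

(** With [z = hform G u v] and [q = hform G u u], the hypothesis says that
    [l * z + l ^+ 2 * z ^+ 2 + l ^+ 3 * q = 0] for all [l]. Adding the cases 1, w, w^2 for a
    primitive cube root w of unity gives [q = 0]; then the cases 1 and w give [z = 0]. *)
Lemma hform_polar n (G : 'M[F]_n) u v : ctr G = G ->
  (forall l, hform G (v + l *: u) (v + l *: u) = hform G v v) -> hform G u v = 0.
Proof.
move=> GH H; set z := hform G u v; set q := hform G u u.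
have E l : l * z + l ^+ 2 * z ^+ 2 + l ^+ 3 * q = 0.
  apply: (addrI (hform G v v)); rewrite addr0 -{2}(H l) hformDZ (hform_sym u v GH) /hconj -/z -/q.
  ring.
have [w Hw] := omega_ex.
have w3 : w ^+ 3 = 1.
  by apply/eqP; rewrite -subr_eq0 -(mulr0 (w - 1)) -Hw; apply/eqP; ring.
have E1 := E 1; have E2 := E w; have E3 := E (w ^+ 2).
have q0 : q = 0.
  have : (1 * z + 1 ^+ 2 * z ^+ 2 + 1 ^+ 3 * q) + (w * z + w ^+ 2 * z ^+ 2 + w ^+ 3 * q) +
     ((w ^+ 2) * z + (w ^+ 2) ^+ 2 * z ^+ 2 + (w ^+ 2) ^+ 3 * q) = 0 by rewrite E1 E2 E3 !addr0.
  have -> : (w ^+ 2) ^+ 3 = 1 by rewrite exprAC w3 expr1n.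
  have -> : (w ^+ 2) ^+ 2 = w by rewrite -exprM F4_exp.
  rewrite w3 => X; have : (w ^+ 2 + w + 1) * (z + z ^+ 2) + q + (q + q) = 0 by rewrite -X; ring.
  by rewrite Hw mul0r add0r F4_add // addr0.
rewrite q0 !expr1n !mul1r addr0 in E1; rewrite q0 mulr0 addr0 in E2.
have zz : z ^+ 2 = z by apply: (addrI z); rewrite E1 F4_add.
rewrite zz in E2; have : (w ^+ 2 + w + 1) * z = 0 by rewrite Hw mul0r.
by rewrite !mulrDl mul1r [w ^+ 2 * z + _]addrC E2 add0r.
Qed.

Lemma hform_mx_eq0 m n p (A : 'M[F]_(m, n)) (G : 'M_n) (B : 'M_(p, n)) :
  (forall u v, (u <= A)%MS -> (v <= B)%MS -> hform G u v = 0) -> A *m G *m ctr B = 0.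
Proof.
move=> H; apply/matrixP => i j; rewrite [RHS]mxE.
have := H (row i A) (row j B) (row_sub i A) (row_sub j B); rewrite /hform => <-.
rewrite -row_mul mxE [in RHS]mxE; apply: eq_bigr => k _; by rewrite !mxE.
Qed.

Lemma hform_sub_eq0 m n p (A : 'M[F]_(m, n)) (G : 'M_n) (B : 'M_(p, n)) u v :
  A *m G *m ctr B = 0 -> (u <= A)%MS -> (v <= B)%MS -> hform G u v = 0.
Proof.
move=> E /submxP[X ->] /submxP[Y ->].
by rewrite /hform ctrM -!mulmxA (mulmxA G) (mulmxA A) (mulmxA A) E mul0mx mulmx0 mxE.
Qed.

Lemma span_ex n (Q : pred 'rV[F]_n) : Q 0 -> (forall u v, Q u -> Q v -> Q (u + v)) ->
  (forall l u, Q u -> Q (l *: u)) -> exists U : 'M[F]_n, forall u, (u <= U)%MS = Q u.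
Proof.
move=> Q0 QD QZ; exists (\sum_(v | Q v) <<v>>)%MS => u; apply/idP/idP => [|Qu].
  case/sub_sumsmxP => w ->; elim/big_ind: _ => // v Qv.
  have : (w v *m <<v>> <= v)%MS by rewrite (submx_trans (submxMl _ _)) // genmxE.
  by case/sub_rVP => l ->; apply: QZ.
by apply: (sumsmx_sup u) => //; rewrite genmxE.
Qed.

Lemma hyperplane_ex n (U : 'M[F]_n) : (\rank U).+1 = n ->
  exists c : 'cV[F]_n, forall u : 'rV_n, (u <= U)%MS = (u *m c == 0).
Proof.
move=> rU; have : \rank (kermx U^T) = 1%N by rewrite mxrank_ker mxrank_tr -{1}rU subSnn.
move=> rk; pose c := (nz_row (kermx U^T))^T; exists c => u.
have kn : kermx U^T != 0 by rewrite -mxrank_eq0 rk.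
have c0 : nz_row (kermx U^T) != 0 by rewrite nz_row_eq0.
have Uc : U *m c = 0.
  apply: trmx_inj; rewrite trmx_mul trmxK trmx0; apply/sub_kermxP; exact: nz_row_sub.
have Uk : (U <= kermx c)%MS by apply/sub_kermxP.
have rc : \rank (kermx c) = \rank U.
  rewrite mxrank_ker mxrank_tr; have -> : \rank (nz_row (kermx U^T)) = 1%N by rewrite rank_rV c0.
  by rewrite -{1}rU subn1.
have /eqmxP E : (U == kermx c)%MS by rewrite -(geq_leqif (mxrank_leqif_eq Uk)) rc.
by rewrite E; apply/sub_kermxP/eqP.
Qed.

(** * Maximal isotropic subspaces as graphs of Hermitian forms *)

Section Model.
Variable n : nat.
Implicit Types U V H : 'M[F]_n.

Definition shear H : 'M[F]_(n + n) := block_mx 1%:M H 0 1%:M.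
(** The row space consists of the (u, u H + k) with u in [U] and k in the annihilator of [U]. It is
    the graph of the form [H] on [U], seen as a map from [U] to its conjugate dual, and does not
    depend on [H] off [U]. *)
Definition Wmx U H : 'M[F]_(n + n) := block_mx U 0 0 (kermx (ctr U)) *m shear H.
Definition hyp : 'M[F]_(n + n) := block_mx 0 1%:M 1%:M 0.

Lemma shearD H H' : shear H *m shear H' = shear (H + H').
Proof.
by rewrite /shear mulmx_block !mul1mx !mulmx1 !mulmx0 !mul0mx !addr0 !add0r addrC.
Qed.

Lemma shear0 : shear 0 = 1%:M.
Proof. by rewrite /shear -scalar_mx_block. Qed.

Lemma shear_unit H : shear H \in unitmx.
Proof.
by have /mulmx1_unit[] : shear H *m shear (- H) = 1%:M by rewrite shearD subrr shear0.
Qed.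

Lemma rank_ker_ctr U : \rank (kermx (ctr U)) = (n - \rank U)%N.
Proof. by rewrite mxrank_ker rank_ctr. Qed.

Lemma rank_blocks U V H : \rank (block_mx U 0 0 (kermx (ctr V)) *m shear H) =
  (\rank U + (n - \rank V))%N.
Proof. by rewrite mxrankMfree ?row_free_unit ?shear_unit // rank_diag_block_mx rank_ker_ctr. Qed.

Lemma rank_Wmx U H : \rank (Wmx U H) = n.
Proof. by rewrite rank_blocks subnKC // rank_leq_row. Qed.

(** A shear by a Hermitian matrix is an isometry of [hyp] because [H + H = 0]; this reduces the
    claim to [H = 0]. *)
Lemma Wmx_isotropic U H : ctr H = H -> Wmx U H *m hyp *m ctr (Wmx U H) = 0.
Proof.
move=> HH; have E : shear H *m hyp *m ctr (shear H) = hyp.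
  rewrite /shear /hyp ctr_block !ctr1 ctr0 HH !mulmx_block.
  rewrite !(mul1mx, mulmx1, mulmx0, mul0mx, addr0, add0r).
  by rewrite -{1}(oppm_id H) addNr.
rewrite /Wmx ctrM -!mulmxA (mulmxA (shear H)) (mulmxA (shear H *m hyp)) E.
rewrite /hyp ctr_block !ctr0 !mulmx_block !(mul1mx, mulmx1, mulmx0, mul0mx, addr0, add0r).
have kU : kermx (ctr U) *m ctr U = 0 by exact: mulmx_ker.
have kU' : U *m ctr (kermx (ctr U)) = 0 by rewrite -[X in X *m _]ctrK -ctrM kU ctr0.
by rewrite kU kU' block_mx0.
Qed.

(** The hypothesis says that [G] and [H] agree as forms on [U'] times [U]. When [U'] has corank one
    in [V], the block has rank [n - 1] and serves as the intersection of two adjacent vertices. *)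
Lemma blocks_sub_Wmx U' U V H G : (U' <= U)%MS -> (U <= V)%MS -> U' *m (G - H) *m ctr U = 0 ->
  (block_mx U' 0 0 (kermx (ctr V)) *m shear G <= Wmx U H)%MS.
Proof.
move=> /submxP[X EX] /submxP[Y EY] E.
have /submxP[Z1 E1] : (U' *m (G - H) <= kermx (ctr U))%MS by apply/sub_kermxP.
have /submxP[Z2 E2] : (kermx (ctr V) <= kermx (ctr U))%MS.
  by apply/sub_kermxP; rewrite EY ctrM mulmxA mulmx_ker mul0mx.
apply/submxP; exists (block_mx X Z1 0 Z2).
have -> : shear G = shear (G - H) *m shear H by rewrite shearD subrK.
rewrite /Wmx !mulmxA; congr (_ *m _).
rewrite [RHS]mulmx_block {1}/shear mulmx_block !(mul1mx, mulmx1, mulmx0, mul0mx, addr0, add0r).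
by rewrite E1 E2 {1}EX.
Qed.

Lemma Wmx_subP U H U' H' : (Wmx U H <= Wmx U' H')%MS ->
  (U <= U')%MS /\ U *m (H' - H) *m ctr U' = 0.
Proof.
move=> /submxP[Z E].
have {}E : block_mx U 0 0 (kermx (ctr U)) = Z *m block_mx U' 0 0 (kermx (ctr U')) *m shear (H' - H).
  apply: (can_inj (mulmxK (shear_unit H))); rewrite -/(Wmx U H) E -!mulmxA shearD subrK //.
move: E; rewrite -[Z]submxK; set A := ulsubmx Z; set B := ursubmx Z.
rewrite mulmx_block /shear mulmx_block !(mul1mx, mulmx1, mulmx0, mul0mx, addr0, add0r).
case/eq_block_mx => EU E0 _ _; split; first by rewrite EU submxMl.
have -> : U *m (H' - H) = - (B *m kermx (ctr U')).
  by apply/eqP; rewrite -addr_eq0 EU -E0.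
by rewrite mulNmx -mulmxA mulmx_ker mulmx0 oppr0.
Qed.

End Model.
End Hermitian.

(** * The dual polar graph of the hyperbolic form: connectedness and a bound on the valency *)

Section DualPolar.
Variable F : finFieldType.
Hypothesis cardF : #|F| = 4.
Variable n : nat.
Hypothesis n_gt0 : 0 < n.
Local Open Scope ring_scope.
Local Notation M := (hyp F n).
Local Notation V := ('M[F]_(n + n)).

Definition isotropic m (A : 'M[F]_(m, n + n)) := A *m M *m ctr A == 0.
Definition vertex (A : V) := [&& (<<A>>%MS == A), \rank A == n & isotropic A].
Definition adjacent (A B : V) := \rank (A :&: B)%MS == n.-1.

Lemma hyp_unit : M \in unitmx.
Proof.
have /mulmx1_unit[] // : M *m M = 1%:M.
rewrite /hyp mulmx_block !(mul1mx, mulmx1, mulmx0, mul0mx, addr0, add0r).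
by rewrite -scalar_mx_block.
Qed.

Lemma ctr_hyp : ctr M = M.
Proof. by rewrite /hyp ctr_block // !ctr0 // !ctr1. Qed.

Lemma form_sym m1 m2 (A : 'M[F]_(m1, n + n)) (B : 'M_(m2, n + n)) :
  A *m M *m ctr B = 0 -> B *m M *m ctr A = 0.
Proof.
move=> E; have : ctr (A *m M *m ctr B) = 0 by rewrite E ctr0.
by rewrite !ctrM // ctrK // ctr_hyp mulmxA.
Qed.

Lemma isotropic_sub m1 m2 (A : 'M[F]_(m1, n + n)) (B : 'M_(m2, n + n)) :
  (A <= B)%MS -> isotropic B -> isotropic A.
Proof.
move=> /submxP[X ->] /eqP E; apply/eqP.
by rewrite ctrM // -!mulmxA (mulmxA M) (mulmxA B) (mulmxA B) E mul0mx mulmx0.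
Qed.

Lemma isotropic_pair m m1 m2 (A : 'M[F]_(m1, n + n)) (B : 'M_(m2, n + n)) (C : 'M_(m, n + n)) :
  isotropic C -> (A <= C)%MS -> (B <= C)%MS -> A *m M *m ctr B = 0.
Proof.
move=> /eqP E /submxP[X ->] /submxP[Y ->].
by rewrite ctrM // -!mulmxA (mulmxA M) (mulmxA C) (mulmxA C) E mul0mx mulmx0.
Qed.

Lemma isotropic_add m1 m2 (A : 'M[F]_(m1, n + n)) (B : 'M_(m2, n + n)) :
  isotropic A -> isotropic B -> A *m M *m ctr B = 0 -> isotropic (A + B)%MS.
Proof.
move=> /eqP EA /eqP EB AB; apply: (@isotropic_sub _ _ _ (col_mx A B)); first by rewrite addsmxE.
have E : ctr (col_mx A B) = row_mx (ctr A) (ctr B) by rewrite /ctr map_col_mx tr_col_mx.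
rewrite /isotropic E mul_col_mx mul_col_row EA EB AB (form_sym AB); apply/eqP.
exact: block_mx0.
Qed.

Lemma rank_isotropic m (A : 'M[F]_(m, n + n)) : isotropic A -> (\rank A <= n)%N.
Proof.
move=> /eqP; rewrite -mulmxA => /sub_kermxP/mxrankS.
rewrite mxrank_ker -(mxrank_tr (M *m _)) trmx_mul.
rewrite mxrankMfree ?row_free_unit ?unitmx_tr ?hyp_unit // mxrank_tr rank_ctr //; nlia.
Qed.

Definition perp (w : 'rV[F]_(n + n)) : V := kermx (M *m ctr w).

Lemma sub_perp m (A : 'M[F]_(m, n + n)) w : (A <= perp w)%MS = (A *m M *m ctr w == 0).
Proof. by rewrite /perp; apply/sub_kermxP/eqP; rewrite mulmxA. Qed.

Lemma rank_perp w : ((n + n).-1 <= \rank (perp w))%N.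
Proof. by rewrite mxrank_ker; have := rank_leq_col (M *m ctr w); nlia. Qed.

Lemma vertexP A : vertex A -> [/\ <<A>>%MS = A, \rank A = n & isotropic A].
Proof. by case/and3P => /eqP ? /eqP ? ?. Qed.

Lemma vertex_genmx (A : V) : \rank A = n -> isotropic A -> vertex <<A>>%MS.
Proof.
move=> rA iA; rewrite /vertex genmx_id eqxx genmxE rA eqxx /=.
by apply: isotropic_sub iA; rewrite genmxE.
Qed.

Lemma isotropic_row_add (A : V) w : isotropic A -> isotropic w -> isotropic ((A :&: perp w) + w)%MS.
Proof.
move=> iA iw; apply: isotropic_add => //; first by apply: isotropic_sub iA; exact: capmxSl.
by apply/eqP; rewrite -sub_perp capmxSr.
Qed.

Lemma rank_add_row (A : V) (w : 'rV_(n + n)) : ~~ (w <= A)%MS -> \rank (A + w)%MS = (\rank A).+1.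
Proof.
move=> nw; have rw : (\rank w <= 1)%N by rewrite rank_leq_row.
have lt : (A < A + w)%MS.
  by rewrite ltmxErank addsmxSl /=; move: nw; apply: contraNltn => le;
    have := addsmxSr A w; rewrite -(eqmxP (_ : (A == A + w)%MS)) //;
    rewrite -(geq_leqif (mxrank_leqif_eq (addsmxSl A w))).
move: lt; rewrite ltmxErank => /andP[_ lt]; have := mxrank_adds_leqif A w => -[le _]; nlia.
Qed.

(** If [w] were perpendicular to all of [A], adding it would give an isotropic subspace of dimension
    [n + 1]. *)
Lemma cap_perp (A : V) (w : 'rV_(n + n)) : vertex A -> isotropic w -> ~~ (w <= A)%MS ->
  \rank (A :&: perp w)%MS = n.-1.
Proof.
move=> /vertexP[_ rA iA] iw nw; apply/eqP; rewrite eqn_leq; apply/andP; split.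
  have := rank_isotropic (isotropic_row_add iA iw).
  rewrite rank_add_row; first by nlia.
  by apply: contra nw => /submx_trans; apply; exact: capmxSl.
have := mxrank_sum_cap A (perp w); have := rank_perp w; rewrite rA.
by have := rank_leq_col (A + perp w)%MS; nlia.
Qed.

(** [A :&: B] is perpendicular to [w] and already has the dimension of [A :&: perp w]. So a
    neighbour of [A] is known from any one of its vectors outside [A]. *)
Lemma neighbour_eq (A B : V) (w : 'rV_(n + n)) : vertex A -> vertex B -> adjacent A B ->
  (w <= B)%MS -> ~~ (w <= A)%MS -> B = <<((A :&: perp w) + w)%MS>>%MS.
Proof.
move=> vA vB /eqP rAB wB nw; have [gB rB iB] := vertexP vB.
have iw := isotropic_sub wB iB.
have cap : (A :&: B <= A :&: perp w)%MS.
  rewrite sub_capmx capmxSl sub_perp /=; apply/eqP.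
  by apply: isotropic_pair iB _ wB; exact: capmxSr.
have /eqmxP E : (A :&: B == A :&: perp w)%MS.
  by rewrite -(geq_leqif (mxrank_leqif_eq cap)) rAB cap_perp.
rewrite -{1}gB; apply/genmxP; rewrite andbC -(geq_leqif (mxrank_leqif_eq _)).
  rewrite rB rank_add_row ?cap_perp //; first by nlia.
  by apply: contra nw => /submx_trans; apply; exact: capmxSl.
by rewrite addsmx_sub wB andbT -E capmxSr.
Qed.

(* A subset closed under adjacency grows towards any given vertex. *)
Lemma dual_polar_connected (X : pred V) A0 : X A0 -> (forall A, X A -> vertex A) ->
  (forall A B, X A -> vertex B -> adjacent A B -> X B) -> forall B, vertex B -> X B.
Proof.
move=> X0 Xv Xadj B vB; have [gB rB iB] := vertexP vB.
pose A := [arg max_(A > A0 | X A) \rank (B :&: A)%MS].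
have [XA maxA] : X A /\ forall A', X A' -> (\rank (B :&: A')%MS <= \rank (B :&: A)%MS)%N.
  by rewrite /A; case: arg_maxnP.
have vA := Xv _ XA; have [gA rA iA] := vertexP vA.
have [BA|] := boolP (B <= A)%MS.
  rewrite -gB (_ : <<B>>%MS = A) // -gA; apply/genmxP.
  by rewrite -(geq_leqif (mxrank_leqif_eq BA)) rA rB.
case/row_subPn => i nw; set w := row i B in nw; have wB : (w <= B)%MS by exact: row_sub.
have iw := isotropic_sub wB iB.
pose C := <<((A :&: perp w) + w)%MS>>%MS.
have nwc : ~~ (w <= A :&: perp w)%MS.
  by apply: contra nw => /submx_trans; apply; exact: capmxSl.
have rC : \rank ((A :&: perp w) + w)%MS = n.
  by rewrite rank_add_row // cap_perp //; nlia.
have vC : vertex C by apply: vertex_genmx => //; exact: isotropic_row_add.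
have capC : (A :&: perp w <= A :&: C)%MS by rewrite sub_capmx capmxSl genmxE addsmxSl.
have adjAC : adjacent A C.
  have := mxrankS capC; rewrite cap_perp // => le1; rewrite /adjacent eqn_leq le1 andbT.
  have := mxrankS (capmxSl A C); rewrite rA => le2; suff : \rank (A :&: C)%MS != n.
    by move=> ne; have lt : (\rank (A :&: C)%MS < n)%N by [rewrite ltn_neqAle ne]; nlia.
  apply: contra nw => /eqP r; have /eqmxP E : (A :&: C == A)%MS.
    by rewrite -(geq_leqif (mxrank_leqif_eq (capmxSl A C))) r rA.
  have : (C <= A)%MS.
    have /eqmxP E2 : (A :&: C == C)%MS.
      by rewrite -(geq_leqif (mxrank_leqif_eq (capmxSr A C))) r genmxE rC.
    by rewrite -E2 capmxSl.
  by apply: submx_trans; rewrite genmxE addsmxSr.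
have := maxA C (Xadj _ _ XA vC adjAC).
suff : (\rank (B :&: A) < \rank (B :&: C))%N%MS by nlia.
have le : ((B :&: A) + w <= B :&: C)%MS.
  have wC : (w <= C)%MS by rewrite genmxE addsmxSr.
  rewrite addsmx_sub !sub_capmx capmxSl wB wC !andbT /= genmxE.
  apply: submx_trans (addsmxSl _ _); rewrite sub_capmx capmxSr sub_perp /=; apply/eqP.
  by apply: isotropic_pair iB _ wB; exact: capmxSl.
have := mxrankS le; rewrite rank_add_row //; apply: contra nw => /submx_trans; apply.
exact: capmxSr.
Qed.

Local Notation rows A := [set w : 'rV[F]_(n + n) | (w <= A)%MS].

Lemma card_rows (A : V) : #|rows A| = (4 ^ \rank A)%N.
Proof. by rewrite -cardF -card_rowg; apply: eq_card => w; rewrite !inE. Qed.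

(** The trace to the prime field of [b *m ctr a], which is the value of the Hermitian form on the
    vector with halves [b] and [a]. *)
Definition half (b a : 'rV[F]_n) : F := (b *m ctr a) 0 0 + (a *m ctr b) 0 0.

Lemma isotropic_row b a : isotropic (row_mx b a) = (half b a == 0).
Proof.
have E : row_mx b a *m M *m ctr (row_mx b a) = a *m ctr b + b *m ctr a.
  rewrite {1}/ctr map_row_mx tr_row_mx /hyp mul_row_block.
  by rewrite !(mulmx0, mulmx1, addr0, add0r) mul_row_col.
rewrite /isotropic E /half; move: (a *m _) (b *m _) => X Y {E}.
apply/eqP/eqP => [/matrixP/(_ 0 0)|E].
  by rewrite mxE [RHS]mxE addrC.
by apply/matrixP => i j; rewrite !ord1 mxE [RHS]mxE addrC.
Qed.

Lemma half01 b a : half b a = 0 \/ half b a = 1.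
Proof.
rewrite /half; have -> : (b *m ctr a) 0 0 = ((a *m ctr b) 0 0) ^+ 2.
  have -> : b *m ctr a = ctr (a *m ctr b) by rewrite ctrM // ctrK.
  by rewrite /ctr !mxE.
set z := (a *m ctr b) 0 0; have : (z ^+ 2 + z) * (z ^+ 2 + z - 1) = 0.
  transitivity (z ^+ 4 - z + (z ^+ 3 + z ^+ 3)); first by ring.
  by rewrite F4_exp // subrr add0r F4_add.
by move/eqP; rewrite mulf_eq0 subr_eq0 => /orP[]/eqP; [left | right].
Qed.

Lemma halfD b a a' : half b (a + a') = half b a + half b a'.
Proof. by rewrite /half ctrD // mulmxDr mulmxDl !mxE; ring. Qed.

(** [half b] is additive with values 0 and 1; translation by a vector of value 1 exchanges its zeros
    with the rest. *)
Lemma card_half0 b : b != 0 -> (2 * #|[set a | half b a == 0%R]| = 4 ^ n)%N.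
Proof.
move=> b0; have [a0 Ea0] : exists a0, half b a0 = 1.
  have [i bi] : exists i, b 0 i != 0 by case/rV0Pn: b0 => i; exists i.
  have [w Hw] := omega_ex cardF.
  have mulE l : (b *m ctr (l *: (delta_mx 0 i : 'rV_n))) 0 0 = b 0 i * l ^+ 2.
    rewrite mxE (bigD1 i) //= big1 => [|j ji].
      by rewrite addr0 !mxE !eqxx mulr1.
    by rewrite !mxE (negbTE ji) andbF mulr0 /hconj expr0n mulr0.
  (* An element w with w^2 + w = 1 has trace 1. The coordinate is squared so that conjugation undoes
     it and [b *m ctr a] is w. *)
  pose a := (w / b 0 i) ^+ 2 *: (delta_mx 0 i : 'rV[F]_n); exists a.
  have E : (b *m ctr a) 0 0 = w by rewrite mulE -exprM F4_exp // mulrCA mulfV // mulr1.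
  have E2 : (a *m ctr b) 0 0 = w ^+ 2.
    rewrite -E; have -> : a *m ctr b = ctr (b *m ctr a) by rewrite ctrM // ctrK.
    by rewrite /ctr !mxE.
  rewrite /half E E2; apply: (addIr 1); rewrite F4_add // -Hw; ring.
have E : [set a | half b a == 0] = (fun a => a + a0) @: ~: [set a | half b a == 0].
  apply/setP => a; rewrite inE; apply/idP/imsetP => [/eqP h|[a']].
    exists (a + a0); last by rewrite -addrA F4_addv // addr0.
    by rewrite !inE halfD h add0r Ea0 oner_eq0.
  rewrite !inE => h ->; rewrite halfD Ea0; case: (half01 b a') h => ->; rewrite ?eqxx //.
  by rewrite F4_add.
have EC : #|[set a | half b a == 0]| = #|~: [set a | half b a == 0]|.
  by rewrite {1}E card_imset //; exact: addIr.
have := cardsC [set a | half b a == 0]; rewrite -EC addnn -mul2n => ->.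
by rewrite card_mx cardF mul1n.
Qed.

Lemma card_isotropic : (2 * #|[set w : 'rV[F]_(n + n) | isotropic w]| = 4 ^ n * (4 ^ n + 1))%N.
Proof.
have -> : #|[set w : 'rV[F]_(n + n) | isotropic w]| =
    (\sum_(b : 'rV[F]_n) #|[set a | half b a == 0%R]|)%N.
  rewrite -sum1_card big_mkcond /= (reindex (fun p : 'rV[F]_n * 'rV_n => row_mx p.1 p.2)) /=.
    rewrite -(pair_bigA _ (fun b a => if row_mx b a \in [set w | isotropic w] then 1 else 0)%N) /=.
    apply: eq_bigr => b _; rewrite -sum1_card [RHS]big_mkcond; apply: eq_bigr => a _.
    by rewrite !inE isotropic_row.
  exists (fun w => (lsubmx w, rsubmx w)) => [[b a] _|w _] /=.
    by rewrite row_mxKl row_mxKr.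
  by rewrite hsubmxK.
rewrite (bigD1 0) //= mulnDr big_distrr /=.
rewrite (eq_bigr (fun=> 4 ^ n)%N) => [|b b0]; last exact: card_half0.
rewrite sum_nat_const.
have -> : #|[set a | half 0 a == 0]| = (4 ^ n)%N.
  rewrite -[RHS](_ : #|[set: 'rV[F]_n]| = _); last by rewrite cardsT card_mx cardF mul1n.
  by apply: eq_card => a; rewrite !inE /half mul0mx ctr0 // mulmx0 !mxE addr0 eqxx.
have -> : #|(fun b : 'rV[F]_n => b != 0)| = (4 ^ n).-1.
  have := cardC1 (0 : 'rV[F]_n); rewrite card_mx cardF mul1n => <-.
  by apply: eq_card => b; rewrite !inE.
have : (0 < 4 ^ n)%N by rewrite expn_gt0.
by case: (4 ^ n)%N => // m _; nlia.
Qed.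

(** By [neighbour_eq] distinct neighbours have disjoint sets of vectors outside [A], each of size
    4^n - 4^(n-1), among the isotropic vectors. An upper bound suffices because an injective map
    will supply as many neighbours. *)
Lemma card_neighbours A : vertex A ->
  (3 * #|[set B | vertex B && adjacent A B]| <= 2 * (4 ^ n).-1)%N.
Proof.
move=> vA; have [gA rA iA] := vertexP vA; set N := [set B | _].
pose out (B : V) := rows B :\: rows A.
have outI B C w : B \in N -> C \in N -> w \in out B -> w \in out C -> B = C.
  rewrite !inE => /andP[vB aB] /andP[vC aC] /andP[nw wB] /andP[_ wC].
  by rewrite (neighbour_eq vA vB aB wB nw) (neighbour_eq vA vC aC wC nw).
have card_out B : B \in N -> (#|out B| + 4 ^ n.-1 = 4 ^ n)%N.
  rewrite inE => /andP[/vertexP[_ rB _] /eqP aB].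
  have := cardsD (rows B) (rows A); rewrite -/(out B) card_rows rB.
  have -> : rows B :&: rows A = rows (A :&: B)%MS.
    by apply/setP => w; rewrite !inE sub_capmx andbC.
  rewrite card_rows aB => ->; rewrite subnK // leq_exp2l //; nlia.
have : (\sum_(B in N) #|out B| <= #|[set w : 'rV[F]_(n + n) | isotropic w] :\: rows A|)%N.
  under eq_bigr do rewrite -sum1_card.
  rewrite (exchange_big_dep [in [set w : 'rV[F]_(n + n) | isotropic w] :\: rows A]) /=.
    rewrite -sum1_card; apply: leq_sum => w _.
    rewrite sum1_card; apply/card_le1_eqP => B C /andP[B1 B2] /andP[C1 C2].
    exact: (outI C B w).
  move=> B w; rewrite !inE => /andP[/vertexP[_ _ iB] _] /andP[-> wB] /=.
  exact: isotropic_sub wB iB.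
have -> : (\sum_(B in N) #|out B| = #|N| * (4 ^ n - 4 ^ n.-1))%N.
  rewrite -sum_nat_const; apply: eq_bigr => B BN.
  by rewrite -(card_out B BN) addnK.
have := cardsD [set w : 'rV[F]_(n + n) | isotropic w] (rows A).
have -> : [set w : 'rV[F]_(n + n) | isotropic w] :&: rows A = rows A.
  by apply/setIidPr/subsetP => w; rewrite !inE => wA; exact: isotropic_sub wA iA.
rewrite card_rows rA => ->; have := card_isotropic.
have E : (4 ^ n = 4 * 4 ^ n.-1)%N by rewrite -expnS prednK.
have : (0 < 4 ^ n.-1)%N by rewrite expn_gt0.
rewrite E; move: (4 ^ n.-1)%N #|N| #|_| => q N' I q0 HI le.
suff : (q * (3 * N') <= q * (2 * (4 * q).-1))%N by rewrite leq_pmul2l.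
nia.
Qed.

End DualPolar.

(** * The near polygon *)

Section NearPolygon.
Variables (T : finType) (d : T -> T -> nat) (th : T -> T -> T) (D : nat).
Hypothesis d0 : forall x y, (d x y == 0) = (x == y).
Hypothesis dC : forall x y, d x y = d y x.
Hypothesis dtri : forall y x z, d x z <= d x y + d y z.
Hypothesis dmid : forall i x y, i <= d x y -> exists2 z, d x z = i & d z y = d x y - i.
Hypothesis dD : forall x y, d x y <= D.
Hypothesis dup : forall x y, d x y < D -> exists2 z, d y z = 1 & d x z = (d x y).+1.
Hypothesis th1 : forall x y, d x y = 1 -> d x (th x y) = 1 /\ d y (th x y) = 1.
Hypothesis thU : forall x y z, d x y = 1 -> d x z = 1 -> d y z = 1 -> z = th x y.
Definition mid (x y : T) := [set z | (d x z == 1) && (d z y == 1)].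
Hypothesis card_mid : forall x y, d x y = 2 -> #|mid x y| = 5.
Hypothesis line0 : forall p x y, d x y = 1 ->
  (wt (d p x) + wt (d p y) + wt (d p (th x y)) = 0)%R.
Hypothesis quad0 : forall p x y, d x y = 2 ->
  (2 * wt (d p x) + 2 * wt (d p y) + \sum_(z in mid x y) wt (d p z) = 0)%R.

Lemma dxx x : d x x = 0. Proof. by apply/eqP; rewrite d0. Qed.

Lemma d_eq0 x y : d x y = 0 -> x = y. Proof. by move/eqP; rewrite d0 => /eqP. Qed.

Lemma dnbr p x y : d x y = 1 -> d p x <= (d p y).+1 /\ d p y <= (d p x).+1.
Proof. by move=> dxy; have := dtri x p y; have := dtri y p x; rewrite (dC y x) dxy; nlia. Qed.

Lemma wtS n : (wt n.+1 = - wt n / 2)%R. Proof. by rewrite /wt exprS; ring. Qed.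
Lemma wt_neq0 n : (wt n != 0)%R. Proof. by apply: expf_neq0. Qed.

Lemma thC x y : d x y = 1 -> th y x = th x y.
Proof. by move=> dxy; have [|h1 h2] := @th1 y x; [rewrite dC | apply: thU]. Qed.

Lemma thK x y : d x y = 1 -> th x (th x y) = y.
Proof. by move=> dxy; have [h1 h2] := th1 dxy; apply/esym/thU => //; rewrite dC. Qed.

(** From any [p], a line has one nearest vertex and two that are one step farther: no other pattern
    of weights sums to zero. The next two lemmas are the other readings of this. *)
Lemma th_far p x y : d x y = 1 -> d p y = (d p x).+1 -> d p (th x y) = (d p x).+1.
Proof.
move=> dxy dpy; have [xt yt] := th1 dxy; have [h1 h2] := dnbr p xt; have [h3 h4] := dnbr p yt.
have := line0 p dxy; have := wt_neq0 (d p x); rewrite dpy.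
have : d p (th x y) = d p x \/ d p (th x y) = (d p x).+1 by nlia.
by case=> -> //; rewrite !wtS => + E; case/eqP; lra.
Qed.

Lemma th_near p x y : d x y = 1 -> d p x = d p y -> (d p (th x y)).+1 = d p x.
Proof.
move=> dxy dpy; have [xt yt] := th1 dxy; have [h1 h2] := dnbr p xt.
have := line0 p dxy; rewrite -dpy.
have : (d p (th x y)).+1 = d p x \/ d p (th x y) = d p x \/ d p (th x y) = (d p x).+1 by nlia.
case=> [//|E]; have := wt_neq0 (d p x).
by case: E => ->; rewrite ?wtS => + E; case/eqP; lra.
Qed.

Lemma th_far' p x y : d x y = 1 -> d p x = (d p y).+1 -> d p (th x y) = (d p y).+1.
Proof. by move=> dxy E; rewrite -thC // th_far // dC. Qed.

Lemma mid_dist x y z z' : d x y = 2 -> z \in mid x y -> z' \in mid x y -> z != z' -> d z z' = 2.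
Proof.
rewrite !inE => dxy /andP[/eqP xz /eqP zy] /andP[/eqP xz' /eqP zy'] ne.
have [_ le2] := dnbr z xz'; rewrite (dC z x) xz in le2.
have n0 : d z z' != 0 by rewrite d0.
have [E|] := eqVneq (d z z') 1; last by nlia.
have Ex : x = th z z' by apply: thU; rewrite // dC.
have Ey : y = th z z' by apply: thU.
by rewrite Ex Ey dxx in dxy.
Qed.

(** * Distances from a vertex [m] to a quadrangle *)

Section QuadPoint.
Variables (m x z : T).
Hypothesis dxz : d x z = 2.
Let j := d m x.
Let M := #|[set r in mid x z | d m r <= j]|.
Let a := #|[set r in mid x z | d m r < j]|.

Let dr r : r \in mid x z -> d m r <= j.+1 /\ j <= (d m r).+1.
Proof. by rewrite inE => /andP[/eqP /(dnbr m) []]. Qed.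

Let aM : a <= M <= 5.
Proof.
rewrite -(card_mid dxz) !subset_leq_card //; apply/subsetP => r; rewrite inE => /andP[rC lt] //.
by move: rC lt; rewrite !inE => -> /ltnW.
Qed.

(** Relative to distance [j], the weights at [j - 1], [j], [j + 1] are -2, 1, -1/2; these are
    interpolated by the two indicators that [a] and [M] count. *)
Lemma quad_count : (4 * wt (d m z) = wt j * (1 + 6 * a%:R - 3 * M%:R))%R.
Proof.
have := quad0 m dxz.
rewrite (eq_bigr (fun r => wt j * ((- 3) * (d m r < j)%:R + (3 / 2) * (d m r <= j)%:R - 1 / 2)))%R;
  last first.
  move=> r /dr [h1 h2].
  have : (d m r).+1 = j \/ d m r = j \/ d m r = j.+1 by nlia.
  case=> [E|[->|->]].
  - by rewrite -E leqnn leqnSn wtS /=; field.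
  - by rewrite leqnn ltnn /=; field.
  - by rewrite ltnn ltnNge leqnSn wtS /=; field.
rewrite -mulr_sumr !big_split /= -!mulr_sumr !sum_nat_cond sumr_const card_mid //.
rewrite -/a -/M -/j -mulr_natl => E; lra.
Qed.

Let cases : [/\ M = 5, a = 5 & d m z + 2 = j] \/ (2 * a + 3 = M /\ d m z + 1 = j) \/
  (2 * a = M + 1 /\ d m z = j) \/ (2 * a + 1 = M /\ d m z = j + 1) \/
  (2 * a = M /\ d m z = j + 2).
Proof.
have [h1 h2] : d m z <= j + 2 /\ j <= d m z + 2.
  by have := dtri x m z; have := dtri z m x; rewrite (dC z x) dxz -/j.
have Q := quad_count; have w0 := wt_neq0 (d m z); have aM' := aM.
have N (p q : nat) : (p%:R = q%:R :> rat)%R -> p = q by move/eqP; rewrite eqr_nat => /eqP.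
have E (s : rat) : (wt j * s = 4 * wt (d m z))%R -> (s = 1 + 6 * a%:R - 3 * M%:R)%R.
  by rewrite Q => /(mulfI (wt_neq0 j)).
have : d m z + 2 = j \/ d m z + 1 = j \/ d m z = j \/ d m z = j + 1 \/ d m z = j + 2 by nlia.
case=> [F|[F|[F|[F|F]]]]; move: E.
- rewrite -F addn2 !wtS => /(_ 16%R) H; have {}H := H ltac:(field).
  suff : 2 * a = M + 5 by move=> ?; left; split; nlia.
  by apply: N; rewrite natrM natrD; lra.
- rewrite -F addn1 !wtS => /(_ (- 8)%R) H; have {}H := H ltac:(field).
  by right; left; split=> //; apply: N; rewrite natrD natrM; lra.
- rewrite -F => /(_ 4%R) H; have {}H := H ltac:(field).
  by do 2 right; left; split=> //; apply: N; rewrite natrD natrM; lra.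
- rewrite F addn1 !wtS => /(_ (- 2)%R) H; have {}H := H ltac:(field).
  by do 3 right; left; split=> //; apply: N; rewrite natrD natrM; lra.
- rewrite F addn2 !wtS => /(_ 1%R) H; have {}H := H ltac:(field).
  by do 4 right; split=> //; apply: N; rewrite natrM; lra.
Qed.

Let close : 0 < a -> d m z <= j.
Proof.
case/card_gt0P => r; rewrite !inE => /andP[/andP[_ /eqP rz]] lt.
by have [] := dnbr m rz; nlia.
Qed.

Let distant : M < 5 -> j <= d m z.
Proof.
move=> M5; have [r rC nr] : exists2 r, r \in mid x z & ~~ (d m r <= j).
  have : ~~ (mid x z \subset [set r in mid x z | d m r <= j]).
    by apply: contraL M5 => /subset_leq_card; rewrite card_mid // -leqNgt.
  by case/subsetPn => r rC; rewrite inE rC /= => nr; exists r.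
by move: rC; rewrite inE => /andP[_ /eqP rz]; have [] := dnbr m rz; nlia.
Qed.

(** Each possible value of [d m z] turns [quad_count] into a linear equation in [M] and [a]. A
    nearer common neighbour forces [d m z <= j], a farther one [j <= d m z]. In the family
    [2 * a = M + 1] the pairs (1,1) and (5,3) are geometric; (3,2) is excluded in [quad_closed]. *)
Lemma quad_cases : [/\ M = 5, a = 5 & d m z + 2 = j] \/ [/\ M = 5, a = 1 & d m z + 1 = j] \/
  (2 * a = M + 1 /\ d m z = j) \/ [/\ M = 1, a = 0 & d m z = j + 1] \/
  [/\ M = 0, a = 0 & d m z = j + 2].
Proof.
case: cases => [h1|[[h1 h2]|[h1|[[h1 h2]|[h1 h2]]]]]; have := aM => aM'.
- by left.
- by right; left; split=> //; [have := distant; nlia..].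
- by do 2 right; left.
- by do 3 right; left; split=> //; have := close; nlia.
- by do 4 right; split=> //; have := close; nlia.
Qed.

End QuadPoint.

Lemma quad_full m x z : d x z = 2 -> (forall r, r \in mid x z -> d m r < d m x) ->
  d m z + 2 = d m x.
Proof.
move=> dxz lt; have := quad_cases m dxz.
have -> : [set r in mid x z | d m r <= d m x] = mid x z.
  by apply/setP => r; rewrite inE; case: (boolP (r \in _)) => //= /lt/ltnW.
have -> : [set r in mid x z | d m r < d m x] = mid x z.
  by apply/setP => r; rewrite inE; case: (boolP (r \in _)) => //= /lt.
by rewrite card_mid // => -[[]|[[]|[[]|[[]|[]]]]].
Qed.

Lemma quad_empty m x z : d x z = 2 -> (forall r, r \in mid x z -> d m x < d m r) ->
  d m z = d m x + 2.
Proof.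
move=> dxz lt; have := quad_cases m dxz.
have -> : [set r in mid x z | d m r <= d m x] = set0.
  apply/setP => r; rewrite [LHS]inE in_set0; apply/negP => /andP[/lt].
  by rewrite ltnNge => /negP.
have -> : [set r in mid x z | d m r < d m x] = set0.
  apply/setP => r; rewrite [LHS]inE in_set0; apply/negP => /andP[/lt].
  by rewrite ltnNge => /negP h /ltnW.
by rewrite cards0 => -[[]|[[]|[[]|[[]|[]]]]].
Qed.

(* A flip of the quadrangle: replacing [z] by the third point of the line through [z] and
   [r3] replaces every point of [mid x z] except [r3] by the third point of its line on [x]. *)
Lemma quad_flip x z r3 r : d x z = 2 -> r3 \in mid x z -> r \in mid x z -> r != r3 ->
  th x r \in mid x (th z r3).
Proof.
move=> dxz r3C rC ne; have d2 := mid_dist dxz rC r3C ne.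
move: r3C rC; rewrite !inE => /andP[/eqP xr3 /eqP r3z] /andP[/eqP xr /eqP rz].
have [xt rt] := th1 xr; rewrite xt eqxx /=; apply/eqP.
have zr3 : d z r3 = 1 by rewrite dC.
have h1 : d z (th x r) = 2 by rewrite (@th_far' z x r) // !(dC z) ?dxz rz.
have h2 : d r3 (th x r) = 2 by rewrite (@th_far r3 x r) // (dC r3 x) xr3 // dC.
have := @th_near (th x r) z r3 zr3; rewrite !(dC (th x r)) h1 h2 => /(_ erefl).
by rewrite (dC (th z r3)) => -[].
Qed.

(** The alternative to [M = 5] is [M = 3], [a = 2]. Then one flips the quadrangle at [r3], the only
    common neighbour at the distance of [x]. In the new quadrangle none is nearer than [x], yet [r3]
    and the third point of the line from [x] through a nearer [t1] are both at its distance, which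
    [quad_cases] forbids. *)
Lemma quad_closed m x z r1 r2 : d x z = 2 -> r1 \in mid x z -> r2 \in mid x z -> r1 != r2 ->
  d m r1 <= d m x -> d m r2 <= d m x -> forall r, r \in mid x z -> d m r <= d m x.
Proof.
move=> dxz r1C r2C r12 le1 le2; have Q := quad_cases m dxz.
set B := [set r in mid x z | d m r <= d m x] in Q *; set A := [set r in mid x z | d m r < d m x] in Q *.
have inB r : (r \in B) = (r \in mid x z) && (d m r <= d m x) by rewrite [LHS]inE.
have inA r : (r \in A) = (r \in mid x z) && (d m r < d m x) by rewrite [LHS]inE.
have B2 : 2 <= #|B|.
  by have := cards2 r1 r2; rewrite r12 => <-; apply/subset_leq_card/subsetP => r;
    rewrite in_set2 => /orP[]/eqP->; rewrite inB ?r1C ?r2C.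
suff [B5|[B3 A2]] : #|B| = 5 \/ #|B| = 3 /\ #|A| = 2.
- move=> r rC; have : B == mid x z.
    by rewrite eqEcard card_mid // B5 andbT; apply/subsetP => t; rewrite inE => /andP[].
  by move/eqP => EB; move: rC; rewrite -EB inE => /andP[].
- exfalso.
  have AB : A \subset B by apply/subsetP => t; rewrite inA inB => /andP[-> /ltnW].
  have /cards1P[r3 Er3] : #|B :\: A| == 1 by rewrite cardsD (setIidPr AB) B3 A2.
  have : r3 \in B :\: A by rewrite Er3 inE.
  rewrite in_setD inA inB => /andP[nA /andP[r3C le3]]; rewrite r3C /= in nA.
  have E3 : d m r3 = d m x by apply/eqP; rewrite eqn_leq le3 leqNgt.
  have only3 r : r \in mid x z -> d m r = d m x -> r = r3.
    move=> rC E; apply/eqP; rewrite -in_set1 -Er3 in_setD inA inB rC E.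
    by rewrite ltnn leqnn.
  have xr3 : d x r3 = 1 by move: r3C; rewrite inE => /andP[/eqP].
  have zr3 : d z r3 = 1 by move: r3C; rewrite dC inE => /andP[_ /eqP].
  set z' := th z r3; have dxz' : d x z' = 2 by rewrite /z' (@th_far' x z r3) // ?dxz xr3.
  have r3C' : r3 \in mid x z' by rewrite inE xr3 /=; have [_ ->] := th1 zr3.
  have far r : r \in mid x z' -> d m x <= d m r.
    move=> rC'; have [->|ne] := eqVneq r r3; first by rewrite E3.
    have xr : d x r = 1 by move: rC'; rewrite inE => /andP[/eqP].
    have := quad_flip dxz' r3C' rC' ne.
    have r3z' : d r3 z' = 1 by have [_] := th1 zr3.
    have -> : th z' r3 = z by rewrite (thC r3z') /z' -(thC zr3) thK // dC.
    move=> tC; rewrite leqNgt; apply/negP => lt.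
    have Et : d m (th x r) = d m x.
      have E : d m x = (d m r).+1 by have [] := dnbr m xr; nlia.
      by rewrite th_far'.
    have := mid_dist dxz' rC' r3C' ne; rewrite -(only3 _ tC Et).
    by have [_ ->] := th1 xr.
  have := quad_cases m dxz'; set M := #|_|; set a := #|_|.
  have a0 : a = 0.
    apply/eqP; rewrite cards_eq0 -subset0; apply/subsetP => r; rewrite inE => /andP[/far].
    by rewrite leqNgt => /negbTE->.
  have [t1] : exists t, t \in A by apply/card_gt0P; rewrite A2.
  rewrite inA => /andP[t1C lt1].
  have t1r3 : t1 != r3 by apply: contraTneq lt1 => ->; rewrite E3 ltnn.
  have xt1 : d x t1 = 1 by move: t1C; rewrite inE => /andP[/eqP].
  have tC' := quad_flip dxz r3C t1C t1r3.
  have nt : th x t1 != r3.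
    apply/eqP => E; have := mid_dist dxz t1C r3C t1r3; rewrite -E.
    by have [_ ->] := th1 xt1.
  have M2 : 2 <= M.
    have := cards2 (th x t1) r3; rewrite nt => <-; apply/subset_leq_card/subsetP => r.
    rewrite in_set2 => /orP[]/eqP->; rewrite inE ?r3C' ?le3 // tC' /=.
    have E : d m x = (d m t1).+1 by have [] := dnbr m xt1; nlia.
    by rewrite th_far' // E.
  by rewrite a0 => -[[]|[[]|[[]|[[]|[]]]]]; nlia.
- have B5 : #|B| <= 5.
    by rewrite -(card_mid dxz); apply/subset_leq_card/subsetP => t; rewrite inB => /andP[].
  by case: Q => [[]|[[]|[[]|[[]|[]]]]]; nlia.
Qed.

Lemma geo_nonadj x y p q : d x p = 1 -> d x q = 1 -> p != q -> d y p < d y x -> d y q < d y x ->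
  d p q = 2.
Proof.
move=> xp xq pq lp lq; have n0 : d p q != 0 by rewrite d0.
have [_] := dnbr p xq; rewrite (dC p x) xp => le2.
have [E|] := eqVneq (d p q) 1; last by nlia.
have Eq : q = th x p by apply: thU.
have E' : d y x = (d y p).+1 by have [] := dnbr y xp; nlia.
by have := th_far' xp E'; rewrite -Eq; nlia.
Qed.

Definition is_join x y p q z := [&& d x z == 2, d z y + 2 == d x y, d z p == 1 & d z q == 1].

(** [p] and [q] are at distance 2 from each other and equally far from [y], so [quad_cases] leaves
    [2 * a = M + 1]; hence some common neighbour is nearer to [y]. *)
Lemma join_ex x y p q : d x p = 1 -> d x q = 1 -> p != q -> d p y < d x y -> d q y < d x y ->
  exists z, is_join x y p q z.
Proof.
move=> xp xq pq lp lq.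
have dpq : d p q = 2 by apply: (@geo_nonadj x y) => //; rewrite !(dC y).
have [lep _] := dnbr y xp; have [leq _] := dnbr y xq; rewrite !(dC y) in lep leq.
have := quad_cases y dpq; rewrite !(dC y).
have -> : d p y = d q y by nlia.
set M := #|_|; set a := #|_| => H.
have : 0 < a by case: H => [[]|[[]|[[]|[[]|[]]]]]; nlia.
case/card_gt0P => z; rewrite inE => /andP[zC]; rewrite dC => lt; exists z.
move: zC; rewrite inE => /andP[/eqP pz /eqP zq].
have [h1 h2] := dnbr x pz; have [h3 h4] := dnbr y zq; rewrite !(dC y) in h3 h4.
rewrite /is_join zq (dC z p) pz eqxx andbT /=.
have := dtri z x y; rewrite xp in h1 h2; nlia.
Qed.

Lemma join_mid x y z r : d x z = 2 -> d z y + 2 = d x y -> r \in mid x z -> (d r y).+1 = d x y.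
Proof.
move=> xz zy; rewrite inE => /andP[/eqP xr /eqP rz].
by have := dtri r x y; have := dtri z r y; rewrite xr rz; nlia.
Qed.

(** All of [mid x z] is within distance 2 of [z'] by [quad_closed]. Equality at [r] would make [z']
    adjacent to [th x r], which is as far from [y] as [x] is. So all are nearer, and [quad_full]
    puts [z] at distance 0 from [z']. *)
Lemma join_uniq x y p q z z' : p != q -> d x p = 1 -> d x q = 1 ->
  is_join x y p q z -> is_join x y p q z' -> z = z'.
Proof.
move=> pq xp xq /and4P[/eqP xz /eqP zy /eqP zp /eqP zq] /and4P[/eqP xz' /eqP zy' /eqP zp' /eqP zq'].
have pC : p \in mid x z by rewrite inE xp dC zp.
have qC : q \in mid x z by rewrite inE xq dC zq.
have cl r (rC : r \in mid x z) : d z' r <= d z' x.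
  by apply: (quad_closed xz pC qC pq _ _ rC); rewrite (dC z' x) xz' ?zp' ?zq'.
apply/esym/d_eq0; suff H r : r \in mid x z -> d z' r < d z' x.
  by have := quad_full xz H; rewrite (dC z' x) xz'; nlia.
move=> rC; rewrite (dC z' x) xz'.
have xr : d x r = 1 by move: rC; rewrite inE => /andP[/eqP].
have := cl r rC; rewrite (dC z' x) xz' leq_eqVlt => /orP[/eqP E|//].
have := @th_near z' x r xr; rewrite (dC z' x) xz' E => /(_ erefl) [E1].
have jm := join_mid xz zy rC; have F : d y x = (d y r).+1 by rewrite !(dC y) jm.
have := dtri z' (th x r) y; rewrite (dC _ z') E1 (dC _ y) (th_far' xr F) -F (dC y); nlia.
Qed.

Lemma quad_all m x z : d x z = 2 -> (forall r, r \in mid x z -> d m r <= d m x) -> d m z <= d m x.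
Proof.
move=> dxz le; have := quad_cases m dxz.
have -> : [set r in mid x z | d m r <= d m x] = mid x z.
  by apply/setP => r; rewrite inE; case: (boolP (r \in _)) => //= /le.
by rewrite card_mid // => -[[]|[[]|[[]|[[]|[]]]]]; nlia.
Qed.

Lemma wt_eq1 n : (wt n = 1)%R -> n = 0.
Proof.
case: n => // n; have : (-1 <= wt n <= 1)%R.
  by elim: n => [|n IH]; rewrite ?wtS; [rewrite /wt expr0 | lra].
by rewrite wtS => /andP[h1 h2] E; exfalso; lra.
Qed.

(** By [quad0], the weight at a vertex follows from weights closer to [x]; so the given distances
    determine all weights, and weight 1 means distance 0. *)
Lemma dist_nbr_inj x v v' : d x v = d x v' -> (forall r, d x r = 1 -> d v r = d v' r) -> v = v'.
Proof.
move=> dx dr; suff H n p : d x p = n -> wt (d v p) = wt (d v' p).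
  by apply/d_eq0/wt_eq1; rewrite dC -(H _ _ erefl) dxx /wt expr0.
elim/ltn_ind: n p => -[|[|n]] IH p dp.
- by rewrite -(d_eq0 dp) !(dC _ x) dx.
- by rewrite dr.
have [a xa ap] : exists2 a, d x a = n & d a p = 2.
  by have [|a xa ap] := @dmid n x p; [nlia | exists a => //; nlia].
have := quad0 v ap; have := quad0 v' ap; rewrite (IH n _ a) //.
rewrite [X in (_ + X = 0)%R -> _](eq_bigr (fun z => wt (d v z))) => [|z]; first lra.
rewrite inE => /andP[/eqP az /eqP zp]; rewrite (IH n.+1) //.
by have := dtri a x z; have := dtri z x p; nlia.
Qed.

(* The interval between [v'] and [x] is determined by the neighbours of [v'] in it. *)
Lemma geodesic_criterion v' v x :
  (forall q, d v' q = 1 -> d q v < d v' v -> d q x < d v' x) -> d v x + d v' v = d v' x.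
Proof.
move: {2}(d v' v) (erefl (d v' v)) => j; elim: j v' => [|j IH] v' dj H.
  by rewrite dj addn0 (d_eq0 dj).
have [|p pv' pv] := @dmid 1 v' v; first by rewrite dj.
have lp := H p pv'; have [_ px] := dnbr x pv'; have [px' _] := dnbr x pv'.
rewrite !(dC x) in px px'.
have E : d v x + d p v = d p x; last by rewrite dj -E in lp *; nlia.
apply: IH => [|w pw lw]; first by nlia.
have v'w : d v' w = 2 by have := dtri p v' w; have := dtri w v' v; nlia.
have := @quad_full x v' w v'w; rewrite !(dC x) => Q.
suff : d w x + 2 = d v' x by nlia.
apply: Q => q; rewrite inE => /andP[/eqP v'q /eqP qw]; rewrite (dC x); apply: H => //.
by have := dtri w q v; nlia.
Qed.

(** Otherwise every neighbour of [v'] nearer to [v] is nearer to [x] too, and [geodesic_criterion]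
    yields [D + d v' v = D]. This lets forms be propagated among the vertices opposite to [x]. *)
Lemma far_connected x v v' : d x v = D -> d x v' = D -> v != v' ->
  exists q, [/\ d v' q = 1, (d q v).+1 = d v' v & d x q = D].
Proof.
move=> xv xv' ne.
have [|none] := boolP [exists q, [&& d v' q == 1, (d q v).+1 == d v' v & d x q == D]].
  by case/existsP => q /and3P[/eqP ? /eqP ? /eqP ?]; exists q.
have n0 : d v' v != 0 by rewrite d0 eq_sym.
have := @geodesic_criterion v' v x; rewrite !(dC _ x) xv xv' => H.
suff /H : forall q, d v' q = 1 -> d q v < d v' v -> d q x < D by nlia.
move=> q v'q lt; rewrite ltn_neqAle dD andbT; apply/negP => /eqP qx.
case/existsP: none; exists q; rewrite v'q eqxx (dC x) qx eqxx andbT /=.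
by have := dtri q v' v; nlia.
Qed.

(** * The projective space of geodesics from [x] to [y] and its subspaces *)

Section Base.
Variables x y : T.
Hypothesis xy : d x y = D.
Hypothesis D2 : 2 <= D.

Definition pts : {set T} := [set p | (d x p == 1) && ((d p y).+1 == D)].
Definition jn p q : T := odflt x [pick z | is_join x y p q z].
Definition ln p q : {set T} := mid x (jn p q).
(** Equality is allowed on purpose: on this subspace the Hermitian form will tell the nearer points
    from those at the distance of [x]. *)
Definition toward m : {set T} := [set r in pts | d m r <= d m x].

Lemma ptsP p : reflect (d x p = 1 /\ (d p y).+1 = D) (p \in pts).
Proof. by rewrite inE; apply: (iffP andP) => -[/eqP ? /eqP ?]. Qed.

Lemma jnP p q : p \in pts -> q \in pts -> p != q -> is_join x y p q (jn p q).
Proof.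
move=> /ptsP[xp py] /ptsP[xq qy] pq; have [||z zJ] := @join_ex x y p q xp xq pq; [nlia..|].
by rewrite /jn; case: pickP => [//|/(_ z)]; rewrite zJ.
Qed.

Lemma mid_pts z r : d x z = 2 -> d z y + 2 = D -> r \in mid x z -> r \in pts.
Proof.
move=> xz zy rC; apply/ptsP; rewrite -xy (join_mid (y := y) xz) ?xy //; split=> //.
by move: rC; rewrite inE => /andP[/eqP].
Qed.

Lemma jn_eq p q z : p != q -> d x z = 2 -> d z y + 2 = D -> p \in mid x z -> q \in mid x z ->
  jn p q = z.
Proof.
move=> pq xz zy pC qC; have pP := mid_pts xz zy pC; have qP := mid_pts xz zy qC.
have /ptsP[xp _] := pP; have /ptsP[xq _] := qP.
apply: (join_uniq pq xp xq (jnP pP qP pq)); rewrite /is_join xz eqxx xy zy eqxx.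
by move: pC qC; rewrite !inE !(dC z) => /andP[_ ->] /andP[_ ->].
Qed.

Lemma jn_dist p q : p \in pts -> q \in pts -> p != q ->
  [/\ d x (jn p q) = 2, d (jn p q) y + 2 = D, p \in ln p q & q \in ln p q].
Proof.
move=> pP qP pq; have /and4P[/eqP h1 /eqP h2 /eqP h3 /eqP h4] := jnP pP qP pq.
have /ptsP[xp _] := pP; have /ptsP[xq _] := qP.
by split; rewrite ?inE ?xp ?xq -?xy // dC ?h3 ?h4.
Qed.

Lemma ln_pts p q : p \in pts -> q \in pts -> p != q -> ln p q \subset pts.
Proof.
by move=> pP qP pq; have [h1 h2 _ _] := jn_dist pP qP pq; apply/subsetP => r; apply: mid_pts.
Qed.

Lemma card_ln p q : p \in pts -> q \in pts -> p != q -> #|ln p q| = 5.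
Proof. by move=> pP qP pq; have [h1 _ _ _] := jn_dist pP qP pq; apply: card_mid. Qed.

Lemma ln_eq p q r s : p \in pts -> q \in pts -> p != q -> r \in ln p q -> s \in ln p q ->
  r != s -> ln r s = ln p q.
Proof.
move=> pP qP pq rC sC rs; have [h1 h2 _ _] := jn_dist pP qP pq.
by rewrite /ln; congr mid; apply: jn_eq.
Qed.

Lemma towardE m r : (r \in toward m) = (r \in pts) && (d m r <= d m x).
Proof. by rewrite [LHS]inE. Qed.

Lemma toward_ln m p q : p \in toward m -> q \in toward m -> p != q -> ln p q \subset toward m.
Proof.
rewrite !towardE => /andP[pP pm] /andP[qP qm] pq.
have [h1 h2 h3 h4] := jn_dist pP qP pq.
apply/subsetP => r rC; rewrite towardE (mid_pts h1 h2 rC) /=.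
exact: (quad_closed h1 h3 h4 pq pm qm rC).
Qed.

Lemma meet_ln m p q : p \in pts -> q \in pts -> p != q -> d m (jn p q) < d m x + 2 ->
  exists2 r, r \in ln p q & r \in toward m.
Proof.
move=> pP qP pq lt; have [h1 h2 h3 h4] := jn_dist pP qP pq.
have [|/exists_inPn H] := boolP [exists r in mid x (jn p q), d m r <= d m x].
  by case/exists_inP => r rC le; exists r => //; rewrite towardE (mid_pts h1 h2 rC).
have := @quad_empty m _ _ h1; move=> E; exfalso.
have /E : forall r, r \in mid x (jn p q) -> d m x < d m r by move=> r /H; rewrite ltnNge.
by nlia.
Qed.

(** Equality would make [th x r] nearer to [z] than [x] is, though as far from [y] as [x], against
    [z] lying between [x] and [y]. *)
Lemma toward_geo z r : d x z + d z y = D -> r \in toward z -> r \in pts /\ d z r < d x z.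
Proof.
move=> xzy; rewrite towardE => /andP[rP]; rewrite (dC z x) leq_eqVlt => /orP[/eqP E|//].
exfalso; have /ptsP[xr ry] := rP; have := @th_near z x r xr; rewrite (dC z x) E => /(_ erefl) Et.
have F : d y x = (d y r).+1 by rewrite (dC y x) xy dC ry.
have := th_far' xr F; have := dtri z (th x r) y; rewrite (dC _ z) -F (dC y) (dC y) xy; nlia.
Qed.

(** The plane is [toward z], with [z] at distance 3 from [x] the join, seen from [a], of [jn a b]
    and [jn a c]. Its lines are the [mid x w] with [w] adjacent to [z]; two such [w] are at distance
    at most 2, so [meet_ln] provides a common point. *)
Lemma plane_ex a b c : a \in pts -> b \in pts -> c \in pts -> a != b -> c \notin ln a b ->
  exists Pi : {set T}, [/\ Pi \subset pts, [/\ a \in Pi, b \in Pi & c \in Pi],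
    (forall p q, p \in Pi -> q \in Pi -> p != q -> ln p q \subset Pi) &
    (forall p q r s, p \in Pi -> q \in Pi -> p != q -> r \in Pi -> s \in Pi -> r != s ->
       exists2 t, t \in ln p q & t \in ln r s)].
Proof.
move=> aP bP cP ab cab.
have [h1 h2 h3 h4] := jn_dist aP bP ab.
have ac : a != c by apply: contraNneq cab => <-.
have [k1 k2 k3 k4] := jn_dist aP cP ac.
have ne : jn a b != jn a c by apply: contraNneq cab => E; rewrite /ln E.
have /ptsP[xa ay] := aP.
have aw : d a (jn a b) = 1 by move: h3; rewrite inE => /andP[_ /eqP].
have aw' : d a (jn a c) = 1 by move: k3; rewrite inE => /andP[_ /eqP].
have [||z /and4P[/eqP az /eqP zy /eqP zw /eqP zw']] := @join_ex a y _ _ aw aw' ne; [nlia..|].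
have xz : d x z = 3 by have := dtri a x z; have := dtri z x y; nlia.
have jnz p q : p \in toward z -> q \in toward z -> p != q -> d z (jn p q) = 1.
  move=> /toward_geo [|pP pz]; first by nlia.
  move=> /toward_geo [|qP qz pq]; first by nlia.
  have /ptsP[xp _] := pP; have /ptsP[xq _] := qP.
  have lp : d p z < d x z by rewrite (dC p).
  have lq : d q z < d x z by rewrite (dC q).
  have [w /and4P[/eqP xw /eqP wz /eqP wp /eqP wq]] := join_ex xp xq pq lp lq.
  rewrite xz in wz; have zw0 : d z w = 1 by rewrite dC; nlia.
  have wy : d w y + 2 = D by have := dtri z w y; have := dtri w x y; nlia.
  have pC : p \in mid x w by rewrite inE xp (dC p) wp.
  have qC : q \in mid x w by rewrite inE xq (dC q) wq.
  by rewrite (jn_eq pq xw wy pC qC).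
have inz w r : d z w = 1 -> d w r = 1 -> r \in pts -> r \in toward z.
  by move=> zw0 wr rP; rewrite towardE rP (dC z x) xz; have := dtri w z r; nlia.
exists (toward z); split.
- by apply/subsetP => r; rewrite towardE => /andP[].
- have mem w r : r \in mid x w -> d w r = 1 by rewrite inE (dC w) => /andP[_ /eqP].
  by split; [exact: (inz _ _ zw (mem _ _ h3)) | exact: (inz _ _ zw (mem _ _ h4))
    | exact: (inz _ _ zw' (mem _ _ k4))].
- by move=> p q; apply: toward_ln.
move=> p q r s pz qz pq rz sz rs.
have := jnz p q pz qz pq; have := jnz r s rz sz rs.
move: rz sz pz qz; rewrite !towardE => /andP[rP _] /andP[sP _] /andP[pP _] /andP[qP _] z1 z2.
have [l1 l2 l3 l4] := jn_dist rP sP rs.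
have [|t tC] := @meet_ln (jn r s) p q pP qP pq.
  by rewrite (dC _ x) l1; have := dtri z (jn r s) (jn p q); rewrite (dC _ z); nlia.
move=> /toward_geo[|tP tr]; first by nlia.
exists t => //; have /ptsP[xt _] := tP; rewrite inE xt eqxx /= dC.
rewrite l1 in tr; apply/eqP; have : d (jn r s) t != 0; last by nlia.
by rewrite d0; apply: contra_eqN xt => /eqP <-; rewrite l1.
Qed.

(* [z] and [z'] are consecutive on a geodesic; [th z z'] is then at the same level as [z']. *)
Lemma step_dist z z' r : d z z' = 1 -> d x z' = (d x z).+1 -> r \in toward z ->
  r \in toward z' /\ (d z' r < d x z') = (d z r < d x z).
Proof.
move=> zz' xz'; rewrite !towardE => /andP[rP le]; rewrite rP /=.
have /ptsP[xr _] := rP; rewrite !(dC _ x) xz' in le *.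
have h1 := dnbr r zz'; have h2 := dnbr z' xr; rewrite !(dC r) !(dC z' x) xz' in h1 h2.
split; first by nlia.
have [E|ne] := eqVneq (d z r) (d x z); last by nlia.
have := @th_near z x r xr; rewrite (dC z x) E => /(_ erefl) Et.
have [xt rt] := th1 xr; have h3 := dnbr (th x r) zz'; have h4 := dnbr z' xt.
rewrite !(dC (th x r)) !(dC z' x) xz' in h3 h4.
have : d z' r = d x z'; last by nlia.
have F : d z' x = (d z' (th x r)).+1 by rewrite (dC z' x); nlia.
by have := th_far' xt F; rewrite thK // => ->; nlia.
Qed.

Lemma step_same z z' r : d z z' = 1 -> d x z' = (d x z).+1 -> r \in toward z ->
  d z' r = d (th z z') r.
Proof.
move=> zz' xz' rz; have [zt zt'] := th1 zz'; have xt := th_far zz' xz'.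
have [h1 h2] := step_dist zz' xz' rz; have [k1 k2] := step_dist zt xt rz.
move: h1 k1 h2 k2; rewrite !towardE => /andP[rP l1] /andP[_ l2]; have /ptsP[xr _] := rP.
have h3 := dnbr z' xr; have h4 := dnbr (th z z') xr; rewrite !(dC _ x) xz' xt in h3 h4 l1 l2 *.
by move=> <-; case: ltnP => ? /esym; case: ltnP => ? // _; nlia.
Qed.

(** Such an [r] is farther from [z] than [x] is, by one, and the vertex of the line nearest to [r]
    is either [z'] or [th z z']. So the two records agree on [toward z] ([step_same]) and are
    opposite on the rest of [toward z']. *)
Lemma step_diff z z' r : d z z' = 1 -> d x z' = (d x z).+1 -> r \in toward z' -> r \notin toward z ->
  r \in toward (th z z') /\ (d (th z z') r < d x z') = ~~ (d z' r < d x z').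
Proof.
move=> zz' xz'; rewrite !towardE => /andP[rP l1]; rewrite rP /= -ltnNge => l2.
have /ptsP[xr _] := rP; have [zt zt'] := th1 zz'; have xt := th_far zz' xz'.
have h1 := dnbr z xr; rewrite !(dC _ x) xt in h1 l1 l2 *.
have h2 := dnbr r zz'; rewrite !(dC r) in h2.
have rz : d r z = (d x z).+1 by rewrite (dC r); nlia.
have [E|E] : d z' r = d x z' \/ (d z' r).+1 = d x z' by nlia.
- have F : d r z = d r z' by rewrite rz -xz' -E dC.
  have [G] : (d r (th z z')).+1 = (d x z).+1 by rewrite (th_near zz' F).
  by rewrite (dC _ r) G E xz' leqnSn ltnSn ltnn.
- have F : d r z = (d r z').+1 by rewrite (dC r z'); nlia.
  have := th_far' zz' F; rewrite -F rz => G.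
  by rewrite (dC _ r) G xz' leqnn ltnn -xz' -E ltnSn.
Qed.

Lemma third_pts r : d x r = 1 -> r \notin pts -> th x r \in pts.
Proof.
move=> xr /ptsP nP; have [h1 h2] := dnbr y xr; have le := dD y r.
have yr : d y r = d y x.
  rewrite (dC y x) xy in h1 h2 *; have [E|ne] := eqVneq (d y r).+1 D; last by nlia.
  by case: nP; split=> //; rewrite dC.
have [xt rt] := th1 xr.
by apply/ptsP; split=> //; rewrite dC (th_near xr) ?yr // (dC y) xy.
Qed.

(** Each line on [x] contains a point of [pts], and the distances to it and to [x] determine the
    distance to the third vertex; then [dist_nbr_inj] applies. *)
Lemma pts_inj v v' : d x v = d x v' -> (forall r, r \in pts -> d v r = d v' r) -> v = v'.
Proof.
move=> dv dr; apply: dist_nbr_inj (dv) _ => r xr.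
have [rP|nP] := boolP (r \in pts); first exact: dr.
have [xt rt] := th1 xr; have tP := third_pts xr nP.
have E := dr _ tP; rewrite -(thK xr).
have h := dnbr v xt; have dv2 : d v x = d v' x by rewrite (dC v) dv dC.
have [F|[F|F]] : d v (th x r) = d v x \/ d v (th x r) = (d v x).+1 \/ d v x = (d v (th x r)).+1.
  by nlia.
- have F' : d v' (th x r) = d v' x by rewrite -E -dv2.
  by apply: succn_inj; rewrite !th_near.
- have F' : d v' (th x r) = (d v' x).+1 by rewrite -E -dv2.
  by rewrite (th_far xt F) (th_far xt F') -dv2.
- have F' : d v' x = (d v' (th x r)).+1 by rewrite -E -dv2.
  by rewrite (th_far' xt F) (th_far' xt F') E.
Qed.

(** If the line [mid x w] missed [toward z], then [w] would be at distance [d x z + 2] from [z],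
    while neither [z'] nor [th z z'] would be farther from [w] than from [x]: two vertices of a line
    nearer to [w] than the third. *)
Lemma step_meet z z' p q : d z z' = 1 -> d x z' = (d x z).+1 ->
  p \in toward z' -> q \in toward z' -> p != q -> exists2 r, r \in ln p q & r \in toward z.
Proof.
move=> zz' xz' pz qz pq; have /subsetP cl := toward_ln pz qz pq.
have pP : p \in pts by move: pz; rewrite towardE => /andP[].
have qP : q \in pts by move: qz; rewrite towardE => /andP[].
have [h1 _ _ _] := jn_dist pP qP pq; set w := jn p q in h1.
have [|/exists_inPn none] := boolP [exists r in mid x w, d z r <= d x z].
  case/exists_inP => r rC le; exists r => //; rewrite towardE.
  by move: (cl r rC) le; rewrite towardE (dC z x) => /andP[-> _] ->.
have [zt zt'] := th1 zz'; have xt := th_far zz' xz'.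
have far r : r \in mid x w -> r \notin toward z.
  by move=> /none; rewrite towardE (dC z x) => /negbTE->; rewrite andbF.
have zw : d z w = d x z + 2.
  rewrite (dC x z); apply: quad_empty => // r /none; rewrite ltnNge (dC z x) //.
have z'w : d z' w <= d z' x.
  by apply: quad_all h1 _ => r rC; have := cl r rC; rewrite towardE => /andP[].
have tw : d (th z z') w <= d (th z z') x.
  apply: quad_all h1 _ => r rC; have [] := step_diff zz' xz' (cl r rC) (far r rC).
  by rewrite towardE => /andP[].
have F : d w z = (d w z').+1.
  by have := dnbr w zz'; rewrite !(dC w) (dC z' x) in z'w *; nlia.
have G := th_far' zz' F; rewrite !(dC w) in F G; rewrite (dC _ x) in z'w; rewrite (dC _ x) in tw.
nlia.
Qed.

(** Without a new point, [z'] and [th z z'] would have the same distance to every point of [pts],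
    hence be equal. *)
Lemma step_strict z z' : d z z' = 1 -> d x z' = (d x z).+1 ->
  exists2 r, r \in toward z' & r \notin toward z.
Proof.
move=> zz' xz'; apply/subsetPn; apply/negP => /subsetP sub.
have [zt zt'] := th1 zz'; have xt := th_far zz' xz'.
suff E : z' = th z z' by move: zt'; rewrite -E dxx.
apply: pts_inj => [|r rP]; first by rewrite xt.
have [rz|nz] := boolP (r \in toward z); first exact: step_same.
have nz' : r \notin toward z' by apply: contra nz; exact: sub.
have /ptsP[xr _] := rP; move: nz nz'; rewrite !towardE rP /= -!ltnNge => lz lz'.
have h1 := dnbr z' xr; have h2 := dnbr r zz'; have h3 := dnbr z xr.
rewrite !(dC r) !(dC _ x) in h1 h2 h3 lz lz'.
have F : d r z' = (d r z).+1 by rewrite !(dC r); nlia.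
by have := th_far zz' F; rewrite -F !(dC r).
Qed.

Lemma toward_far m : d x m = D -> toward m = pts.
Proof. by move=> xm; apply/setP => r; rewrite towardE (dC m x) xm dD andbT. Qed.

Lemma toward_base : toward x = set0.
Proof.
apply/setP => r; rewrite towardE in_set0; apply/negP => /andP[/ptsP[xr _]].
by rewrite dxx xr.
Qed.

Lemma far_ex v : exists2 w, d x w = D & d x v + d v w = D.
Proof.
move: {2}(D - d x v) (erefl (D - d x v)) => n; elim: n v => [|n IH] v E.
  by exists v; rewrite ?dxx; have := dD x v; nlia.
have [|z vz xz] := @dup x v; first by nlia.
have [|w xw zw] := IH z; first by rewrite xz; nlia.
exists w => //; have := dtri z v w; have := dtri v x w; nlia.
Qed.

Lemma toward_geodesic v w r : d x v + d v w = d x w -> r \in toward v ->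
  r \in toward w /\ (d w r < d x w) = (d v r < d x v).
Proof.
move: {2}(d v w) (erefl (d v w)) => n; elim: n v => [|n IH] v vw E rv.
  by rewrite -(d_eq0 vw).
have [|z vz zw] := @dmid 1 v w; first by rewrite vw.
have xz : d x z = (d x v).+1 by have := dtri v x z; have := dtri z x w; nlia.
have [rz <-] := step_dist vz xz rv; apply: IH => //; nlia.
Qed.

Lemma card_nbr_pts : #|[set r | d x r == 1]| = 2 * #|pts|.
Proof.
have thI : {in pts &, injective (th x)}.
  by move=> p q /ptsP[xp _] /ptsP[xq _] E; rewrite -(thK xp) E thK.
rewrite mul2n -addnn -{2}(card_in_imset thI) -cardsUI.
have -> : pts :&: th x @: pts = set0.
  apply/setP => p; rewrite in_set0 in_setI; apply/negP => /andP[pP /imsetP[q qP E]].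
  have /ptsP[xp py] := pP; have /ptsP[xq qy] := qP.
  have F : d y x = (d y q).+1 by rewrite (dC y x) (dC y q) xy.
  by have := th_far' xq F; rewrite -E (dC y p) (dC y q); nlia.
rewrite cards0 addn0; apply: eq_card => r; rewrite inE in_setU.
apply/eqP/orP => [xr|[/ptsP[]//|/imsetP[q /ptsP[xq _] ->]]]; last by have [] := th1 xq.
have [rP|nP] := boolP (r \in pts); [by left | right].
apply/imsetP; exists (th x r); last by rewrite thK.
exact: third_pts.
Qed.

Section FieldCoordinates.
Variable F : finFieldType.
Hypothesis cardF : #|F| = 4.
Local Open Scope ring_scope.

Let ln_l p q : p \in pts -> q \in pts -> p != q -> p \in ln p q.
Proof. by move=> pP qP pq; have [] := jn_dist pP qP pq. Qed.
Let ln_r p q : p \in pts -> q \in pts -> p != q -> q \in ln p q.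
Proof. by move=> pP qP pq; have [] := jn_dist pP qP pq. Qed.

Lemma toward_closed m : line_closed ln pts (toward m).
Proof.
split; first by apply/subsetP => r; rewrite towardE => /andP[].
by move=> p q; apply: toward_ln.
Qed.

Let planes a b c : a \in pts -> b \in pts -> c \in pts -> a != b -> c \notin ln a b ->
  exists Pi, plane ln pts Pi /\ [/\ a \in Pi, b \in Pi & c \in Pi].
Proof.
move=> aP bP cP ab cab; have [Pi [h1 h2 h3 h4]] := plane_ex aP bP cP ab cab.
by exists Pi.
Qed.

(** Along a geodesic each [toward z] is a hyperplane of the next, by [step_meet] and [step_strict].
    The start is a single point; extending it to a line is separate, since there are no two
    independent vectors yet. *)
Lemma coordinates_ex i z : (0 < i)%N -> d x z = i -> (i + d z y)%N = D ->
  exists pt : 'rV[F]_i -> T, coordinates ln (toward z) pt.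
Proof.
elim: i z => // -[|i] IH z' _ xz' zy'.
  have tz : toward z' = [set z'].
    apply/setP => r; rewrite in_set1; apply/idP/eqP => [/toward_geo[|_]|->].
    - by rewrite xz'.
    - by rewrite xz' ltnS leqn0 => /eqP/d_eq0->.
    - by rewrite towardE dxx andbT; apply/ptsP; split.
  exists (fun=> z'); rewrite tz; split=> [v _|h|v w v0 w0|v w _ _].
  - by rewrite inE.
  - rewrite inE => /eqP ->; exists (const_mx 1) => //; apply/eqP => /rowP/(_ ord0).
    by rewrite !mxE => /eqP; rewrite oner_eq0.
  - split=> // _; have v00 : v 0 0 != 0.
      by apply: contraNneq v0 => E; apply/eqP/rowP => j; rewrite !ord1 E mxE.
    exists (w 0 0 / v 0 0); apply/rowP => j; rewrite !ord1 mxE divfK //.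
  - by rewrite eqxx.
have [z xz zz'] : exists2 z, d x z = i.+1 & d z z' = 1%N.
  have [|z xz zz'] := @dmid i.+1 x z'; first by rewrite xz'.
  by exists z => //; rewrite zz' xz'; nlia.
have xz1 : d x z' = (d x z).+1 by rewrite xz xz'.
have zy : (i.+1 + d z y)%N = D.
  by have := dtri z' z y; have := dtri z x y; nlia.
have [pt ptH] := IH z isT xz zy.
have HS : toward z \subset toward z'.
  by apply/subsetP => r rz; have [] := step_dist zz' xz1 rz.
have [a aS aH] := step_strict zz' xz1.
have SH p q : p \in toward z' -> q \in toward z' -> p != q -> exists2 t, t \in ln p q & t \in toward z.
  exact: step_meet.
suff [psi chart] : exists psi, affine_chart ln (toward z) pt (toward z') psi.
  by exists (extend_pt pt psi);
    apply: (extend_coordinates cardF ln_l ln_r ln_eq ptH (toward_closed z') HS).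
case: i pt ptH {IH xz' zy' xz zy} => [|i] pt ptH.
  apply: (chart_of_line cardF ln_l ln_r card_ln ln_eq ptH (toward_closed z') HS aS aH SH) => //.
  move=> v w v0 w0; case: (ptH) => _ _ h _; apply/h => //.
  have v00 : v 0 0 != 0.
    by apply: contraNneq v0 => E; apply/eqP/rowP => j; rewrite !ord1 E mxE.
  exists (w 0 0 / v 0 0); apply/rowP => j; rewrite !ord1 mxE divfK //.
pose e : 'rV[F]_i.+2 := delta_mx 0 0; pose f : 'rV[F]_i.+2 := delta_mx 0 1.
have e0 : e != 0 by apply/eqP => /rowP/(_ 0); rewrite !mxE !eqxx => /eqP; rewrite oner_eq0.
have f0 : f != 0 by apply/eqP => /rowP/(_ 1); rewrite !mxE !eqxx => /eqP; rewrite oner_eq0.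
have ef : indep pt e f.
  rewrite /indep e0 f0; apply/eqP => E; case: (ptH) => _ _ /(_ e f e0 f0) [/(_ E)[l El] _] _.
  by move/rowP/(_ 1): El; rewrite !mxE /= mulr0 => /eqP; rewrite oner_eq0.
exact: (chart_of_indep cardF ln_l ln_r card_ln ln_eq planes (toward_closed z) ptH (toward_closed z') 
  HS aS aH SH ef).
Qed.

Lemma pts_coordinates : exists pt : 'rV[F]_D -> T, coordinates ln pts pt.
Proof.
have D0 : (0 < D)%N by exact: ltnW.
have E : (D + d y y)%N = D by rewrite dxx addn0.
have [pt ptH] := coordinates_ex D0 xy E.
by exists pt; rewrite -(toward_far xy).
Qed.

End FieldCoordinates.

(** * The map to the dual polar graph *)

Section DualPolarModel.
Variables (F : finFieldType) (pt : 'rV[F]_D -> T).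
Hypotheses (cardF : #|F| = 4) (ptH : coordinates ln pts pt).
Local Open Scope ring_scope.

Let pt_in v : v != 0 -> pt v \in pts. Proof. by case: ptH => h _ _ _; exact: h. Qed.
Let pt_surj r : r \in pts -> exists2 v, v != 0 & pt v = r.
Proof. by case: ptH => _ h _ _; exact: h. Qed.
Let pt_eq v w : v != 0 -> w != 0 -> (pt v = pt w <-> exists l, w = l *: v).
Proof. by case: ptH => _ _ h _; exact: h. Qed.
Let pt_add v w : v != 0 -> w != 0 -> pt v != pt w -> pt (v + w) \in ln (pt v) (pt w).
Proof. by case: ptH => _ _ _ h; exact: h. Qed.
Let pt_scale l v : l != 0 -> v != 0 -> pt (l *: v) = pt v.
Proof.
by move=> l0 v0; apply/esym/pt_eq; rewrite ?scaler_eq0 ?negb_or ?l0 //; exists l.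
Qed.

Definition Umx m : 'M[F]_D := odflt 0
  [pick U : 'M[F]_D | [forall u : 'rV_D, (u <= U)%MS == (u == 0) || (pt u \in toward m)]].

Lemma UmxP m u : (u <= Umx m)%MS = (u == 0) || (pt u \in toward m).
Proof.
rewrite /Umx; case: pickP => [U /forallP/(_ u)/eqP // | none].
pose Q : pred 'rV[F]_D := fun u => (u == 0) || (pt u \in toward m).
have [|||U HU] := @span_ex F D Q; rewrite /Q ?eqxx //.
- move=> v w; have [->|v0] /= := eqVneq v 0; first by rewrite add0r.
  have [->|w0] /= := eqVneq w 0; first by rewrite addr0 (negbTE v0).
  move=> tv tw; have [//|vw0] /= := eqVneq (v + w) 0.
  have [/pt_eq [] // l El|ne] := eqVneq (pt v) (pt w).
    move: vw0; rewrite El -{1}[v]scale1r -scalerDl scaler_eq0 negb_or => /andP[l0 _].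
    by rewrite -{1}[v]scale1r -scalerDl pt_scale.
  have /subsetP := toward_ln tv tw ne; apply; exact: pt_add.
- move=> l v; have [->|v0] /= := eqVneq v 0; first by rewrite scaler0 eqxx.
  by have [->|l0] := eqVneq l 0; rewrite ?scale0r ?eqxx // pt_scale // => ->; rewrite orbT.
by have /forallP[] := none U; move=> u'; rewrite HU.
Qed.

Lemma Umx_le z z' : toward z \subset toward z' -> (Umx z <= Umx z')%MS.
Proof.
move=> /subsetP sub; apply/row_subP => i; have := row_sub i (Umx z).
by rewrite !UmxP => /orP[->//|/sub->]; rewrite orbT.
Qed.

(** For two points of [toward z'], the first outside [toward z], a combination lies in [Umx z] by
    [step_meet]; so [Umx z] and one vector [b0] span [Umx z']. *)
Lemma rank_step z z' : d z z' = 1%N -> d x z' = (d x z).+1 ->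
  (Umx z <= Umx z')%MS /\ (\rank (Umx z') <= (\rank (Umx z)).+1)%N.
Proof.
move=> zz' xz'; split.
  by apply: Umx_le; apply/subsetP => r rz; have [] := step_dist zz' xz' rz.
have [sub|] := boolP (Umx z' <= Umx z)%MS; first by apply: leq_trans (mxrankS sub) _.
case/row_subPn => i; set b0 := row i _ => nb0.
have b00 : b0 != 0 by apply: contraNneq nb0 => ->; rewrite sub0mx.
have b0z' : pt b0 \in toward z'.
  by have := row_sub i (Umx z'); rewrite -/b0 UmxP (negbTE b00).
have nb0z : pt b0 \notin toward z by apply: contra nb0; rewrite UmxP => ->; rewrite orbT.
suff le : (Umx z' <= Umx z + b0)%MS.
  apply: leq_trans (mxrankS le) _; have := mxrank_adds_leqif (Umx z) b0 => -[h _].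
  by apply: leq_trans h _; rewrite -[X in (_ <= X)%N]addn1 leq_add2l rank_leq_row.
apply/row_subP => j; set b := row j _.
have [->|bn0] := eqVneq b 0; first exact: sub0mx.
have bz' : pt b \in toward z' by have := row_sub j (Umx z'); rewrite -/b UmxP (negbTE bn0).
have [/pt_eq [] // l ->|ne] := eqVneq (pt b0) (pt b).
  by rewrite scalemx_sub ?addsmxSr.
have [r rl rz] := step_meet zz' xz' b0z' bz' ne.
have rP : r \in pts by move: rz; rewrite towardE => /andP[].
have [u u0 Eu] := pt_surj rP; rewrite -Eu in rl rz.
have ind : indep pt b0 b by rewrite /indep b00 bn0.
have clP : line_closed ln pts pts by split=> // p q; exact: ln_pts.
have [al [be Eab]] : exists al be, u = al *: b0 + be *: b.
  apply: (pt_span cardF _ _ card_ln clP ptH ind u0 rl) => p q pP qP pq.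
    by have [] := jn_dist pP qP pq.
  by have [] := jn_dist pP qP pq.
have uU : (u <= Umx z)%MS by rewrite UmxP rz orbT.
have be0 : be != 0.
  apply: contraNneq nb0z => E; move: rz u0; rewrite Eab E scale0r addr0.
  by rewrite scaler_eq0 negb_or => + /andP[al0 _]; rewrite pt_scale.
have -> : b = be^-1 *: (u - al *: b0) by rewrite Eab addrC addKr scalerA mulVf // scale1r.
apply: scalemx_sub; apply: addmx_sub; first by apply: submx_trans uU (addsmxSl _ _).
by rewrite -scaleNr scalemx_sub ?addsmxSr.
Qed.

(** Rising by at most one per step, the rank cannot exceed the distance from [x]; since it is [D] at
    every vertex opposite to [x], it cannot fall short either. *)
Lemma rank_Umx m : \rank (Umx m) = d x m.
Proof.
have up j v : d x v = j -> (\rank (Umx v) <= j)%N.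
  elim: j v => [|j IH] v xv.
    rewrite -(d_eq0 xv) leqn0 mxrank_eq0 -submx0; apply/row_subP => i.
    by have := row_sub i (Umx x); rewrite UmxP toward_base in_set0 orbF => /eqP->; rewrite sub0mx.
  have [|z xz zv] := @dmid j x v; first by rewrite xv.
  have zv1 : d z v = 1%N by rewrite zv xv subSn // subnn.
  have [|_ le] := @rank_step z v zv1; first by rewrite xz xv.
  by apply: leq_trans le _; rewrite ltnS IH.
have low j v : (D - d x v)%N = j -> (D <= \rank (Umx v) + j)%N.
  elim: j v => [|j IH] v xv.
    have {}xv : d x v = D by apply/eqP; rewrite eqn_leq dD -subn_eq0 xv.
    rewrite addn0 -{1}(mxrank1 F D); apply: mxrankS; apply/row_subP => i.
    rewrite UmxP (toward_far xv) -implyNb; apply/implyP; exact: pt_in.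
  have [|z vz xz] := @dup x v; first by rewrite -subn_gt0 xv.
  have [_ le] := rank_step vz xz.
  have := IH z; rewrite xz subnS xv => /(_ erefl) /leq_trans -> //.
  by rewrite -addSnnS leq_add2r.
apply/eqP; rewrite eqn_leq up //=.
have := low _ m erefl; have := dD x m; nlia.
Qed.

Definition level_mark v (b : 'rV[F]_D) : F := ((b != 0) && (d v (pt b) == d x v))%:R.

(** Induction over the opposite vertices, from [y], where the form is zero. From [q] to [v] the mark
    flips exactly off the hyperplane [Umx m], [m] being the third vertex of their line. If [c]
    defines this hyperplane, [c *m ctr c] has value 1 off it, since nonzero elements have cube 1. *)
Lemma far_form v : d x v = D ->
  exists H : 'M[F]_D, ctr H = H /\ forall b, hform H b b = level_mark v b.
Proof.
move: {2}(d v y) (erefl (d v y)) => n; elim: n v => [|n IH] v vy xv.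
  rewrite (d_eq0 vy); exists 0; split=> [|b]; first by rewrite ctr0.
  rewrite /hform mulmx0 mul0mx mxE /level_mark; have [//|b0] := eqVneq b 0.
  have /ptsP[_ E] := pt_in b0; rewrite (dC y) xy -E.
  by rewrite (_ : _ == _ = false) //; apply/negbTE; rewrite neq_ltn ltnSn.
have yv : y != v by rewrite eq_sym -d0 vy.
have [q [vq qy xq]] := far_connected xy xv yv.
have [|H [HH Hq]] := IH q _ xq; first by apply: succn_inj; rewrite -vy.
pose m := th v q; have [vm qm] := th1 vq.
have xm : d x v = (d x m).+1 by rewrite (th_near vq) // xv xq.
have mv : d m v = 1%N by rewrite dC.
have Eq : th m v = q by rewrite /m thC // thK.
have [|c Hc] := @hyperplane_ex F D (Umx m); first by rewrite rank_Umx -xm xv.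
exists (H + c *m ctr c); split; first by rewrite ctrD // ctrM // ctrK // HH.
move=> b; have -> : hform (H + c *m ctr c) b b = hform H b b + (~~ (b <= Umx m)%MS)%:R.
  rewrite /hform mulmxDr mulmxDl mxE; congr (_ + _).
  have -> : b *m (c *m ctr c) *m ctr b = (b *m c) *m ctr (b *m c) by rewrite ctrM // !mulmxA.
  rewrite Hc; set X := b *m c; have -> : (X *m ctr X) 0 0 = X 0 0 ^+ 3.
    by rewrite mxE big_ord1 /ctr !mxE /hconj -exprS.
  have [E|X0] := eqVneq X 0; first by rewrite E mxE expr0n.
  rewrite F4_exp3 //; apply: contraNneq X0 => E; apply/eqP/matrixP => i j.
  by rewrite !ord1 E mxE.
rewrite Hq /level_mark UmxP; have [_|b0] := eqVneq b 0; first by rewrite addr0.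
rewrite /= xq xv; have rP := pt_in b0.
have [rm|nm] := boolP (pt b \in toward m); first by rewrite addr0 (step_same mv xm rm) Eq.
have rv : pt b \in toward v by rewrite toward_far.
have [_ E] := step_diff mv xm rv nm; move: E; rewrite Eq xv.
have [le1 le2] : (d q (pt b) <= D)%N /\ (d v (pt b) <= D)%N by rewrite !dD.
rewrite !ltn_neqAle le1 le2 !andbT; case: eqP => _; case: eqP => _ //= _.
  by rewrite F4_add.
by rewrite add0r.
Qed.

Definition Hmx v : 'M[F]_D := odflt 0 [pick H : 'M[F]_D | (ctr H == H) &&
  [forall b : 'rV_D, (b <= Umx v)%MS ==> (hform H b b == level_mark v b)]].

(** A geodesic from [x] through [v] ends at an opposite vertex [w]; the form of [w] serves for [v],
    because the marks agree on [Umx v] by [toward_geodesic]. *)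
Lemma HmxP v : ctr (Hmx v) = Hmx v /\
  forall b, (b <= Umx v)%MS -> hform (Hmx v) b b = level_mark v b.
Proof.
rewrite /Hmx; case: pickP => [H /andP[/eqP h1 /forallP h2]|none].
  by split=> // b bU; apply/eqP; move/implyP: (h2 b); apply.
have [w xw vw] := far_ex v; have [H [HH Hw]] := far_form xw.
have := none H; rewrite HH eqxx /= => /negbT/forallPn[b].
rewrite negb_imply => /andP[bU]; rewrite Hw /level_mark.
have [b0|b0] := eqVneq b 0; first by rewrite eqxx.
move: bU; rewrite UmxP (negbTE b0) /= => tv; case/eqP.
have [|tw E] := @toward_geodesic v w _ _ tv; first by rewrite xw.
move: tw tv; rewrite !towardE !(dC _ x) => /andP[_ l1] /andP[_ l2].
by move: E; rewrite !ltn_neqAle l1 l2 !andbT => /negb_inj->.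
Qed.

Definition dual_polar_map v := <<Wmx (Umx v) (Hmx v)>>%MS.

Lemma dual_polar_map_vertex v : vertex (dual_polar_map v).
Proof.
apply: vertex_genmx => //; first by rewrite rank_Wmx.
by apply/eqP/Wmx_isotropic => //; have [] := HmxP v.
Qed.

(** Equal graphs have the same subspace and the same form on it, so [v] and [v'] have the same
    distances to all of [pts]. *)
Lemma dual_polar_map_inj : injective dual_polar_map.
Proof.
move=> v v' /eqP E; have /andP[le1 le2] : (Wmx (Umx v) (Hmx v) == Wmx (Umx v') (Hmx v'))%MS.
  by apply/genmxP/eqP.
have [U1 Z1] := Wmx_subP le1; have [U2 _] := Wmx_subP le2.
have xv : d x v = d x v'.
  by rewrite -!rank_Umx; apply/eqP; rewrite eqn_leq !mxrankS.
apply: pts_inj => // r rP; have [b b0 Eb] := pt_surj rP.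
have mem z : (b <= Umx z)%MS = (r \in toward z) by rewrite UmxP (negbTE b0) Eb.
have /ptsP[xr _] := rP; have h1 := dnbr v xr; have h2 := dnbr v' xr.
rewrite !(dC _ x) -xv in h1 h2.
have [bU|bU] := boolP (b <= Umx v)%MS.
  have bU' := submx_trans bU U1; have [_ F1] := HmxP v; have [_ F2] := HmxP v'.
  have := hform_sub_eq0 cardF Z1 bU bU'.
  have -> : hform (Hmx v' - Hmx v) b b = hform (Hmx v') b b - hform (Hmx v) b b.
    by rewrite /hform mulmxBr mulmxBl !mxE.
  rewrite F1 // F2 // /level_mark b0 Eb -xv /= => /eqP; rewrite subr_eq0.
  rewrite mem in bU; rewrite mem in bU'; move: bU bU'; rewrite !towardE !(dC _ x) -xv.
  move=> /andP[_ l1] /andP[_ l2].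
  have [e1|n1] := eqVneq (d v r) (d x v); have [e2|n2] := eqVneq (d v' r) (d x v).
  - by rewrite e1.
  - by rewrite eq_sym oner_eq0.
  - by rewrite oner_eq0.
  - move=> _; have g1 : (d v r < d x v)%N by rewrite ltn_neqAle n1.
    have g2 : (d v' r < d x v)%N by rewrite ltn_neqAle n2.
    nlia.
have bU' : ~~ (b <= Umx v')%MS by apply: contra bU => /submx_trans; exact.
move: bU bU'; rewrite !mem !towardE rP /= !(dC _ x) -xv -!ltnNge => l1 l2; nlia.
Qed.

Lemma blocks_rank (U' U G : 'M[F]_D) : (\rank U').+1 = \rank U ->
  \rank (block_mx U' 0 0 (kermx (ctr U)) *m shear G) = D.-1.
Proof.
move=> r; rewrite rank_blocks //; have := rank_leq_row U; rewrite -r => le; nlia.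
Qed.

Lemma sub_adjacent v v' (K : 'M[F]_(D + D)) : v != v' -> \rank K = D.-1 ->
  (K <= Wmx (Umx v) (Hmx v))%MS -> (K <= Wmx (Umx v') (Hmx v'))%MS ->
  adjacent (dual_polar_map v) (dual_polar_map v').
Proof.
move=> ne rK K1 K2; have [g1 r1 _] := vertexP (dual_polar_map_vertex v).
have [g2 r2 _] := vertexP (dual_polar_map_vertex v').
set A := dual_polar_map v in g1 r1 *; set B := dual_polar_map v' in g2 r2 *.
have le1 : (\rank K <= \rank (A :&: B)%MS)%N by apply: mxrankS; rewrite sub_capmx !genmxE K1.
have le2 := mxrankS (capmxSl A B); rewrite r1 in le2; rewrite rK in le1.
rewrite /adjacent eqn_leq le1 andbT.
have : \rank (A :&: B)%MS != D.
  apply: contra ne => /eqP r; apply/eqP/dual_polar_map_inj; rewrite -/A -/B -g1 -g2.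
  apply/genmxP/eqmxP; apply: (@eqmx_trans _ _ _ _ _ _ (A :&: B)%MS).
    apply/eqmx_sym/eqmxP; by rewrite -(geq_leqif (mxrank_leqif_eq (capmxSl A B))) r r1.
  apply/eqmxP; by rewrite -(geq_leqif (mxrank_leqif_eq (capmxSr A B))) r r2.
move=> ne'; have lt : (\rank (A :&: B)%MS < D)%N by rewrite ltn_neqAle ne'.
nlia.
Qed.

Lemma adjacent_step z z' : d z z' = 1%N -> d x z' = (d x z).+1 ->
  adjacent (dual_polar_map z) (dual_polar_map z').
Proof.
move=> zz' xz'; have [sub _] := rank_step zz' xz'.
have zne : z != z' by rewrite -d0 zz'.
have [HH Hz] := HmxP z; have [HH' Hz'] := HmxP z'.
apply: (sub_adjacent zne (K := block_mx (Umx z) 0 0 (kermx (ctr (Umx z'))) *m shear (Hmx z'))).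
- by rewrite blocks_rank // !rank_Umx xz'.
- apply: blocks_sub_Wmx => //; apply: hform_mx_eq0 => u v uU vU.
  apply: hform_polar => //; first by rewrite ctrB // HH HH'.
  have Z b : (b <= Umx z)%MS -> hform (Hmx z' - Hmx z) b b = 0.
    move=> bU; have bU' := submx_trans bU sub.
    have -> : hform (Hmx z' - Hmx z) b b = hform (Hmx z') b b - hform (Hmx z) b b.
      by rewrite /hform mulmxBr mulmxBl !mxE.
    rewrite Hz // Hz' // /level_mark; have [_|b0] := eqVneq b 0; first by rewrite subrr.
    move: bU; rewrite UmxP (negbTE b0) /= => tz; have [tz' E] := step_dist zz' xz' tz.
    move: E tz tz'; rewrite !towardE !(dC _ x) => E /andP[_ l1] /andP[_ l2].
    by move: E; rewrite !ltn_neqAle l1 l2 !andbT => /negb_inj->; rewrite subrr.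
  by move=> l; rewrite !Z // addmx_sub // scalemx_sub.
by apply: blocks_sub_Wmx => //; rewrite subrr mulmx0 mul0mx.
Qed.

(** The subspaces of [v] and [v'] coincide, and their forms differ by the indicator of the
    complement of [Umx m]. Adding a vector of [Umx m] does not change it, so by [hform_polar] the
    difference vanishes on [Umx m] times [Umx v], and the graphs share a block of rank [D - 1]. *)
Lemma adjacent_level v v' : d v v' = 1%N -> d x v = d x v' ->
  adjacent (dual_polar_map v) (dual_polar_map v').
Proof.
move=> vv' xvv'; pose m := th v v'; have [vm v'm] := th1 vv'.
have xm : d x v = (d x m).+1 by rewrite (th_near vv').
have xm' : d x v' = (d x m).+1 by rewrite -xvv'.
have mv : d m v = 1%N by rewrite dC.
have mv' : d m v' = 1%N by rewrite dC.
have Ev' : th m v = v' by rewrite /m thC // thK.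
have Ev : th m v' = v by rewrite thC ?Ev' // /m -(thC vv') thK // dC.
have [sub _] := rank_step mv xm; have [sub' _] := rank_step mv' xm'.
have tw z z' : d m z = 1%N -> d x z = (d x m).+1 -> th m z = z' -> toward z \subset toward z'.
  move=> mz xz Ez; apply/subsetP => r rz; have [rm|nm] := boolP (r \in toward m).
    have xz' : d x z' = (d x m).+1 by rewrite -Ez th_far.
    by have [mz' _] := th1 mz; rewrite Ez in mz'; have [] := step_dist mz' xz' rm.
  by rewrite -Ez; have [] := step_diff mz xz rz nm.
have le1 := Umx_le (tw _ _ mv xm Ev'); have le2 := Umx_le (tw _ _ mv' xm' Ev).
have vne : v != v' by rewrite -d0 vv'.
have [HH Hz] := HmxP v; have [HH' Hz'] := HmxP v'.
apply: (sub_adjacent vne (K := block_mx (Umx m) 0 0 (kermx (ctr (Umx v))) *m shear (Hmx v))).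
- by rewrite blocks_rank // !rank_Umx xm.
- by apply: blocks_sub_Wmx => //; rewrite subrr mulmx0 mul0mx.
apply: blocks_sub_Wmx => //; apply: hform_mx_eq0 => u w uU wU.
apply: hform_polar => //; first by rewrite ctrB // HH HH'.
have Z b : (b <= Umx v)%MS -> hform (Hmx v - Hmx v') b b = (~~ (b <= Umx m)%MS)%:R.
  move=> bU; have bU' := submx_trans bU le1.
  have -> : hform (Hmx v - Hmx v') b b = hform (Hmx v) b b - hform (Hmx v') b b.
    by rewrite /hform mulmxBr mulmxBl !mxE.
  rewrite Hz // Hz' // /level_mark UmxP; have [_|b0] := eqVneq b 0; first by rewrite subrr.
  rewrite /= -xvv'; have [rm|nm] := boolP (pt b \in toward m).
    by rewrite (step_same mv xm rm) Ev' subrr.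
  move: bU bU'; rewrite !UmxP (negbTE b0) /= => tv tv'.
  have [_ E] := step_diff mv xm tv nm; move: E tv tv'; rewrite Ev' !towardE !(dC _ x) -xvv'.
  move=> E /andP[_ l1] /andP[_ l2]; move: E; rewrite !ltn_neqAle l1 l2 !andbT.
  by case: eqP => _; case: eqP => _ //= _; rewrite ?subr0 // sub0r F4_opp.
move=> l; have wV := submx_trans wU le2; have uV := submx_trans uU sub.
have luU : (l *: u <= Umx m)%MS by rewrite scalemx_sub.
rewrite !Z //; last by rewrite addmx_sub // scalemx_sub.
congr (~~ _)%:R; apply/idP/idP => [h|h]; last by rewrite addmx_sub.
have -> : w = (w + l *: u) - l *: u by rewrite addrK.
by rewrite addmx_sub // eqmx_opp.
Qed.

Lemma adjacent_map v v' : d v v' = 1%N -> adjacent (dual_polar_map v) (dual_polar_map v').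
Proof.
move=> vv'; have [h1 h2] := dnbr x vv'.
have [E|[E|E]] : d x v = d x v' \/ d x v' = (d x v).+1 \/ d x v = (d x v').+1 by nlia.
- exact: adjacent_level.
- exact: adjacent_step.
- by rewrite /adjacent capmxC; apply: adjacent_step; rewrite // dC.
Qed.

Hypothesis regular : forall v, #|[set r | d v r == 1%N]| = #|[set r | d x r == 1%N]|.

Lemma card_pts : ((4 ^ D).-1 <= 3 * #|pts|)%N.
Proof.
have -> : (4 ^ D).-1 = #|[set v : 'rV[F]_D | v != 0]|.
  have := cardsC1 (0 : 'rV[F]_D); rewrite card_mx cardF mul1n => <-.
  by apply: eq_card => v; rewrite !inE.
rewrite -sum1_card (partition_big pt [in pts]) => [|v]; last by rewrite inE; exact: pt_in.
rewrite mulnC -sum_nat_const; apply: leq_sum => r rP; have [v0 v00 <-] := pt_surj rP.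
rewrite sum1_card; apply: (@leq_trans #|[set l *: v0 | l in [set~ (0 : F)]]|).
  apply/subset_leq_card/subsetP => v; rewrite unfold_in inE => /andP[vn /eqP E].
  have [l El] := (pt_eq v00 vn).1 (esym E).
  by apply/imsetP; exists l; rewrite // !inE; apply: contraNneq vn => l0; rewrite El l0 scale0r.
by apply: leq_trans (leq_imset_card _ _) _; rewrite cardsC1 cardF.
Qed.

Let D_gt0 : (0 < D)%N. Proof. exact: ltnW. Qed.

(** [v] has twice [#|pts|], so at least 2(4^D - 1)/3, neighbours with distinct images adjacent to
    its own image; by [card_neighbours] there is room for no others. *)
Lemma neighbour_map v B : vertex B -> adjacent (dual_polar_map v) B ->
  exists2 v', d v v' = 1%N & dual_polar_map v' = B.
Proof.
move=> vB aB; set N := [set B | vertex B && adjacent (dual_polar_map v) B].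
have sub : [set dual_polar_map v' | v' in [set r | d v r == 1%N]] \subset N.
  apply/subsetP => _ /imsetP[v' + ->]; rewrite !inE => /eqP vv'.
  by rewrite dual_polar_map_vertex adjacent_map.
have cN := card_neighbours cardF D_gt0 (dual_polar_map_vertex v).
have : [set dual_polar_map v' | v' in [set r | d v r == 1%N]] == N.
  rewrite eqEcard sub card_imset; last exact: dual_polar_map_inj.
  rewrite regular card_nbr_pts /=; have := card_pts; move: cN; rewrite -/N.
  by move: #|_| (4 ^ D).-1 #|_| => k1 k2 k3; lia.
move/eqP => EN; have : B \in N by rewrite inE vB.
by rewrite -EN => /imsetP[v' + ->]; rewrite inE => /eqP vv'; exists v'.
Qed.

Lemma dual_polar_map_surj B : vertex B -> exists v, dual_polar_map v = B.
Proof.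
move=> vB; pose X : pred 'M[F]_(D + D) := fun B => B \in codom dual_polar_map.
suff /codomP[v ->] : X B by exists v.
apply: (@dual_polar_connected F cardF D D_gt0 X (dual_polar_map x)) vB => [|A|A C].
- exact: codom_f.
- by case/codomP => v ->; exact: dual_polar_map_vertex.
- by case/codomP => v -> vC /(neighbour_map vC)[v' _ <-]; exact: codom_f.
Qed.

Lemma dual_polar_map_adjacent v v' : (d v v' == 1%N) = adjacent (dual_polar_map v) (dual_polar_map v').
Proof.
apply/eqP/idP => [|a]; first exact: adjacent_map.
have [w vw /dual_polar_map_inj <-] := neighbour_map (dual_polar_map_vertex v') a.
exact: vw.
Qed.

End DualPolarModel.

Lemma near_polygon_dual_polar (F : finFieldType) : #|F| = 4 ->
  (forall v, #|[set r | d v r == 1]| = #|[set r | d x r == 1]|) ->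
  exists f : T -> 'M[F]_(D + D), [/\ injective f, forall v, vertex (f v),
    forall B, vertex B -> exists v, f v = B &
    forall v v', (d v v' == 1) = adjacent (f v) (f v')].
Proof.
move=> cardF reg; have [pt ptH] := pts_coordinates cardF; exists (dual_polar_map pt); split.
- exact: dual_polar_map_inj.
- exact: dual_polar_map_vertex.
- exact: dual_polar_map_surj.
- exact: dual_polar_map_adjacent.
Qed.

End Base.
End NearPolygon.

(** * From the graph to the near polygon, and the final form of the statement *)

Lemma drg_dual_polar (T : finType) (e : rel T) (b c : nat -> nat) (F : finFieldType) :
  distance_regular e b c -> 2 <= diameter e -> b 0 - b 1 - c 1 = 1 -> 5 <= c 2 ->
  eigenvalue (adjmx e) (- ((b 0%N)%:R) / 2)%R -> #|F| = 4 ->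
  c 2 = 5 /\ exists f : T -> 'M[F]_(diameter e + diameter e),
    [/\ injective f, forall v, vertex (f v),
    forall B, vertex B -> exists v, f v = B &
    forall v v', e v v' = adjacent (f v) (f v')].
Proof.
move=> drg D2 a1 c25 eig cardF; have [[e_sym e_irr] e_con _] := drg.
have th_eig := rational_eigenfun e_sym eig.
split; first exact: c2_eq5 drg a1 D2 th_eig c25.
have D0 : 0 < diameter e by exact: ltnW.
have [x [y xy]] := diam_pair D0.
have d1 u v : (gdist e u v == 1) = e u v by exact: gdist1.
have d1P u v : gdist e u v = 1 -> e u v by move/eqP; rewrite d1.
have d1I u v : e u v -> gdist e u v = 1 by rewrite -d1 => /eqP.
have midE u v : mid (gdist e) u v = cnbr e u v by apply/setP => z; rewrite !inE !d1.
have [||||||||||||f [f1 f2 f3 f4]] := @near_polygon_dual_polar T (gdist e) (third e) (diameter e)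
   _ _ _ _ _ _ _ _ _ _ _ x y xy D2 F cardF.
- exact: gdist0.
- exact: gdistC.
- exact: gdist_tri.
- by move=> i u v; exact: gdist_mid.
- exact: gdist_diam.
- by move=> u v /(gdist_up drg)[z /d1I vz uz]; exists z.
- by move=> u v /d1P /(third_edge drg a1 D2)/andP[/d1I uw /d1I vw].
- move=> u v w /d1P uv /d1P uw /d1P vw; apply/eqP.
  by rewrite -(thirdP drg a1 D2 w uv) uw vw.
- by move=> u v uv; rewrite midE (card_cnbr drg uv) (c2_eq5 drg a1 D2 th_eig c25).
- by move=> p u v /d1P uv; exact: (wt_line drg a1 D2 th_eig c25 p uv).
- by move=> p u v uv; rewrite midE; exact: (wt_rel drg a1 D2 th_eig c25 p uv).
- have cN u : #|[set r | gdist e u r == 1]| = b 0.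
    by rewrite -(card_nbr drg u); apply: eq_card => r; rewrite !inE d1.
  by move=> v; rewrite !cN.
by exists f; split=> // u v; rewrite -d1.
Qed.

(** The size [N] is kept general so that [D + D = N] can be substituted: [D + D] and [D.*2] are not
    convertible for a variable [D]. *)
Lemma dual_polar_hermitian (T : finType) (e : rel T) (D N : nat) (F : finFieldType) :
  #|F| = 4 -> D + D = N ->
  (exists f : T -> 'M[F]_(D + D),
    [/\ injective f, forall v, vertex (f v),
    forall B, vertex B -> exists v, f v = B &
    forall v v', e v v' = adjacent (f v) (f v')]) ->
  exists M : 'M[F]_N,
    [/\ M \in unitmx, M^T%R = map_mx (hconj 2) M &
    exists f : T -> 'M[F]_N,
      [/\ injective f,
          forall x, [&& (<<f x>>%MS == f x), \rank (f x) == D &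
             (f x *m M *m (map_mx (hconj 2) (f x))^T == 0)%R],
          forall A : 'M[F]_N, [&& (<<A>>%MS == A), \rank A == D &
             (A *m M *m (map_mx (hconj 2) A)^T == 0)%R] -> exists x, f x = A &
          forall x y, e x y = (\rank (f x :&: f y)%MS == D.-1)]].
Proof.
move=> cardF <- [f [f1 f2 f3 f4]]; exists (hyp F D); split; first exact: hyp_unit.
  by rewrite -{1}(ctr_hyp cardF) /ctr trmxK.
by exists f; split.
Qed.

Theorem theorem1p2 (T : finType) (e : rel T) (b c : nat -> nat) (D : nat) :
  distance_regular e b c ->
  diameter e = D ->
  3 <= b 0 ->
  2 <= D ->
  b 0 - b 1 - c 1 = 1 ->
  5 <= c 2 ->
  least_eigenvalue (adjmx e) (- ((b 0%N)%:R) / 2)%R ->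
  c 2 = 5 /\ is_hermitian_dual_polar e D 2.
Proof.
move=> drg <- _ D2 a1 c25 [eig _].
have [F _ cardF] := pPrimePowerField (isT : prime 2) (isT : 0 < 2).
have [c5 ex] := drg_dual_polar drg D2 a1 c25 eig cardF.
split=> //; exists F; split; first exact: cardF.
exact: dual_polar_hermitian cardF (addnn _) ex.
Qed.
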